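(* One has $$\sum_{n=0}^\infty(4n+1)\frac{\binom{2n}{n}^6}{2^{12n}}\left[64H_{2n}^{(7)}-\bigl(8H_{2n}^{(3)}-\zeta(3)\bigr)\bigl(8H_{2n}^{(4)}-H_n^{(4)}\bigr)\right]=\frac{8\zeta(7)}{\pi^4}\,s_{4,0},$$ where $s_{4,0}=\int_0^\infty I_0(t)K_0(t)^3\,dt$.
   Context: $H_n^{(r)}=\sum_{k=1}^n k^{-r}$, with $H_0^{(r)}=0$; $\zeta$ is the Riemann zeta function; $I_0,K_0$ are the modified Bessel functions of the first and second kinds of order zero. *)

(* Defs.v *)
From mathcomp Require Import all_boot all_order all_algebra.
From mathcomp Require Import all_classical all_reals all_analysis.

Set Implicit Arguments.
Unset Strict Implicit.
Unset Printing Implicit Defensive.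

Import Order.TTheory GRing.Theory Num.Theory.
Import numFieldNormedType.Exports.

Local Open Scope classical_set_scope.
Local Open Scope ring_scope.

Definition harmonic_number (R : realType) (r n : nat) : R :=
  \sum_(1 <= k < n.+1) k%:R ^- r.

(* Only the values at integers s >= 2 are meaningful: for s = 0, 1 the series
   diverges and limn returns an arbitrary value. *)
Definition zeta (R : realType) (s : nat) : R :=
  limn (series (fun k : nat => (k.+1%:R : R) ^- s)).

(* I_0(t) = sum_k (t^2/4)^k / (k!)^2 *)
Definition besselI0 (R : realType) (t : R) : R :=
  limn (series (fun k : nat => (t / 2) ^+ (2 * k) / (k`!%:R) ^+ 2)).

Definition cosh (R : realType) (u : R) : R := (expR u + expR (- u)) / 2.

(* K_0(t) = int_0^oo exp (- t cosh u) du, meaningful for t > 0 only: the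
   integral diverges for t <= 0, where Rintegral returns 0. *)
Definition besselK0 (R : realType) (t : R) : R :=
  \int[@lebesgue_measure R]_(u in `[0, +oo[) expR (- (t * cosh u)).

(* The endpoint 0 is excluded because K_0 has a logarithmic singularity there.
   The integrand is nonnegative, so the Lebesgue integral agrees with the
   improper Riemann integral. *)
Definition s40 (R : realType) : R :=
  \int[@lebesgue_measure R]_(t in `]0, +oo[) (besselI0 t * besselK0 t ^+ 3).

(* Main.v *)
(* Write c_n = binom(2n, n) / 4^n and S = sum_n (4n+1) c_n^6. Both sides equal zeta(7) S / 2.

   Left-hand side. Let A_n(s, t) be the Legendre coefficients of the function obtained by putting
   z = 1 - x^2 in 2F1(a, b; 1; z), where a + b = 1 + s and (a - 1/2)(b - 1/2) - s/2 = t. Gauss's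
   theorem gives them in closed form. By Parseval's identity, sum_n (4n+1) A_n(s, t) A_n(-s, -t)
   is the integral of a product of two such functions, and Euler's transformation of
   both factors shows that it is even in s. Up to a factor even in s, it is
     sum_n (4n+1) c_n^6 prod_w (1 - (s/w + t/w^2)^2),
   where w ranges over 1/2, ..., n - 1/2, -(n+1), -(n+2), ... Put t = x, s = x^3 and compare the
   coefficients of x^4 and x^6 with those for s = -x^3: the weighted sums of O_3 and of
   O_3 O_4 - O_7 vanish, where O_r is the sum of the w^-r. This evaluates the left-hand side.

   Right-hand side. K_0(t)^2 is a double integral of exp(-2 t cosh q cosh r), and the Laplace
   transform of I_0 is 1 / sqrt(a^2 - 1), so s_{4,0} is a triple integral of algebraic functions
   of hyperbolic functions. A Landen transformation of the innermost integral and the binomial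
   series give s_{4,0} = (pi^3/8) sum_k c_k^2 M_k with M_k = sum_j c_j^2 c_{k-j}. Finally
   M_k = sum_n (4n+1) m_{k,n} c_n^3, with m_{k,n} the Legendre moments of (1 - x^2)^k, and
   sum_k c_k^2 m_{k,n} = A_n(0, 0) = (pi/2) c_n^3, so that s_{4,0} = (pi^4/16) S. *)

Require Import Defs.
From mathcomp Require Import all_boot all_order all_algebra.
From mathcomp Require Import all_classical all_reals all_analysis.
From mathcomp Require Import measurable_realfun.
From mathcomp Require Import ring lra zify.

Set Implicit Arguments.
Unset Strict Implicit.
Unset Printing Implicit Defensive.

Import Order.TTheory GRing.Theory Num.Theory.
Import numFieldNormedType.Exports.

Local Open Scope classical_set_scope.
Local Open Scope ring_scope.

(** * Moments of (1 - x^2)^k against the even Legendre polynomials *)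

Section LegendreMoments.
Context {R : realFieldType}.
Implicit Types k l n N : nat.

(** Legendre polynomials, 2F1 and the Gamma function never occur as functions. They are replaced by
    the rational moments [legm], whose recurrences contain the orthogonality, by power series
    coefficients in the symmetric parameters [s], [t], and by Gauss's theorem in the form of an
    infinite product. Sums and integrals are interchanged for nonnegative terms in the extended
    reals, which is why [s], [t] stay in the region [admissible].

    What is wanted from evenness in s is the part linear in s. Differentiation under the sum is
    avoided by moving along t = x, s = +-x^3. The monomials odd in s are s t (t^2)^k (s^2)^l, of
    order x^(4 + 2k + 6l), so that orders 4 and 6 see only s t and s t^3; with s = x the monomials s
    t^3 and s^3 t would collide. Each factor is then a polynomial in y = x^2, and the remainder is
    at most a constant times y^4, uniformly in n, hence summable against the weights. The zeta(4)
    inside O_4 drops out because the weighted sum of O_3 vanishes; the zeta(7) inside O_7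
    survives. *)

Definition cbin n : R := 'C(2 * n, n)%:R / 4 ^+ n.

Lemma cbin0 : cbin 0 = 1.
Proof. by rewrite /cbin bin0 expr0 divr1. Qed.

Lemma cbinS n : cbin n.+1 = cbin n * ((2 * n%:R + 1) / (2 * n%:R + 2)).
Proof.
have e : ('C(2 * n.+1, n.+1) * (n.+1) = 'C(2 * n, n) * (2 * (2 * n + 1)))%N.
  have f1 : ('C(2 * n.+1, n.+1) * (n.+1`! * n.+1`!) = (2 * n.+1)`!)%N.
    have h : (n.+1 <= 2 * n.+1)%N by lia.
    by rewrite -(bin_fact h) (_ : (2 * n.+1 - n.+1 = n.+1)%N) //; lia.
  have f2 : ('C(2 * n, n) * (n`! * n`!) = (2 * n)`!)%N.
    have h : (n <= 2 * n)%N by lia.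
    by rewrite -(bin_fact h) (_ : (2 * n - n = n)%N) //; lia.
  have f3 : ((2 * n.+1)`! = (2 * n + 2) * (2 * n + 1) * (2 * n)`!)%N.
    rewrite (_ : (2 * n.+1 = (2 * n).+2)%N) ?factS; last by lia.
    by rewrite mulnA; congr (_ * _ * _)%N; lia.
  move: f1; rewrite f3 -f2 factS => f1.
  have g : (0 < n.+1 * (n`! * n`!))%N by rewrite !muln_gt0 fact_gt0.
  by apply/eqP; rewrite -(eqn_pmul2r g); apply/eqP; nia.
have /(congr1 (fun m => m%:R : R)) := e.
rewrite !natrM /cbin exprS => er.
have n1 : (n.+1%:R : R) != 0 by rewrite pnatr_eq0.
have -> : 'C(2 * n.+1, n.+1)%:R = 'C(2 * n, n)%:R * (2 * (2 * n + 1)%:R) / n.+1%:R :> R.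
  by rewrite -er mulfK.
have x4 : (4 : R) ^+ n != 0 by rewrite expf_neq0 // pnatr_eq0.
rewrite natrD natrM -addn1 natrD in n1 *.
have n0 : 0 <= n%:R :> R by [].
by clear e er; field; rewrite x4 /=; apply/andP; split; lra.
Qed.

Lemma cbin_gt0 n : 0 < cbin n.
Proof.
by elim: n => [|n IH]; rewrite ?cbin0 // cbinS mulr_gt0 // divr_gt0 //;
  have : 0 <= n%:R :> R by []; lra.
Qed.

Lemma cbin_sqr_le n : cbin n ^+ 2 * (2 * n%:R + 1) <= 1.
Proof.
elim: n => [|n IH]; first by rewrite cbin0; lra.
apply: le_trans IH; rewrite cbinS exprMn -mulrA ler_wpM2l ?sqr_ge0 //.
have n0 : 0 <= n%:R :> R by [].
rewrite expr_div_n -mulrA mulrC -mulrA mulrC ler_pdivrMr; last by apply: exprn_gt0; lra.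
rewrite -natr1; nra.
Qed.

(* Up to the sign [(-1) ^ n], the integral over [0, 1] of [(1 - x ^ 2) ^ k] times the
   Legendre polynomial of degree [2n]. *)
Fixpoint legm k n : R :=
  if n is p.+1 then legm k p *
    ((2 * p%:R + 1) / (2 * p%:R + 2) * ((k%:R - p%:R) / (k%:R + p%:R + 3 / 2)))
  else \prod_(j < k) ((j%:R + 1) / (j%:R + 3 / 2)).

Lemma legm_gt n k : (k < n)%N -> legm k n = 0.
Proof.
elim: n => // n IH; rewrite ltnS leq_eqVlt => /predU1P[->|/IH /= ->]; last by rewrite mul0r.
by rewrite /= subrr mul0r !mulr0.
Qed.

(** Stated without division because k + 1 - n vanishes at n = k + 1. *)
Lemma legm_row k n : legm k.+1 n * ((k%:R + 1 - n%:R) * (k%:R + 3 / 2 + n%:R)) =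
  legm k n * (k%:R + 1) ^+ 2.
Proof.
have k0 : 0 <= k%:R :> R by [].
elim: n => [|n IH].
  by rewrite /= big_ord_recr /=; field; lra.
have n0 : 0 <= n%:R :> R by [].
transitivity (legm k.+1 n * ((k%:R + 1 - n%:R) * (k%:R + 3 / 2 + n%:R)) *
   ((2 * n%:R + 1) / (2 * n%:R + 2) * ((k%:R - n%:R) / (k%:R + n%:R + 3 / 2)))).
  rewrite /= -!natr1; field; apply/and3P; split; lra.
by rewrite IH /=; ring.
Qed.

(** With m = 2 (n + 1), these are the coefficients in the expansion of x^2 P_m in P_{m-2}, P_m,
    P_{m+2}; the alternating sign built into [legm] makes the two outer ones positive. *)
Lemma legm_three_term k n : legm k.+1 n.+1 =
  legm k n.+1 * (1 - (8 * n.+1%:R ^+ 2 + 4 * n.+1%:R - 1)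
                     / ((4 * n.+1%:R - 1) * (4 * n.+1%:R + 3)))
  + legm k n.+2 * ((2 * n.+1%:R + 1) * (2 * n.+1%:R + 2)
                   / ((4 * n.+1%:R + 1) * (4 * n.+1%:R + 3)))
  + legm k n * (2 * n.+1%:R * (2 * n.+1%:R - 1)
                   / ((4 * n.+1%:R - 1) * (4 * n.+1%:R + 1))).
Proof.
have k0 : 0 <= k%:R :> R by [].
have n0 : 0 <= n%:R :> R by [].
have -> : legm k.+1 n.+1 = legm k n * ((2 * n%:R + 1) / (2 * n%:R + 2) *
   (k%:R + 1) ^+ 2 / ((k%:R + n%:R + 3 / 2) * (k%:R + n%:R + 5 / 2))).
  (* The factor (k + 1)^2 lets [legm_row] be read from right to left, so that nothing is divided by
     k + 1 - n. *)
  have -> : legm k n = legm k n * (k%:R + 1) ^+ 2 / (k%:R + 1) ^+ 2.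
    by rewrite mulfK // expf_neq0 //; lra.
  rewrite -legm_row /= -natr1; field; apply/and4P; split; lra.
rewrite /= -!natr1; field; do !(apply/andP; split); lra.
Qed.

Lemma legm_three_term0 k : legm k.+1 0 =
  legm k 0 * (2 / 3) + legm k 1 * (2 / 3).
Proof.
have k0 : 0 <= k%:R :> R by [].
by rewrite /= big_ord_recr /=; field; lra.
Qed.

(* Multiplication by [1 - x ^+ 2] is symmetric for the Legendre basis; the
   right-hand side is the boundary term of the truncated sums. *)
Lemma legm_shift k l N :
  \sum_(n < N.+1) (4 * n%:R + 1) * (legm k.+1 n * legm l n - legm k n * legm l.+1 n) =
  (2 * N%:R + 1) * (2 * N%:R + 2) / (4 * N%:R + 3) *
    (legm k N.+1 * legm l N - legm k N * legm l N.+1).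
Proof.
elim: N => [|N IH].
  rewrite big_ord1; have -> : nat_of_ord (@ord0 0) = 0%N by [].
  by rewrite !legm_three_term0; field.
rewrite big_ord_recr IH.
have -> : nat_of_ord (@ord_max N.+1) = N.+1 by [].
have n0 : 0 <= N%:R :> R by [].
rewrite !legm_three_term.
move: (legm k N.+2) (legm k N.+1) (legm k N) (legm l N.+2) (legm l N.+1) (legm l N).
move=> a b c d e f; rewrite -!natr1 /=; field; do !(apply/andP; split); lra.
Qed.

(** Factors 1 - x^2 move one at a time from l to k by [legm_shift]; the boundary term vanishes
    because the moments are zero for n > k. At l = 0 only n = 0 is left. *)
Lemma legm_parseval k l N : (k + l < N)%N ->
  \sum_(n < N) (4 * n%:R + 1) * (legm k n * legm l n) = legm (k + l) 0.
Proof.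
elim: l k N => [|l IH] k N.
  case: N => // N _; rewrite big_ord_recl big1 ?addr0.
    by rewrite addn0 /= big_ord0; ring.
  by move=> i _; rewrite [legm 0 _]legm_gt // !mulr0.
case: N => // N; rewrite addnS ltnS => klN.
rewrite -addSn -(IH k.+1 N.+1); last by lia.
apply/eqP; rewrite -subr_eq0 -sumrB; apply/eqP.
transitivity (- \sum_(n < N.+1) (4 * n%:R + 1) *
    (legm k.+1 n * legm l n - legm k n * legm l.+1 n)).
  by rewrite -sumrN; apply: eq_bigr => i _; ring.
rewrite legm_shift !(@legm_gt N.+1) ?mul0r ?mulr0 ?subrr ?mulr0 ?oppr0 //; lia.
Qed.

Lemma legm_ge0 k n : 0 <= legm k n.
Proof.
have k0 : 0 <= k%:R :> R by [].
elim: n => [|n IH]; first by apply: prodr_ge0 => j _; rewrite divr_ge0 //; have : 0 <= j%:R :> R by []; lra.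
have n0 : 0 <= n%:R :> R by [].
have [kn|nk] := leqP k n; first by rewrite legm_gt.
have : n%:R <= k%:R :> R by rewrite ler_nat ltnW.
by move=> ?; rewrite /= mulr_ge0 // mulr_ge0 // divr_ge0 //; lra.
Qed.

Lemma legm_le k n : legm k n <= legm k 0.
Proof.
have k0 : 0 <= k%:R :> R by [].
elim: n => // n IH; apply: le_trans IH.
have n0 : 0 <= n%:R :> R by [].
have [kn|nk] := leqP k n; first by rewrite legm_gt // legm_ge0.
have : n%:R <= k%:R :> R by rewrite ler_nat ltnW.
move=> ?; rewrite /= ler_piMr ?legm_ge0 //.
by rewrite mulr_ile1 ?divr_ge0 ?ler_pdivrMr //; lra.
Qed.

End LegendreMoments.

(** * Cauchy products of sequences *)

Section Convolution.
Context {R : realFieldType}.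
Implicit Types a b c : nat -> R.

Definition cauchy_prod a b n : R := \sum_(i < n.+1) a i * b (n - i)%N.

Lemma eq_cauchy_prod a a' b b' : a =1 a' -> b =1 b' -> cauchy_prod a b =1 cauchy_prod a' b'.
Proof. by move=> aa bb n; apply: eq_bigr => i _; rewrite aa bb. Qed.

(** Below degree N the product is that of truncated polynomials, whose ring laws give commutativity
    and associativity. *)
Lemma cauchy_prodM a b N n : (n < N)%N ->
  cauchy_prod a b n = ((\poly_(i < N) a i) * (\poly_(i < N) b i))`_n.
Proof.
move=> nN; rewrite coefM; apply: eq_bigr => i _.
rewrite !coef_poly (leq_trans (ltn_ord i) nN).
by rewrite (leq_ltn_trans (leq_subr i n) nN).
Qed.

Lemma cauchy_prodC a b : cauchy_prod a b =1 cauchy_prod b a.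
Proof. by move=> n; rewrite !(@cauchy_prodM _ _ n.+1) // mulrC. Qed.

Lemma cauchy_prodA a b c : cauchy_prod a (cauchy_prod b c) =1 cauchy_prod (cauchy_prod a b) c.
Proof.
move=> n.
have e x y : cauchy_prod x y n = \sum_(i < n.+1) x i * y (n - i)%N by [].
have -> : cauchy_prod a (cauchy_prod b c) n = ((\poly_(i < n.+1) a i) *
    ((\poly_(i < n.+1) b i) * (\poly_(i < n.+1) c i)))`_n.
  rewrite coefM e; apply: eq_bigr => i _.
  by rewrite coef_poly ltn_ord (@cauchy_prodM _ _ n.+1) // ltnS leq_subr.
rewrite mulrA coefM e; apply: eq_bigr => i _.
by rewrite -cauchy_prodM // coef_poly ltnS leq_subr.
Qed.

End Convolution.

(** * The convolution M_k as a sum over Legendre moments *)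

Section CubicSum.
Context {R : realFieldType}.
Implicit Types j k n N : nat.
Local Notation c := (@cbin R).

Let half_neq k j : (k%:R + 1 / 2 - j%:R : R) != 0.
Proof.
have [jk|kj] := leqP j k.
  have : (j%:R : R) <= k%:R by rewrite ler_nat.
  by move=> ?; lra.
have : (k.+1%:R : R) <= j%:R by rewrite ler_nat.
by rewrite -natr1; lra.
Qed.

(** Extension by zero, so that the range of summation need not depend on k. *)
Let dz k j : R := if (j <= k)%N then c (k - j) else 0.

Let dzS k j : dz k.+1 j * (k%:R + 1 - j%:R) = dz k j * (k%:R + 1 / 2 - j%:R).
Proof.
rewrite /dz; have [jk|kj] := leqP j k.
  rewrite (leq_trans jk) // subSn // cbinS natrB //.
  have : (j%:R : R) <= k%:R by rewrite ler_nat.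
  by move=> ?; field; lra.
rewrite mul0r; move: kj; rewrite leq_eqVlt => /predU1P[<-|kj].
  by rewrite -natr1 subrr mulr0.
by rewrite leqNgt kj mul0r.
Qed.

Let convdz N k : (k < N)%N ->
  cauchy_prod (fun n => c n ^+ 2) c k = \sum_(j < N) c j ^+ 2 * dz k j.
Proof.
move=> kN; rewrite /cauchy_prod (big_ord_widen N (fun i => c i ^+ 2 * c (k - i)%N)) //.
rewrite [LHS]big_mkcond; apply: eq_bigr => i _; rewrite /dz ltnS.
by case: ifP; rewrite ?mulr0.
Qed.

Let sol (y : nat -> R) := forall k,
  (k%:R + 2) ^+ 2 * y k.+2 - (2 * (k%:R + 1) ^+ 2 + 2 * (k%:R + 1) + 3 / 4) * y k.+1
  + (k%:R + 1) ^+ 2 * y k = 0.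

Let sol_uniq y z : sol y -> sol z -> y 0%N = z 0%N -> y 1%N = z 1%N -> y =1 z.
Proof.
move=> sy sz e0 e1 k; suff [] : y k = z k /\ y k.+1 = z k.+1 by [].
elim: k => // k [IH1 IH2]; split=> //.
have k0 : 0 <= k%:R :> R by [].
have k2 : (k%:R + 2) ^+ 2 != 0 :> R by rewrite expf_neq0 //; lra.
apply: (mulfI k2); have := sy k; have := sz k; rewrite IH1 IH2.
lra.
Qed.

Let sol_conv : sol (cauchy_prod (fun n => c n ^+ 2) c).
Proof.
move=> k; rewrite !(@convdz k.+3) // ?mulr_sumr; last by lia.
rewrite -sumrB -big_split /=.
(* The telescoping certificate: the recurrence applied to the summand is G (j + 1) - G j. It
   vanishes at j = 0 through j^2 and at j = k + 3 through [dz]; its denominator lies in 1/2 + Z. *)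
pose G j := 1 / 2 * j%:R ^+ 2 * c j ^+ 2 * dz k.+2 j / (k%:R + 3 / 2 - j%:R).
transitivity (\sum_(j < k.+3) (G j.+1 - G j)).
  apply: eq_bigr => -[j jk] _ /=; rewrite /G cbinS.
  have -> : dz k.+2 j.+1 = dz k.+1 j by rewrite /dz ltnS subSS.
  have h1 := half_neq k j.
  have h2 : k%:R + 3 / 2 - j%:R != 0 :> R.
    by have := half_neq k.+1 j; rewrite -natr1 (_ : k%:R + 3 / 2 = k%:R + 1 + 1 / 2) //; field.
  have e1 : dz k.+1 j = dz k.+2 j * (k%:R + 2 - j%:R) / (k%:R + 3 / 2 - j%:R).
    apply: (mulIf h2); rewrite divfK //; have := dzS k.+1 j; rewrite -natr1 => e.
    transitivity (dz k.+1 j * (k%:R + 1 + 1 / 2 - j%:R)); first by field.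
    by rewrite -e; ring.
  have e0 : dz k j = dz k.+1 j * (k%:R + 1 - j%:R) / (k%:R + 1 / 2 - j%:R).
    by rewrite dzS mulfK.
  rewrite e0 e1; have j0 : 0 <= j%:R :> R by [].
  rewrite -(natr1 j); field; apply/and3P; split; last by lra.
    rewrite (_ : _ + _ = 2 * (k%:R + 3 / 2 - j%:R)); first by rewrite mulf_neq0 ?pnatr_eq0.
    by field.
  rewrite (_ : _ + _ = 2 * (k%:R + 1 / 2 - j%:R)); first by rewrite mulf_neq0 ?pnatr_eq0.
  by field.
rewrite -(big_mkord xpredT (fun j => G j.+1 - G j)) telescope_sumr // /G.
by rewrite /dz ltnn expr0n /= !(mulr0, mul0r) subrr.
Qed.

Let V k := \sum_(n < k.+1) (4 * n%:R + 1) * (legm k n * c n ^+ 3).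

Let VE N k : (k < N)%N -> V k = \sum_(n < N) (4 * n%:R + 1) * (legm k n * c n ^+ 3).
Proof.
move=> kN; rewrite /V (big_ord_widen N (fun n => (4 * n%:R + 1) * (legm k n * c n ^+ 3))) //.
rewrite [LHS]big_mkcond; apply: eq_bigr => i _; case: ifPn => //.
by rewrite ltnS -ltnNge => ki; rewrite legm_gt // mul0r mulr0.
Qed.

Let sol_V : sol V.
Proof.
move=> k; rewrite !(@VE k.+3) // ?mulr_sumr; last by lia.
rewrite -sumrB -big_split /=.
have k0 : 0 <= k%:R :> R by [].
(* The certificate in n, killed at n = 0 by n^4 and at n = k + 3 by the moment. *)
pose G n := - 2 / (k%:R + 2) ^+ 2 * n%:R ^+ 4 * (k%:R + 5 / 2 + n%:R) *
  c n ^+ 3 * legm k.+2 n.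
transitivity (\sum_(n < k.+3) (G n.+1 - G n)).
  apply: eq_bigr => -[n nk] _; rewrite [nat_of_ord _]/=.
  have n0 : 0 <= n%:R :> R by [].
  have e1 : legm k.+1 n = legm k.+2 n *
     ((k%:R + 2 - n%:R) * (k%:R + 5 / 2 + n%:R)) / (k%:R + 2) ^+ 2 :> R.
    have k2 : (k%:R + 2) ^+ 2 != 0 :> R by rewrite expf_neq0 //; lra.
    apply: (mulIf k2); rewrite divfK //.
    have := @legm_row R k.+1 n; rewrite -natr1 => e.
    by rewrite (_ : k%:R + 2 = k%:R + 1 + 1) -?e; field.
  have e0 : legm k n = legm k.+1 n *
     ((k%:R + 1 - n%:R) * (k%:R + 3 / 2 + n%:R)) / (k%:R + 1) ^+ 2 :> R.
    have k2 : (k%:R + 1) ^+ 2 != 0 :> R by rewrite expf_neq0 //; lra.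
    by rewrite legm_row mulfK.
  rewrite e0 e1 /G cbinS [legm _ n.+1]/= -!natr1; field.
  by do !(apply/andP; split); lra.
rewrite -(big_mkord xpredT (fun j => G j.+1 - G j)) telescope_sumr // /G.
by rewrite legm_gt // expr0n /= !(mulr0, mul0r) subrr.
Qed.

(** Both sides solve [sol], whose leading coefficient (k + 2)^2 never vanishes, and agree at k = 0
    and k = 1. *)
Lemma cauchy_prod_cbin k : cauchy_prod (fun n => c n ^+ 2) c k =
  \sum_(n < k.+1) (4 * n%:R + 1) * (legm k n * c n ^+ 3).
Proof.
apply: (sol_uniq sol_conv sol_V).
  by rewrite /cauchy_prod /V !big_ord1 /= big_ord0 !cbin0; ring.
rewrite /cauchy_prod /V !big_ord_recr !big_ord0 /= !big_ord_recr !big_ord0 /= !cbinS !cbin0.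
by field.
Qed.

End CubicSum.

(** * Hypergeometric coefficients and Euler's transformation *)

Section Hypergeometric.
Context {R : realFieldType}.
Implicit Types (s t : R) (k n N : nat).
Local Notation half := (1 / 2 : R).

(* Coefficients of [2F1(a, b; 1; z)] where [a + b = 1 + s] and
   [(a - 1/2) (b - 1/2) - s / 2 = t]: only symmetric functions of [a], [b] are used, as
   [a] and [b] may be complex. *)
Definition hyp s t k : R := \prod_(j < k)
  (((j%:R + half) ^+ 2 + s * (j%:R + half) + t) / (j%:R + 1) ^+ 2).

Lemma hyp0 s t : hyp s t 0 = 1. Proof. by rewrite /hyp big_ord0. Qed.

Lemma hypS s t k : hyp s t k.+1 =
  hyp s t k * (((k%:R + half) ^+ 2 + s * (k%:R + half) + t) / (k%:R + 1) ^+ 2).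
Proof. by rewrite /hyp big_ord_recr. Qed.

Lemma hypSM s t k : hyp s t k.+1 * (k%:R + 1) ^+ 2 =
  hyp s t k * ((k%:R + half) ^+ 2 + s * (k%:R + half) + t).
Proof.
have k0 : 0 <= k%:R :> R by [].
by rewrite hypS mulrA divfK // expf_neq0 //; lra.
Qed.

Lemma hyp00 k : hyp 0 0 k = cbin k ^+ 2.
Proof.
elim: k => [|k IH]; first by rewrite hyp0 cbin0 expr1n.
have k0 : 0 <= k%:R :> R by [].
by rewrite hypS cbinS IH; field; lra.
Qed.

Lemma hyp_ge0 s t k : -1 / 2 <= s -> 0 <= 1 / 4 + s / 2 + t -> 0 <= hyp s t k.
Proof.
move=> s0 p0; apply: prodr_ge0 => j _; rewrite divr_ge0 ?sqr_ge0 //.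
have j0 : 0 <= j%:R :> R by [].
nra.
Qed.

(* Coefficients of [(1 - z)^(- s)]. *)
Definition binom_coef s k : R := \prod_(j < k) ((s + j%:R) / (j%:R + 1)).

Lemma binom_coefSM s k : binom_coef s k.+1 * (k%:R + 1) = binom_coef s k * (s + k%:R).
Proof.
have k0 : 0 <= k%:R :> R by [].
by rewrite /binom_coef big_ord_recr /= mulrA divfK //; lra.
Qed.

(** Euler's transformation 2F1(a, b; 1; z) = (1 - z)^(1 - a - b) 2F1(1 - a, 1 - b; 1; z), read on
    coefficients; here 1 - a - b = - s. *)
Lemma hyp_euler s t : hyp s t =1 cauchy_prod (binom_coef s) (hyp (- s) t).
Proof.
elim=> [|k IH]; first by rewrite /cauchy_prod big_ord1 /binom_coef big_ord0 !hyp0 mulr1.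
have k0 : 0 <= k%:R :> R by [].
have k1 : (k%:R + 1) ^+ 2 != 0 :> R by rewrite expf_neq0 //; lra.
apply: (mulIf k1); rewrite hypSM IH cauchy_prodC [in RHS]cauchy_prodC.
pose P j : R := (j%:R + half) ^+ 2 - s * (j%:R + half) + t.
(* The factor (k + 1)^2 is split as j^2 + (k + 1 - j) (k + 1 + j): after a shift of j the first part
   fits the recurrence of [hyp], and the second part fits that of [binom_coef]. *)
transitivity (\sum_(j < k.+2) hyp (- s) t j * (binom_coef s (k.+1 - j) * j%:R ^+ 2)
  + \sum_(j < k.+2) hyp (- s) t j *
    (binom_coef s (k.+1 - j) * ((k%:R + 1 - j%:R) * (k%:R + 1 + j%:R)))); last first.
  rewrite -big_split /cauchy_prod mulr_suml; apply: eq_bigr => j _ /=; ring.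
rewrite big_ord_recl [X in _ = _ + X]big_ord_recr /=.
rewrite subnn expr0n /= !mulr0 add0r natr1 subrr mul0r !mulr0 addr0.
rewrite -big_split /= /cauchy_prod mulr_suml; apply: eq_bigr => -[j jk] _.
rewrite /= /bump add1n subSS.
have jk' : (j%:R : R) <= k%:R by rewrite ler_nat.
have -> : binom_coef s (k.+1 - j) * ((k.+1%:R - j%:R) * (k.+1%:R + j%:R)) =
   binom_coef s (k - j) * ((s + (k%:R - j%:R)) * (k.+1%:R + j%:R)).
  have := binom_coefSM s (k - j); rewrite -subSn // natrB // => e.
  rewrite [in RHS]mulrA -e -[k.+1%:R]natr1; ring.
have -> : hyp (- s) t j.+1 * (binom_coef s (k - j) * j.+1%:R ^+ 2) =
   hyp (- s) t j * P j * binom_coef s (k - j).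
  have -> : hyp (- s) t j * P j = hyp (- s) t j.+1 * (j%:R + 1) ^+ 2.
    by rewrite hypSM /P mulNr.
  by rewrite natr1; ring.
by rewrite /P -natr1; field.
Qed.

(** The factor (1 - z)^(- s) which Euler's transformation takes out of the first series is the one
    that turns the second, for (- s, t'), into the series for (s, t'). *)
Lemma cauchy_prod_hyp s t t' :
  cauchy_prod (hyp s t) (hyp (- s) t') =1 cauchy_prod (hyp (- s) t) (hyp s t').
Proof.
move=> N.
rewrite (eq_cauchy_prod (hyp_euler s t) (frefl _)).
rewrite (eq_cauchy_prod (frefl _) (hyp_euler s t')).
rewrite cauchy_prodA; apply: eq_cauchy_prod => //; exact: cauchy_prodC.
Qed.

(** A first-order recurrence in n, exact for partial sums: the sum over k telescopes to the last
    term, which tends to 0 for admissible parameters. The factor K - n is kept there to match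
    [legm_row]. *)
Lemma hyp_legm_ratio s t n K : let u := n%:R + half in let v := n%:R + 1 in
  (2 * n%:R + 2) * (v ^+ 2 - s * v + t) * (\sum_(k < K) hyp s t k * legm k n.+1) =
  (2 * n%:R + 1) * (u ^+ 2 + s * u + t) * (\sum_(k < K) hyp s t k * legm k n)
  - (2 * n%:R + 1) * (2 * n%:R + 3 / 2) * ((K%:R - n%:R) * (hyp s t K * legm K n)).
Proof.
move=> u v; rewrite /u /v {u v}; have n0 : 0 <= n%:R :> R by [].
elim: K => [|K IH].
  rewrite !big_ord0; case: n {n0} => [|n]; first by rewrite subrr; ring.
  by rewrite legm_gt //; ring.
rewrite !big_ord_recr [_ (\sum_(i < K) _) _]/= [X in _ = _ * _ * X - _]/=.
rewrite mulrDr IH.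
have K0 : 0 <= K%:R :> R by [].
have -> : (K.+1%:R - n%:R) * (hyp s t K.+1 * legm K.+1 n) =
  hyp s t K * legm K n * (((K%:R + half) ^+ 2 + s * (K%:R + half) + t)
    / (K%:R + 3 / 2 + n%:R)).
  have e := @legm_row R K n.
  have d : K%:R + 3 / 2 + n%:R != 0 :> R by lra.
  have d1 : (K%:R + 1) ^+ 2 != 0 :> R by rewrite expf_neq0 //; lra.
  apply: (mulIf d); apply: (mulIf d1); rewrite -natr1.
  transitivity (hyp s t K.+1 * (K%:R + 1) ^+ 2 *
     (legm K.+1 n * ((K%:R + 1 - n%:R) * (K%:R + 3 / 2 + n%:R)))); first by ring.
  by rewrite e hypSM; field; lra.
by rewrite /=; field; lra.
Qed.

End Hypergeometric.

(** * Raabe's convergence test *)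

Section Raabe.
Context {R : realType}.
Implicit Types t : nat -> R.

Lemma series_ge0_cvg t M : (forall k, 0 <= t k) -> (forall n, series t n <= M) ->
  cvgn (series t).
Proof.
move=> t0 tM; apply: nondecreasing_is_cvgn.
  by apply/nondecreasing_seqP => n; rewrite /series /= big_nat_recr //= lerDl.
by exists M => _ [n _ <-].
Qed.

Lemma series_shift t m : cvgn (series t) -> cvgn (series (fun k => t (k + m)%N)).
Proof.
rewrite -(is_cvg_series_restrict m) => /cvg_ex[l /= tl].
apply/cvg_ex; exists l; move: tl; rewrite -(cvg_shiftn m) /=.
apply: cvg_trans; apply: near_eq_cvg; apply: nearW => n /=.
by rewrite -{1}[m]add0n big_addn addnK.
Qed.

(* [k * t k] decreases, and its limit vanishes since the harmonic series diverges. *)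
Lemma raabe t (e : R) M : 0 < e -> (forall k, 0 <= t k) ->
  (forall k, (M <= k)%N -> (k%:R + 1) * t k.+1 <= (k%:R - e) * t k) ->
  cvgn (series t) /\ (k%:R * t k) @[k --> \oo] --> 0.
Proof.
move=> e0 t0 tM; pose y d : R := (d + M)%:R * t (d + M)%N.
have yS d : e * t (d + M)%N <= y d - y d.+1.
  have := tM (d + M)%N (leq_addl _ _).
  by rewrite /y addSn -[(d + M).+1%:R]natr1; lra.
have y0 d : 0 <= y d by rewrite mulr_ge0.
have cvt : cvgn (series t).
  apply: (@series_ge0_cvg _ (series t M + y 0%N / e)) => // K.
  have sd d : series t (d + M)%N + y d / e <= series t M + y 0%N / e.
    elim: d => [|d IH] //; apply: le_trans IH.
    rewrite addSn /series /= big_nat_recr //= -addrA lerD2l.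
    have : e * t (d + M)%N / e <= (y d - y d.+1) / e by rewrite ler_pM2r ?invr_gt0.
    by rewrite mulrAC mulfV ?gt_eqF // mul1r mulrBl; lra.
  apply: le_trans (sd K).
  apply: le_trans (_ : series t (K + M)%N <= _); last by rewrite lerDl divr_ge0 // ltW.
  rewrite /series /= (@big_cat_nat _ _ _ K 0 (K + M)) //= ?leq_addr // lerDl.
  by rewrite sumr_ge0.
split=> //.
have ny : {homo y : n m / (n <= m)%N >-> m <= n}.
  apply/nonincreasing_seqP => d; rewrite -subr_ge0; apply: le_trans (yS d).
  by rewrite mulr_ge0 // ltW.
have cy : cvgn y.
  by apply: nonincreasing_is_cvgn => //; exists 0 => _ [n _ <-].
suff l0 : limn y = 0.
  by rewrite -(cvg_shiftn M); have : y @ \oo --> limn y := cy; rewrite l0.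
apply/eqP; rewrite eq_le; apply/andP; split; last first.
  by apply: limr_ge => //; apply: nearW.
rewrite leNgt; apply/negP => lpos.
apply: (@dvg_harmonic R).
(* As d + M + 1 <= (d + 1) (M + 1) and t (d + M + 1) >= limn y / (d + M + 1), this majorizes the
   harmonic term. *)
apply: (@series_le_cvg _ _ (fun d => (M.+1%:R / limn y) * t (d + M.+1)%N)).
- by move=> n; exact: harmonic_ge0.
- by move=> n; rewrite mulr_ge0 // divr_ge0 // ltW.
- move=> d; have yl : limn y <= y d.+1 by apply: nonincreasing_cvgn_ge.
  rewrite /harmonic /= -lter_pdivrMl ?invf_gt0 ?divr_gt0 ?ltr0n // invf_div.
  move: yl; rewrite /y addSnnS => yl.
  have dM : 0 < ((d + M.+1)%:R : R) by rewrite ltr0n addnS.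
  have : limn y / (d + M.+1)%:R <= t (d + M.+1)%N by rewrite ler_pdivrMr // mulrC.
  apply: le_trans; rewrite -mulrA ler_pM2l // -invfM lef_pV2 ?posrE // ?mulr_gt0 ?ltr0n //.
  by rewrite -natrM ler_nat; lia.
- by apply: is_cvg_seriesZ; apply: series_shift.
Qed.

End Raabe.

(** * Gauss's summation theorem *)

Section Gauss.
Context {R : realType}.
Implicit Types (S P c : R) (j k n N : nat).

(* Terms of [2F1(a, b; c; 1)] with [S = a + b] and [P = a b]. *)
Definition gauss_term S P c k : R :=
  \prod_(j < k) ((j%:R ^+ 2 + S * j%:R + P) / ((j%:R + 1) * (c + j%:R))).

Definition gauss_sum S P c : R := limn (series (gauss_term S P c)).

Context (S P : R) (S0 : 0 <= S) (P0 : 0 <= P).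

Lemma gauss_termS c k : gauss_term S P c k.+1 =
  gauss_term S P c k * ((k%:R ^+ 2 + S * k%:R + P) / ((k%:R + 1) * (c + k%:R))).
Proof. by rewrite /gauss_term big_ord_recr. Qed.

Lemma gauss_term_ge0 c k : 0 < c -> 0 <= gauss_term S P c k.
Proof.
move=> c0; apply: prodr_ge0 => j _; rewrite divr_ge0 //.
  by rewrite !addr_ge0 // ?sqr_ge0 // mulr_ge0.
by rewrite mulr_ge0 // addr_ge0 // ltW.
Qed.

Lemma gauss_term_cvg c : S < c -> cvgn (series (gauss_term S P c)) /\
  (k%:R * gauss_term S P c k) @[k --> \oo] --> 0.
Proof.
move=> Sc; have c0 : 0 < c by exact: le_lt_trans Sc.
pose e := (c - S) / 2; have e0 : 0 < e by rewrite /e; lra.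
(* Since c - S = 2 e, the inequality k^2 + S k + P <= (k - e) (c + k) amounts to P + e c <= e k. *)
pose M := (Num.truncn ((P + e * c) / e)).+1.
apply: (@raabe _ _ e M) => // [k|k Mk]; first exact: gauss_term_ge0.
have k0 : 0 <= k%:R :> R by [].
rewrite gauss_termS mulrCA mulrC ler_wpM2r ?gauss_term_ge0 //.
rewrite [X in X <= _](_ : _ = (k%:R ^+ 2 + S * k%:R + P) / (c + k%:R)); last by field; lra.
rewrite ler_pdivrMr; last by lra.
have : (P + e * c) / e < k%:R.
  by apply: lt_le_trans (_ : M%:R <= _); rewrite ?ler_nat // /M truncnS_gt.
rewrite ltr_pdivrMr // => h.
have : 2 * e = c - S by rewrite /e; field.
nra.
Qed.

(** Gauss's contiguous relation: this combination of partial sums telescopes to - c K times the K-th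
    term, which [raabe] sends to 0. *)
Lemma gauss_sum_contig c : S < c ->
  c * (c - S) * gauss_sum S P c = (c ^+ 2 - S * c + P) * gauss_sum S P (c + 1).
Proof.
move=> Sc; have c0 : 0 < c by exact: le_lt_trans Sc.
have [cv1 to0] := gauss_term_cvg Sc.
have [cv2 _] := @gauss_term_cvg (c + 1) ltac:(lra).
have tc k : gauss_term S P (c + 1) k * (c + k%:R) = gauss_term S P c k * c.
  elim: k => [|k IH]; first by rewrite /gauss_term !big_ord0; ring.
  have k0 : 0 <= k%:R :> R by [].
  rewrite !gauss_termS -natr1.
  transitivity (gauss_term S P (c + 1) k * (c + k%:R) *
     ((k%:R ^+ 2 + S * k%:R + P) / ((k%:R + 1) * (c + k%:R)))).
    by field; lra.
  by rewrite IH; ring.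
have part K : c * (c - S) * series (gauss_term S P c) K -
    (c ^+ 2 - S * c + P) * series (gauss_term S P (c + 1)) K =
    - c * (K%:R * gauss_term S P c K).
  elim: K => [|K IH]; first by rewrite /series /= !big_geq //; ring.
  rewrite /series /= !big_nat_recr //= in IH *.
  have K0 : 0 <= K%:R :> R by [].
  have e : gauss_term S P (c + 1) K = gauss_term S P c K * c / (c + K%:R).
    by rewrite -tc mulfK //; lra.
  move: IH; set s1 := \sum_(0 <= k < K) _; set s2 := \sum_(0 <= k < K) _ => IH.
  rewrite (_ : _ - _ = (c * (c - S) * s1 - (c ^+ 2 - S * c + P) * s2)
    + (c * (c - S) * gauss_term S P c K - (c ^+ 2 - S * c + P) * gauss_term S P (c + 1) K)).
    by rewrite IH gauss_termS e -natr1; field; lra.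
  by ring.
apply/eqP; rewrite -subr_eq0; apply/eqP.
have l1 : (c * (c - S) * series (gauss_term S P c) K -
    (c ^+ 2 - S * c + P) * series (gauss_term S P (c + 1)) K) @[K --> \oo] -->
    c * (c - S) * gauss_sum S P c - (c ^+ 2 - S * c + P) * gauss_sum S P (c + 1).
  by apply: cvgB; apply: cvgMr.
have l2 : (- c * (K%:R * gauss_term S P c K)) @[K --> \oo] --> (- c * 0).
  exact: cvgMr.
move: l1; under eq_fun do rewrite part.
by move=> /(cvg_unique _ l2) <-; rewrite ?mulr0.
Qed.

Let series_gaussS c n : series (gauss_term S P c) n.+1 =
  1 + \sum_(0 <= i < n) gauss_term S P c i.+1.
Proof. by rewrite /series /= big_nat_recl // {1}/gauss_term big_ord0. Qed.

Lemma gauss_sum_ge1 c : S < c -> 1 <= gauss_sum S P c.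
Proof.
move=> Sc; have c0 : 0 < c by exact: le_lt_trans Sc.
have [cv1 _] := gauss_term_cvg Sc.
apply: limr_ge => //; near=> n.
have n0 : (0 < n)%N by near: n; exists 1%N.
rewrite -(prednK n0) series_gaussS lerDl.
by apply: sumr_ge0 => i _; exact: gauss_term_ge0.
Unshelve. all: by end_near. Qed.

(** Passing from c to c + N shrinks every term but the constant one by at least c / (c + N), already
    through its first factor. Hence the sums tend to 1 as N grows. *)
Lemma gauss_sum_shift_le c N : S < c ->
  gauss_sum S P (c + N%:R) <= 1 + c / (c + N%:R) * (gauss_sum S P c - 1).
Proof.
move=> Sc; have c0 : 0 < c by exact: le_lt_trans Sc.
have N0 : 0 <= N%:R :> R by [].
have [cv1 _] := gauss_term_cvg Sc.
have [cv2 _] := @gauss_term_cvg (c + N%:R) ltac:(lra).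
have tle k : gauss_term S P (c + N%:R) k.+1 <= c / (c + N%:R) * gauss_term S P c k.+1.
  elim: k => [|k IH].
    rewrite /gauss_term !big_ord1 /= le_eqVlt; apply/orP; left; apply/eqP.
    by field; lra.
  rewrite gauss_termS [in X in _ <= X]gauss_termS [X in _ <= X]mulrA.
  have k0 : 0 <= k.+1%:R :> R by [].
  apply: ler_pM => //; first by apply: gauss_term_ge0; lra.
    by rewrite divr_ge0 ?mulr_ge0 ?addr_ge0 ?mulr_ge0 ?sqr_ge0 //; lra.
  rewrite ler_wpM2l ?addr_ge0 ?mulr_ge0 ?sqr_ge0 // lef_pV2 ?posrE; first by nra.
    by apply: mulr_gt0; lra.
  by apply: mulr_gt0; lra.
have cv3 : (1 + c / (c + N%:R) * (series (gauss_term S P c) n - 1)) @[n --> \oo] -->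
    1 + c / (c + N%:R) * (gauss_sum S P c - 1).
  by apply: cvgD; [exact: cvg_cst|apply: cvgMr; apply: cvgB => //; exact: cvg_cst].
apply: (ler_cvg_to cv2 cv3); near=> n.
have n0 : (0 < n)%N by near: n; exists 1%N.
rewrite -(prednK n0) !series_gaussS addrAC subrr add0r lerD2l mulr_sumr; exact: ler_sum.
Unshelve. all: by end_near. Qed.

Lemma gauss_sum_iter c N : S < c -> gauss_sum S P c =
  (\prod_(j < N) (((c + j%:R) ^+ 2 - S * (c + j%:R) + P) /
     ((c + j%:R) * (c + j%:R - S)))) * gauss_sum S P (c + N%:R).
Proof.
move=> Sc; have c0 : 0 < c by exact: le_lt_trans Sc.
elim: N => [|N IH]; first by rewrite big_ord0 addr0 mul1r.
have N0 : 0 <= N%:R :> R by [].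
rewrite IH big_ord_recr /= -mulrA; congr (_ * _).
have := @gauss_sum_contig (c + N%:R) ltac:(lra).
have h : (c + N%:R) * (c + N%:R - S) != 0 by rewrite mulf_neq0 //; lra.
rewrite (_ : c + N.+1%:R = c + N%:R + 1); last by rewrite -natr1; ring.
by move=> e; apply: (mulfI h); rewrite e; field; apply/andP; split; lra.
Qed.

(* Gauss's theorem, as the limit of the product of the contiguity factors. *)
Lemma gauss_sumE c : S < c ->
  (\prod_(j < N) (((c + j%:R) ^+ 2 - S * (c + j%:R) + P) /
     ((c + j%:R) * (c + j%:R - S)))) @[N --> \oo] --> gauss_sum S P c.
Proof.
move=> Sc; have c0 : 0 < c by exact: le_lt_trans Sc.
have g1 N : 1 <= gauss_sum S P (c + N%:R).
  by apply: gauss_sum_ge1; rewrite (lt_le_trans Sc) // lerDl.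
have to1 : gauss_sum S P (c + N%:R) @[N --> \oo] --> (1 : R).
  apply: (@squeeze_cvgr _ _ _ _ (fun=> 1)
     (fun N => 1 + c / (c + N%:R) * (gauss_sum S P c - 1))).
  - by apply: nearW => N; rewrite g1 gauss_sum_shift_le.
  - exact: cvg_cst.
  - rewrite -[X in _ --> X]addr0; apply: cvgD; first exact: cvg_cst.
    rewrite -[X in _ --> X](mul0r (gauss_sum S P c - 1)); apply: cvgMl.
    rewrite -[X in _ --> X](mulr0 c); apply: cvgMr.
    apply: (@squeeze_cvgr _ _ _ _ (fun=> 0) (fun N => (1 / c + 1) * (harmonic N))).
    + apply: nearW => N; have N0 : 0 <= N%:R :> R by [].
      have cN : 0 < c + N%:R by lra.
      apply/andP; split; first by rewrite invr_ge0 ltW.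
      rewrite /harmonic /= ler_pdivlMr ?ltr0n // mulrC.
      rewrite ler_pdivrMr -?natr1; last by lra.
      rewrite mulrDl mulrDr div1r mulVf ?gt_eqF //.
      have : 0 <= c^-1 * N%:R by rewrite mulr_ge0 // invr_ge0 ltW.
      by lra.
    + exact: cvg_cst.
    + rewrite -[X in _ --> X](mulr0 (1 / c + 1)); apply: cvgMr; exact: cvg_harmonic.
have -> : (fun N => \prod_(j < N) (((c + j%:R) ^+ 2 - S * (c + j%:R) + P) /
     ((c + j%:R) * (c + j%:R - S)))) =
   (fun N => gauss_sum S P c / gauss_sum S P (c + N%:R)).
  apply/funext => N; rewrite {1}(gauss_sum_iter N Sc) mulfK //.
  by have := g1 N; lra.
rewrite -[X in _ --> X]divr1; apply: cvgMr; apply: cvgV => //.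
Qed.

End Gauss.

(** * Series of nonnegative extended reals *)

Section ExtendedSeries.
Context {R : realType}.
Implicit Types (a b : nat -> R) (f : nat -> \bar R) (n N : nat).
Local Open Scope ereal_scope.

Lemma nneseries_EFin a : (forall k, 0 <= a k)%R -> cvgn (series a) ->
  \sum_(k <oo) (a k)%:E = (limn (series a))%:E.
Proof.
move=> a0 cva; rewrite -EFin_lim //; congr (limn _).
by apply/funext => n; rewrite /series /= sumEFin.
Qed.

Lemma nneseries_fin f N : (forall k, 0 <= f k) -> (forall k, (N <= k)%N -> f k = 0) ->
  \sum_(k <oo) f k = \sum_(k < N) f k.
Proof.
move=> f0 fN; rewrite (nneseries_split 0 N) // add0n big_mkord.
by rewrite [X in _ + X]eseries0 ?adde0 // => i Ni _; exact: fN.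
Qed.

Lemma nneseries_diag (g : nat -> nat -> \bar R) : (forall k l, 0 <= g k l) ->
  \sum_(k <oo) \sum_(l <oo) g k l =
  \sum_(N <oo) \sum_(k < N.+1) g k (N - k)%N.
Proof.
move=> g0; pose h k N := if (k <= N)%N then g k (N - k)%N else 0.
have h0 k N : 0 <= h k N by rewrite /h; case: ifP.
transitivity (\sum_(k <oo) \sum_(N <oo) h k N).
  apply: eq_eseriesr => k _.
  rewrite [RHS](nneseries_split 0 k) // add0n big1_seq; last first.
    by move=> i; rewrite mem_index_iota /h => /andP[_ /andP[_ ik]]; rewrite leqNgt ik.
  rewrite add0e -(nneseries_addn k) //; apply: eq_eseriesr => l _.
  by rewrite /h leq_addl addnK.
rewrite nneseries_interchange //; apply: eq_eseriesr => N _.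
rewrite (@nneseries_fin _ N.+1) //; last by move=> k Nk; rewrite /h leqNgt Nk.
by apply: eq_bigr => -[k /= kN] _; rewrite /h -ltnS kN.
Qed.

Lemma nneseriesM f g : (forall k, 0 <= f k) -> (forall k, 0 <= g k) ->
  (\sum_(l <oo) g l) \is a fin_num -> (forall k, f k \is a fin_num) ->
  (\sum_(k <oo) f k) * (\sum_(l <oo) g l) = \sum_(k <oo) \sum_(l <oo) f k * g l.
Proof.
move=> f0 g0 gfin ffin.
rewrite muleC -{1}(fineK gfin) -nneseriesZl //; apply: eq_eseriesr => k _.
by rewrite fineK // muleC -{1}(fineK (ffin k)) -nneseriesZl // fineK.
Qed.

End ExtendedSeries.

(** * Legendre coefficients of 2F1 in closed form *)

Section LegendreCoefficients.
Context {R : realType}.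
Implicit Types (s t : R) (k n N : nat).

(** With a + b = 1 + s and a b = 1/4 + s/2 + t, these conditions make all terms nonnegative and give
    a + b < 3/2, the convergence condition of the Gauss series with c = 3/2. *)
Definition admissible s t := [&& -1 / 2 <= s, s < 1 / 2 & 0 <= 1 / 4 + s / 2 + t].

(* Up to sign, the Legendre coefficients of the function [sum_k hyp s t k * (1 - x ^ 2) ^ k]. *)
Definition lcoef s t n : R := limn (series (fun k => hyp s t k * legm k n)).

(** The moments of degree 0 are (1)_k / (3/2)_k, so that A_0 is a Gauss series with c = 3/2. *)
Lemma hyp_legm0 s t k :
  hyp s t k * legm k 0 = gauss_term (1 + s) (1 / 4 + s / 2 + t) (3 / 2) k.
Proof.
elim: k => [|k IH]; first by rewrite hyp0 /gauss_term /= !big_ord0 mulr1.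
have k0 : 0 <= k%:R :> R by [].
rewrite gauss_termS -IH hypS /= big_ord_recr /=; field; lra.
Qed.

Context (s t : R) (st : admissible s t).

Let s1 : 0 <= 1 + s. Proof. by case/and3P: st; lra. Qed.
Let p0 : 0 <= 1 / 4 + s / 2 + t. Proof. by case/and3P: st. Qed.
Let sc : 1 + s < 3 / 2. Proof. by case/and3P: st; lra. Qed.

Lemma hyp_adm_ge0 k : 0 <= hyp s t k.
Proof. by case/and3P: st => ? _ ?; exact: hyp_ge0. Qed.

Lemma lcoef_term_ge0 k n : 0 <= hyp s t k * legm k n.
Proof. by rewrite mulr_ge0 ?hyp_adm_ge0 ?legm_ge0. Qed.

Let gcvg := gauss_term_cvg s1 p0 sc.

Let series0E : series (fun k => hyp s t k * legm k 0) =
  series (gauss_term (1 + s) (1 / 4 + s / 2 + t) (3 / 2)).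
Proof. by congr series; apply/funext => k; exact: hyp_legm0. Qed.

Lemma lcoef_cvg n : cvgn (series (fun k => hyp s t k * legm k n)).
Proof.
apply: (@series_le_cvg _ _ (fun k => hyp s t k * legm k 0)).
- by move=> k; exact: lcoef_term_ge0.
- by move=> k; exact: lcoef_term_ge0.
- by move=> k; rewrite ler_wpM2l ?hyp_adm_ge0 ?legm_le.
- by rewrite series0E; case: gcvg.
Qed.

Lemma lcoef0E : (\prod_(j < N) (((j%:R + 1) ^+ 2 - s * (j%:R + 1) + t) /
    ((j%:R + 3 / 2) * (j%:R + 1 / 2 - s)))) @[N --> \oo] --> lcoef s t 0.
Proof.
rewrite /lcoef series0E; have := gauss_sumE s1 p0 sc.
apply: cvg_trans; apply: near_eq_cvg; apply: nearW => N.
by apply: eq_bigr => j _; congr (_ / _); field.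
Qed.

Lemma lcoef_ge0 n : 0 <= lcoef s t n.
Proof.
apply: limr_ge; first exact: lcoef_cvg.
by apply: nearW => m; apply: sumr_ge0 => k _; exact: lcoef_term_ge0.
Qed.

(** Column n is dominated by column 0, where [raabe] applies. *)
Let boundary n : ((K%:R - n%:R) * (hyp s t K * legm K n)) @[K --> \oo] --> 0.
Proof.
have [_ to0] := gcvg.
have b0 : (K%:R * (hyp s t K * legm K n)) @[K --> \oo] --> 0.
  apply: (@squeeze_cvgr _ _ _ _ (fun=> 0)
    (fun K => K%:R * gauss_term (1 + s) (1 / 4 + s / 2 + t) (3 / 2) K)) => //.
    apply: nearW => K; rewrite mulr_ge0 ?lcoef_term_ge0 //=.
    by rewrite -hyp_legm0 ler_wpM2l // ler_wpM2l ?hyp_adm_ge0 ?legm_le.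
  exact: cvg_cst.
have b1 : (n%:R * (hyp s t K * legm K n)) @[K --> \oo] --> (n%:R * 0 : R).
  have b2 := cvg_series_cvg_0 (@lcoef_cvg n).
  exact: cvgMr b2.
have : (K%:R * (hyp s t K * legm K n) - n%:R * (hyp s t K * legm K n)) @[K --> \oo] -->
    (0 - n%:R * 0 : R) by exact: cvgB.
rewrite mulr0 subr0.
by apply: cvg_trans; apply: near_eq_cvg; apply: nearW => K /=; rewrite mulrBl.
Qed.

Lemma lcoefS n : let u := n%:R + 1 / 2 in let v := n%:R + 1 in
  (2 * n%:R + 2) * (v ^+ 2 - s * v + t) * lcoef s t n.+1 =
  (2 * n%:R + 1) * (u ^+ 2 + s * u + t) * lcoef s t n.
Proof.
move=> u v.
set a := (2 * n%:R + 2) * _; set b := (2 * n%:R + 1) * _.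
pose d : R := (2 * n%:R + 1) * (2 * n%:R + 3 / 2).
have l1 : (a * series (fun k => hyp s t k * legm k n.+1) K) @[K --> \oo] -->
    a * lcoef s t n.+1.
  by apply: cvgMr; exact: lcoef_cvg.
have l2 : (b * series (fun k => hyp s t k * legm k n) K
    - d * ((K%:R - n%:R) * (hyp s t K * legm K n))) @[K --> \oo] -->
    b * lcoef s t n - d * 0.
  by apply: cvgB; apply: cvgMr; [exact: lcoef_cvg|exact: boundary].
rewrite mulr0 subr0 in l2.
have e K : a * series (fun k => hyp s t k * legm k n.+1) K =
    b * series (fun k => hyp s t k * legm k n) K
    - d * ((K%:R - n%:R) * (hyp s t K * legm K n)).
  by rewrite /series /= !big_mkord hyp_legm_ratio.
by move: l1; under eq_fun do rewrite e; move=> /(cvg_unique _ l2) ->.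
Qed.

Lemma lcoefE n :
  lcoef s t n * \prod_(j < n) ((j%:R + 1) ^+ 2 - s * (j%:R + 1) + t) =
  lcoef s t 0 * cbin n * \prod_(j < n) ((j%:R + 1 / 2) ^+ 2 + s * (j%:R + 1 / 2) + t).
Proof.
elim: n => [|n IH]; first by rewrite !big_ord0 cbin0 !mulr1.
have n0 : 0 <= n%:R :> R by [].
have e := lcoefS n; rewrite /= in e.
rewrite !big_ord_recr /= cbinS.
set q := (n%:R + 1) ^+ 2 - _ + _ in e *; set p := (n%:R + _) ^+ 2 + _ + _ in e *.
have d : 2 * n%:R + 2 != 0 :> R by lra.
apply: (mulIf d).
transitivity ((2 * n%:R + 2) * q * lcoef s t n.+1 *
   \prod_(j < n) ((j%:R + 1) ^+ 2 - s * (j%:R + 1) + t)); first by ring.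
rewrite e.
transitivity ((2 * n%:R + 1) * p *
  (lcoef s t n * \prod_(j < n) ((j%:R + 1) ^+ 2 - s * (j%:R + 1) + t))); first by ring.
by rewrite IH; field.
Qed.

Lemma lcoef_nneseries n :
  (\sum_(k <oo) (hyp s t k * legm k n)%:E)%E = (lcoef s t n)%:E.
Proof.
by rewrite nneseries_EFin //; [move=> k; exact: lcoef_term_ge0|exact: lcoef_cvg].
Qed.

End LegendreCoefficients.

(** * Parseval's identity and the symmetry in s *)

Section Parseval.
Context {R : realType}.
Implicit Types (s t : R).

(** The triple sum over n, k, l has nonnegative terms. Summing over n first is [legm_parseval];
    grouping the rest by N = k + l gives the Cauchy product. *)
Lemma lcoef_parseval s t s' t' : admissible s t -> admissible s' t' ->
  (\sum_(n <oo) ((4 * n%:R + 1) * (lcoef s t n * lcoef s' t' n))%:E =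
   \sum_(N <oo) (legm N 0 * cauchy_prod (hyp s t) (hyp s' t') N)%:E)%E.
Proof.
move=> st st'.
pose g n k l : \bar R := ((4 * n%:R + 1) * (hyp s t k * legm k n * (hyp s' t' l * legm l n)))%:E.
have g0 n k l : (0 <= g n k l)%E.
  rewrite lee_fin mulr_ge0 ?addr_ge0 ?mulr_ge0 ?lcoef_term_ge0 //;
  by rewrite ?hyp_adm_ge0 ?legm_ge0.
transitivity (\sum_(n <oo) \sum_(k <oo) \sum_(l <oo) g n k l)%E.
  apply: eq_eseriesr => n _.
  rewrite !EFinM -!lcoef_nneseries // nneseriesM; last first.
  - by [].
  - by rewrite lcoef_nneseries.
  - by move=> k; rewrite lee_fin lcoef_term_ge0.
  - by move=> k; rewrite lee_fin lcoef_term_ge0.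
  rewrite -nneseriesZl; last first.
    by move=> k _; apply: nneseries_ge0 => l _ _; rewrite mule_ge0 ?lee_fin ?lcoef_term_ge0.
  apply: eq_eseriesr => k _.
  rewrite -nneseriesZl; last by move=> l _; rewrite mule_ge0 ?lee_fin ?lcoef_term_ge0.
  by apply: eq_eseriesr => l _; rewrite -!EFinM.
rewrite nneseries_interchange; last by move=> *; exact: nneseries_ge0.
transitivity (\sum_(k <oo) \sum_(l <oo) \sum_(n <oo) g n k l)%E.
  by apply: eq_eseriesr => k _; rewrite nneseries_interchange.
transitivity (\sum_(k <oo) \sum_(l <oo)
    (hyp s t k * hyp s' t' l * legm (k + l) 0)%:E)%E.
  apply: eq_eseriesr => k _; apply: eq_eseriesr => l _.
  rewrite (@nneseries_fin _ _ (k + l).+1) //; last first.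
    by move=> n kln; rewrite /g legm_gt ?(mul0r, mulr0) //; lia.
  rewrite sumEFin -(@legm_parseval _ k l (k + l).+1) // mulr_sumr; congr EFin.
  by apply: eq_bigr => n _; ring.
rewrite nneseries_diag; last first.
  by move=> k l; rewrite lee_fin !mulr_ge0 ?hyp_adm_ge0 ?legm_ge0.
apply: eq_eseriesr => N _; rewrite sumEFin; congr EFin.
rewrite /cauchy_prod mulr_sumr; apply: eq_bigr => -[k kN] _ /=.
by rewrite subnKC // mulrC.
Qed.

Lemma lcoef_even s t t' : admissible s t -> admissible (- s) t' ->
    admissible (- s) t -> admissible s t' ->
  (\sum_(n <oo) ((4 * n%:R + 1) * (lcoef s t n * lcoef (- s) t' n))%:E =
   \sum_(n <oo) ((4 * n%:R + 1) * (lcoef (- s) t n * lcoef s t' n))%:E)%E.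
Proof.
move=> *; rewrite !lcoef_parseval //; apply: eq_eseriesr => N _.
by rewrite cauchy_prod_hyp.
Qed.

End Parseval.

(** * Truncated products with explicit remainders *)

Section TruncatedProducts.
Context {R : realFieldType}.
Implicit Types (a b c : nat -> R) (e y r t al be ga : R) (N : nat).

(** The sum of the absolute values of the coefficients, with the remainder bound r counted as one of
    them, is submultiplicative for 0 <= y <= 1. *)
Let trunc_step y r t1 t2 t3 al be ga Q : 0 <= y <= 1 -> 0 <= r ->
  `|Q - (1 + t1 * y + t2 * y ^+ 2 + t3 * y ^+ 3)| <= r * y ^+ 4 ->
  exists r', [/\ 0 <= r',
    1 + `|t1 + al| + `|t2 + t1 * al + be| + `|t3 + t2 * al + t1 * be + ga| + r' <=
     (1 + `|t1| + `|t2| + `|t3| + r) * (1 + (`|al| + `|be| + `|ga|)) &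
    `|Q * (1 + al * y + be * y ^+ 2 + ga * y ^+ 3) -
      (1 + (t1 + al) * y + (t2 + t1 * al + be) * y ^+ 2 +
       (t3 + t2 * al + t1 * be + ga) * y ^+ 3)| <= r' * y ^+ 4].
Proof.
move=> /andP[y0 y1] r0 hQ.
have ny k x : `|x * y ^+ k| <= `|x|.
  by rewrite normrM normrX (ger0_norm y0) ler_piMr // exprn_ile1.
have ny1 x : `|x * y| <= `|x| by have := ny 1%N x.
pose T := 1 + t1 * y + t2 * y ^+ 2 + t3 * y ^+ 3.
pose f := 1 + al * y + be * y ^+ 2 + ga * y ^+ 3.
(* The terms of degree at least 4 in T f, divided by y^4. *)
pose S := t1 * ga + t2 * be + t3 * al + (t2 * ga) * y + (t3 * be) * y + (t3 * ga) * y ^+ 2.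
have nf : `|f| <= 1 + (`|al| + `|be| + `|ga|).
  have := ler_normD (1 + al * y + be * y ^+ 2) (ga * y ^+ 3).
  have := ler_normD (1 + al * y) (be * y ^+ 2).
  have := ler_normD 1 (al * y); rewrite normr1.
  have := ny 3%N ga; have := ny 2%N be; have := ny1 al.
  rewrite -/f; lra.
have nS : `|S| <= `|t1| * `|ga| + `|t2| * (`|be| + `|ga|) + `|t3| * (`|al| + `|be| + `|ga|).
  have h x z : `|x * z| = `|x| * `|z| by exact: normrM.
  have := ler_normD (t1 * ga + t2 * be + t3 * al + (t2 * ga) * y + (t3 * be) * y) ((t3 * ga) * y ^+ 2).
  have := ler_normD (t1 * ga + t2 * be + t3 * al + (t2 * ga) * y) ((t3 * be) * y).
  have := ler_normD (t1 * ga + t2 * be + t3 * al) ((t2 * ga) * y).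
  have := ler_normD (t1 * ga + t2 * be) (t3 * al).
  have := ler_normD (t1 * ga) (t2 * be).
  have := ny 2%N (t3 * ga); have := ny1 (t3 * be); have := ny1 (t2 * ga).
  rewrite -/S !h; lra.
exists (r * (1 + (`|al| + `|be| + `|ga|)) +
  (`|t1| * `|ga| + `|t2| * (`|be| + `|ga|) + `|t3| * (`|al| + `|be| + `|ga|))); split.
- by rewrite !addr_ge0 ?mulr_ge0 ?addr_ge0.
- have h x z : `|x * z| = `|x| * `|z| by exact: normrM.
  have := ler_normD t1 al; have := ler_normD (t2 + t1 * al) be.
  have := ler_normD t2 (t1 * al); have := ler_normD (t3 + t2 * al + t1 * be) ga.
  have := ler_normD (t3 + t2 * al) (t1 * be); have := ler_normD t3 (t2 * al).
  rewrite !h; nra.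
rewrite (_ : _ - _ = (Q - T) * f + S * y ^+ 4); last by rewrite /T /f /S; ring.
apply: le_trans (ler_normD _ _) _.
rewrite [`|_ * f|]normrM [`|S * _|]normrM mulrDl; apply: lerD.
  by rewrite -mulrA [_ * y ^+ 4]mulrC mulrA; apply: ler_pM.
by rewrite normrX (ger0_norm y0) ler_wpM2r // exprn_ge0.
Qed.

(* The coefficients are bounded by those of the product of the
   [1 + (|a| + 2 |b| + |c|) y]; the part odd in [e] is given explicitly. *)
Lemma prod_trunc a b c N : let A := \sum_(i < N) a i in let B := \sum_(i < N) b i in
  let D := \sum_(i < N) a i * b i in
  let M := \prod_(i < N) (1 + (`|a i| + 2 * `|b i| + `|c i|)) in
  exists E2 E3 : R, forall e y, `|e| <= 1 -> 0 <= y <= 1 ->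
    exists r, [/\ 0 <= r,
      1 + `|A| + `|E2 - 2 * e * B| + `|E3 + 2 * e * (A * B - D)| + r <= M &
    `|\prod_(i < N) (1 - y * a i - 2 * e * y ^+ 2 * b i - y ^+ 3 * c i) -
      (1 - A * y + (E2 - 2 * e * B) * y ^+ 2 + (E3 + 2 * e * (A * B - D)) * y ^+ 3)|
    <= r * y ^+ 4].
Proof.
elim: N => [|N IH] A B D M.
  exists 0, 0 => e y _ _; exists 0; rewrite /A /B /D /M !big_ord0.
  split; rewrite ?(mul0r, mulr0, subr0, addr0) ?normr0 ?addr0 //.
  by rewrite subrr normr0.
case: IH; set A1 := \sum_(i < N) a i; set B1 := \sum_(i < N) b i.
set D1 := \sum_(i < N) a i * b i; set M1 := \prod_(i < N) _ => E2 [E3 IH].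
(* The witnesses do not depend on e, so that the even parts for e = 1 and e = -1 cancel in a
   difference. *)
exists (E2 + A1 * a N), (E3 - a N * E2 - c N) => e y e1 y01.
have [r [r0 rM hr]] := IH e y e1 y01.
have eA : A = A1 + a N by rewrite /A big_ord_recr.
have eB : B = B1 + b N by rewrite /B big_ord_recr.
have eD : D = D1 + a N * b N by rewrite /D big_ord_recr.
have eM : M = M1 * (1 + (`|a N| + 2 * `|b N| + `|c N|)) by rewrite /M big_ord_recr.
rewrite {}eA {}eB {}eD {}eM big_ord_recr /=.
move: hr rM; set Q := \prod_(i < N) _ => hr rM.
rewrite (_ : 1 - A1 * y = 1 + - A1 * y) in hr; last by ring.
have [r' [r'0 r'M hr']] :=
  trunc_step (- a N) (- (2 * e * b N)) (- c N) y01 r0 hr.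
exists r'; split => //.
  apply: le_trans (le_trans r'M _).
    rewrite (_ : `|- A1 - a N| = `|A1 + a N|); last by rewrite -opprD normrN.
    rewrite le_eqVlt; apply/orP; left; apply/eqP.
    have -> : E2 + A1 * a N - 2 * e * (B1 + b N) =
      E2 - 2 * e * B1 + - A1 * - a N - 2 * e * b N by ring.
    have -> : E3 - a N * E2 - c N + 2 * e * ((A1 + a N) * (B1 + b N) - (D1 + a N * b N)) =
      E3 + 2 * e * (A1 * B1 - D1) + (E2 - 2 * e * B1) * - a N +
      - A1 * - (2 * e * b N) - c N by ring.
    by [].
  rewrite !normrN; apply: ler_pM => //.
    by rewrite !addr_ge0.
  rewrite lerD2l lerD2r lerD2l normrM normrM ger0_norm //.
  by rewrite ler_wpM2r // -[X in _ <= X]mulr1 ler_wpM2l.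
move: hr'; congr (`|_| <= _); congr (_ - _); last by ring.
by congr (_ * _); ring.
Qed.

End TruncatedProducts.

(** * The product over the nodes *)

Section Contiguity.
Context {R : realType}.
Implicit Types (s t x y : R) (i j n N r : nat).

(* The reciprocals of the roots [1/2, ..., n - 1/2, - (n + 1), - (n + 2), ...]. *)
Definition node n i : R := if (i < n)%N then (i%:R + 1 / 2)^-1 else - (i%:R + 1)^-1.

Definition node_prod s t n N : R := \prod_(i < N) (1 - (s * node n i + t * node n i ^+ 2) ^+ 2).

(** The denominators of [lcoef0E] for s and for - s, multiplied together and divided by (j + 1)^4;
    their product is the factor even in s. For s^2 <= 1/4 each lies in [0, 1]. *)
Definition wallis_factor s j : R :=
  (j%:R + 3 / 2) ^+ 2 * ((j%:R + 1 / 2) ^+ 2 - s ^+ 2) / (j%:R + 1) ^+ 4.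

Lemma wallis_factor_cvg s : s ^+ 2 <= 1 / 4 ->
  cvgn (fun N => \prod_(j < N) wallis_factor s j) /\
  0 <= limn (fun N => \prod_(j < N) wallis_factor s j).
Proof.
move=> s4.
have w01 j : 0 <= wallis_factor s j <= 1.
  have j0 : 0 <= j%:R :> R by [].
  have d : 0 < (j%:R + 1) ^+ 4 :> R by rewrite exprn_gt0 //; lra.
  apply/andP; split.
    rewrite divr_ge0 ?(ltW d) // mulr_ge0 ?sqr_ge0 //; nra.
  rewrite ler_pdivrMr // [X in _ <= X]mul1r.
  apply: le_trans (_ : (j%:R + 3 / 2) ^+ 2 * (j%:R + 1 / 2) ^+ 2 <= _).
    by rewrite ler_wpM2l ?sqr_ge0 // lerBlDr lerDl sqr_ge0.
  rewrite -exprMn (_ : (j%:R + 1) ^+ 4 = ((j%:R + 1) ^+ 2) ^+ 2); last by ring.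
  rewrite lerXn2r ?nnegrE ?mulr_ge0 ?sqr_ge0 //; nra.
have p0 N : 0 <= \prod_(j < N) wallis_factor s j.
  by apply: prodr_ge0 => j _; case/andP: (w01 j).
have cv : cvgn (fun N => \prod_(j < N) wallis_factor s j).
  apply: nonincreasing_is_cvgn; last by exists 0 => _ [n _ <-].
  apply/nonincreasing_seqP => N; rewrite big_ord_recr /= ler_piMr ?p0 //.
  by case/andP: (w01 N).
by split=> //; apply: limr_ge => //; apply: nearW.
Qed.

(* [u ^ 4 - (s u + t) ^ 2] factors as [(u ^ 2 + s u + t) (u ^ 2 - s u - t)]. *)
Lemma node_prod_cvg s t n : s ^+ 2 < 1 / 4 -> `|s| + `|t| < 1 ->
    admissible s t -> admissible (- s) (- t) ->
  (cbin n ^+ 6 * node_prod s t n N) @[N --> \oo] -->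
  limn (fun N => \prod_(j < N) wallis_factor s j) * (lcoef s t n * lcoef (- s) (- t) n).
Proof.
move=> s4 stlt adm adm'.
pose v j : R := j%:R + 1; pose u j : R := j%:R + 1 / 2.
have v0 j : 1 <= v j by rewrite /v lerDr.
have u0 j : 0 < u j by rewrite /u ltr_wpDl.
(* The factors of the two closed forms multiplied in pairs: [q] belongs to the negative nodes, [p]
   to the half-integers, [d] to the denominators. The bound on |s| + |t| makes [q] positive. *)
pose q j := v j ^+ 4 - (s * v j - t) ^+ 2; pose p j := u j ^+ 4 - (s * u j + t) ^+ 2.
pose d j : R := (j%:R + 3 / 2) ^+ 2 * (u j ^+ 2 - s ^+ 2).
have d0 j : d j != 0.
  have j0 : 0 <= j%:R :> R by [].
  apply: mulf_neq0; first by rewrite expf_neq0 //; lra.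
  by rewrite gt_eqF // subr_gt0 (lt_le_trans s4) // /u; nra.
have v4 j : v j ^+ 4 != 0 by rewrite expf_neq0 // gt_eqF // (lt_le_trans _ (v0 j)).
have q0 j : 0 < q j.
  rewrite subr_gt0 (_ : v j ^+ 4 = (v j ^+ 2) ^+ 2); last by ring.
  have := v0 j; have := ler_norm s; have := ler_norm (- s); have := ler_norm t.
  have := ler_norm (- t); rewrite !normrN => *.
  have v2 : v j <= v j ^+ 2 by rewrite expr2 ler_peMl // (le_trans _ (v0 j)).
  have vn : 0 <= v j by exact: le_trans (v0 j).
  rewrite -[X in X < _]real_normK ?num_real // ltrXn2r // ?nnegrE //.
  apply: le_lt_trans (ler_normB _ _) _; rewrite normrM (ger0_norm vn).
  have := normr_ge0 t; nra.
have cn m' : cbin m' ^+ 4 = \prod_(j < m') (u j ^+ 4 / v j ^+ 4).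
  elim: m' => [|m IH]; first by rewrite big_ord0 cbin0 expr1n.
  rewrite big_ord_recr /= -IH cbinS exprMn; congr (_ * _).
  have m0 : 0 <= m%:R :> R by [].
  by rewrite /u /v; field; lra.
have lim1 : (\prod_(j < N) (q j / d j)) @[N --> \oo] --> lcoef s t 0 * lcoef (- s) (- t) 0.
  have l0 := lcoef0E adm; have l0' := lcoef0E adm'.
  have -> : (fun N => \prod_(j < N) (q j / d j)) =
     (fun N => \prod_(j < N) (((j%:R + 1) ^+ 2 - s * (j%:R + 1) + t) /
         ((j%:R + 3 / 2) * (j%:R + 1 / 2 - s))) *
       \prod_(j < N) (((j%:R + 1) ^+ 2 - - s * (j%:R + 1) + - t) /
         ((j%:R + 3 / 2) * (j%:R + 1 / 2 - - s)))); last by exact: cvgM.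
  apply/funext => N; rewrite -big_split; apply: eq_bigr => j _ /=.
  have j0 : 0 <= j%:R :> R by [].
  have := d0 j; rewrite /q /d /v /u; set w := (_ + _) ^+ 2 * _ => w0.
  have e : w = ((j%:R + 3 / 2) * (j%:R + 1 / 2 - s)) * ((j%:R + 3 / 2) * (j%:R + 1 / 2 - - s)).
    by rewrite /w; ring.
  by rewrite mulf_div -e; congr (_ / _); ring.
have lim2 := (wallis_factor_cvg (ltW s4)).1.
set lam : R := limn _ in lim2 *.
have Xn : lcoef s t n * lcoef (- s) (- t) n * \prod_(j < n) q j =
    lcoef s t 0 * lcoef (- s) (- t) 0 * (cbin n ^+ 2 * \prod_(j < n) p j).
  have := congr2 *%R (lcoefE adm n) (lcoefE adm' n).
  rewrite mulrACA -big_split => e.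
  transitivity (lcoef s t 0 * cbin n * (lcoef (- s) (- t) 0 * cbin n) * \prod_(j < n) p j).
    rewrite /= mulrACA -big_split in e.
    transitivity (lcoef s t n * lcoef (- s) (- t) n * \prod_(i < n) ((v i ^+ 2 - s * v i + t) *
       (v i ^+ 2 - - s * v i + - t))).
      by congr (_ * _); apply: eq_bigr => j _; rewrite /q; ring.
    by rewrite e; congr (_ * _); apply: eq_bigr => j _; rewrite /p /u /=; field.
  by ring.
have qn0 : \prod_(j < n) q j != 0 by apply/prodf_neq0 => j _; rewrite gt_eqF.
have -> : lam * (lcoef s t n * lcoef (- s) (- t) n) =
  (cbin n ^+ 2 * \prod_(j < n) p j / \prod_(j < n) q j) *
  (lcoef s t 0 * lcoef (- s) (- t) 0 * lam).
  apply: (mulIf qn0).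
  transitivity (lam * (lcoef s t n * lcoef (- s) (- t) n * \prod_(j < n) q j)).
    by rewrite -[LHS]mulrA.
  by rewrite Xn; field.
set K := _ / \prod_(j < n) q j.
have : (K * (\prod_(j < N) (q j / d j) * \prod_(j < N) wallis_factor s j)) @[N --> \oo] -->
    (K * (lcoef s t 0 * lcoef (- s) (- t) 0 * lam) : R).
  by apply: cvgMr; exact: cvgM lim1 lim2.
apply: cvg_trans; apply: near_eq_cvg; near=> N.
have nN : (n <= N)%N by near: N; exists n.
(* In the limit the first n factors are q / v^4 and must become p / u^4: [K] supplies p / q and [cn]
   supplies u^4 / v^4. *)
have split_prod (F : nat -> R) : \prod_(j < N) F j = \prod_(j < n) F j * \prod_(n <= j < N) F j.
  by rewrite -!(big_mkord xpredT) (@big_cat_nat _ _ _ n).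
rewrite /node_prod (split_prod (fun i => 1 - (s * node n i + t * node n i ^+ 2) ^+ 2)).
have -> : \prod_(j < n) (1 - (s * node n j + t * node n j ^+ 2) ^+ 2) =
    \prod_(j < n) (p j / u j ^+ 4).
  apply: eq_bigr => -[j jn] _ /=; rewrite /node jn /p -/(u j).
  by have := u0 j => uj; field; rewrite gt_eqF.
have -> : \prod_(n <= j < N) (1 - (s * node n j + t * node n j ^+ 2) ^+ 2) =
    \prod_(n <= j < N) (q j / v j ^+ 4).
  apply: eq_big_nat => j /andP[nj _]; rewrite /node ltnNge nj /= /q -/(v j).
  by have := v0 j => vj; field; rewrite gt_eqF // (lt_le_trans _ vj).
have -> : (\prod_(j < N) (q j / d j)) * (\prod_(j < N) wallis_factor s j) =
   \prod_(j < N) (q j / v j ^+ 4).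
  rewrite -big_split; apply: eq_bigr => j _ /=; rewrite /wallis_factor -/(u j) -/(d j) -/(v j).
  by rewrite mulrA divfK.
rewrite (split_prod (fun j => q j / v j ^+ 4)) [cbin n ^+ 6](_ : _ = cbin n ^+ 2 * cbin n ^+ 4).
  rewrite cn; have -> : \prod_(j < n) (q j / v j ^+ 4) =
     \prod_(j < n) q j * \prod_(j < n) (v j ^+ 4)^-1 by rewrite -big_split.
  have -> : \prod_(j < n) (p j / u j ^+ 4) =
     \prod_(j < n) p j * \prod_(j < n) (u j ^+ 4)^-1 by rewrite -big_split.
  have -> : \prod_(j < n) (u j ^+ 4 / v j ^+ 4) =
     \prod_(j < n) u j ^+ 4 * \prod_(j < n) (v j ^+ 4)^-1 by rewrite -big_split.
  have : \prod_(j < n) u j ^+ 4 * \prod_(j < n) (u j ^+ 4)^-1 = 1.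
    by rewrite -big_split big1 // => j _; rewrite /= mulfV // expf_neq0 // gt_eqF.
  rewrite /K; move: (\prod_(j < n) u j ^+ 4) (\prod_(j < n) (u j ^+ 4)^-1) => U V UV.
  move: (\prod_(j < n) p j) (\prod_(j < n) (v j ^+ 4)^-1) (\prod_(n <= j < N) _) => P W Z.
  move: (\prod_(j < n) q j) qn0 => Q Q0.
  transitivity (cbin n ^+ 2 * P * W * Z); first by field.
  by rewrite -[LHS]mulr1 -UV; ring.
by ring.
Unshelve. all: by end_near. Qed.

(** This is [lcoef_even] at t' = - t, multiplied by the product of the [wallis_factor], which
    depends on s^2 only. *)
Lemma node_prod_even s t : s ^+ 2 < 1 / 4 -> `|s| + `|t| < 1 ->
    admissible s t -> admissible (- s) (- t) -> admissible (- s) t -> admissible s (- t) ->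
  (\sum_(n <oo) ((4 * n%:R + 1) * (cbin n ^+ 6 * limn (node_prod s t n)))%:E =
   \sum_(n <oo) ((4 * n%:R + 1) * (cbin n ^+ 6 * limn (node_prod (- s) t n)))%:E)%E.
Proof.
move=> s4 stlt a1 a2 a3 a4.
have a2' : admissible (- - s) (- t) by rewrite opprK.
set lam := limn (fun N => \prod_(j < N) wallis_factor s j).
have lam0 : 0 <= lam by case: (wallis_factor_cvg (ltW s4)).
have clim s' n : s' ^+ 2 < 1 / 4 -> `|s'| + `|t| < 1 ->
    admissible s' t -> admissible (- s') (- t) ->
    cbin n ^+ 6 * limn (node_prod s' t n) =
    limn (fun N => \prod_(j < N) wallis_factor s' j) * (lcoef s' t n * lcoef (- s') (- t) n).
  move=> h1 h2 h3 h4; have h := @node_prod_cvg s' t n h1 h2 h3 h4.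
  have c0 : cbin n ^+ 6 != 0 :> R by rewrite expf_neq0 // gt_eqF // cbin_gt0.
  have : ((cbin n ^+ 6)^-1 * (cbin n ^+ 6 * node_prod s' t n N)) @[N --> \oo] -->
    ((cbin n ^+ 6)^-1 * (limn (fun N => \prod_(j < N) wallis_factor s' j) *
      (lcoef s' t n * lcoef (- s') (- t) n)) : R) by exact: cvgMr.
  have -> : (fun N => (cbin n ^+ 6)^-1 * (cbin n ^+ 6 * node_prod s' t n N)) =
    node_prod s' t n by apply/funext => N; rewrite mulKf.
  by move=> /cvg_lim -> //; rewrite mulVKf.
have lamN : limn (fun N => \prod_(j < N) wallis_factor (- s) j) = lam.
  by congr (limn _); apply/funext => N; apply: eq_bigr => j _; rewrite /wallis_factor sqrrN.
transitivity (lam%:E * \sum_(n <oo) ((4 * n%:R + 1) * (lcoef s t n * lcoef (- s) (- t) n))%:E)%E.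
  rewrite -nneseriesZl; last first.
    by move=> n _; rewrite lee_fin !mulr_ge0 ?addr_ge0 ?mulr_ge0 ?lcoef_ge0.
  by apply: eq_eseriesr => n _; rewrite clim // -EFinM -/lam; congr EFin; ring.
rewrite lcoef_even // -nneseriesZl; last first.
  by move=> n _; rewrite lee_fin !mulr_ge0 ?addr_ge0 ?mulr_ge0 ?lcoef_ge0.
apply: eq_eseriesr => n _; rewrite clim ?sqrrN ?normrN // opprK lamN -EFinM.
by congr EFin; ring.
Qed.

End Contiguity.

(** * Power sums of the nodes *)

Section PowerSums.
Context {R : realType}.
Implicit Types (i n N r : nat).

Lemma sum_inv_sqr_le N : \sum_(i < N) ((i%:R + 1)^-1 : R) ^+ 2 <= 2.
Proof.
case: N => [|N]; first by rewrite big_ord0.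
suff : \sum_(i < N.+1) ((i%:R + 1)^-1 : R) ^+ 2 <= 2 - (N%:R + 1)^-1.
  by move=> h; apply: le_trans h _; rewrite gerBl invr_ge0 addr_ge0.
elim: N => [|N IH]; first by rewrite big_ord1 /= add0r invr1; lra.
rewrite big_ord_recr /= -[N.+1%:R]natr1; apply: le_trans (lerD IH (lexx _)) _.
have n0 : 0 <= N%:R :> R by [].
rewrite -subr_ge0 (_ : _ - _ = (N%:R + 1 + 1)^-1 ^+ 2 * (N%:R + 1)^-1).
  by rewrite mulr_ge0 ?sqr_ge0 // invr_ge0; lra.
by field; lra.
Qed.

Lemma zeta_cvg r : (2 <= r)%N -> cvgn (series (fun k : nat => (k.+1%:R : R) ^- r)).
Proof.
move=> r2; apply: (@series_ge0_cvg _ _ 2) => [k|n]; first by rewrite invr_ge0 exprn_ge0.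
apply: le_trans (sum_inv_sqr_le n); rewrite /series /= big_mkord; apply: ler_sum => i _.
rewrite natr1 -exprVn -(subnKC r2) exprD ler_piMr ?sqr_ge0 //.
by rewrite exprn_ile1 ?invr_ge0 ?invf_le1 ?ltr0n // ler1n.
Qed.

(** The nodes from index n on form a tail of (-1)^r zeta(r); its n missing terms are compensated in
    the finite sum. *)
Lemma node_sum_cvg r n : (2 <= r)%N -> (\sum_(i < N) (node n i : R) ^+ r) @[N --> \oo] -->
  \sum_(i < n) ((i%:R + 1 / 2)^-1 ^+ r - (-1) ^+ r * (i%:R + 1)^-1 ^+ r) + (-1) ^+ r * zeta R r.
Proof.
move=> r2; set K := \sum_(i < n) _.
have : (K + (-1) ^+ r * series (fun k : nat => (k.+1%:R : R) ^- r) N) @[N --> \oo] -->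
    (K + (-1) ^+ r * zeta R r : R).
  by apply: cvgD; [exact: cvg_cst|apply: cvgMr; exact: zeta_cvg].
apply: cvg_trans; apply: near_eq_cvg; near=> N.
have nN : (n <= N)%N by near: N; exists n.
rewrite /series /= !(big_mkord xpredT) -!(big_mkord xpredT (fun i => _ i ^+ r)).
rewrite (@big_cat_nat _ _ _ n 0 N) //= -(big_mkord xpredT (fun k => k.+1%:R ^- r)).
rewrite [in LHS](@big_cat_nat _ _ _ n 0 N) //= mulrDr addrA; congr (_ + _).
  rewrite /K -(big_mkord xpredT (fun i => (i%:R + 1 / 2)^-1 ^+ r - (-1) ^+ r * (i%:R + 1)^-1 ^+ r)).
  rewrite mulr_sumr -big_split; apply: eq_big_nat => i /andP[_ ni].
  by rewrite /= /node ni -exprVn -(natr1 i) subrK.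
rewrite mulr_sumr; apply: eq_big_nat => i /andP[ni _].
by rewrite /node ltnNge ni /= [RHS]exprNn natr1 -exprVn.
Unshelve. all: by end_near. Qed.

(** The indices k = 2 i + 1 and k = 2 i + 2, each divided by 2. *)
Lemma harmonic_number_double r n : 2 ^+ r * harmonic_number R r (2 * n) =
  \sum_(i < n) ((i%:R + 1 / 2)^-1 ^+ r + (i%:R + 1)^-1 ^+ r).
Proof.
rewrite /harmonic_number big_add1 /=.
elim: n => [|n IH]; first by rewrite muln0 big_geq // mulr0 big_ord0.
rewrite (_ : (2 * n.+1 = (2 * n).+2)%N); last by lia.
rewrite !big_nat_recr //= big_ord_recr /= -IH -addrA mulrDr; congr (_ + _).
have n0 : 0 <= n%:R :> R by [].
rewrite -!exprVn mulrDr -!exprMn; congr (_ ^+ _ + _ ^+ _);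
  by rewrite -!natr1 natrM; field; lra.
Qed.

Lemma harmonic_numberE r n : harmonic_number R r n = \sum_(i < n) (i%:R + 1)^-1 ^+ r.
Proof.
rewrite /harmonic_number big_add1 big_mkord; apply: eq_bigr => i _.
by rewrite natr1 exprVn.
Qed.

Lemma node_sum3 n : (\sum_(i < N) (node n i : R) ^+ 3) @[N --> \oo] -->
  8 * harmonic_number R 3 (2 * n) - zeta R 3.
Proof.
rewrite (_ : _ - _ = \sum_(i < n) ((i%:R + 1 / 2)^-1 ^+ 3 - (-1) ^+ 3 * (i%:R + 1)^-1 ^+ 3)
  + (-1) ^+ 3 * zeta R 3); first exact: node_sum_cvg.
rewrite (_ : 8 = 2 ^+ 3); last by ring.
rewrite harmonic_number_double; congr (_ + _); last by ring.
by apply: eq_bigr => i _; ring.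
Qed.

Lemma node_sum4 n : (\sum_(i < N) (node n i : R) ^+ 4) @[N --> \oo] -->
  2 * (8 * harmonic_number R 4 (2 * n) - harmonic_number R 4 n) + zeta R 4.
Proof.
rewrite (_ : _ + _ = \sum_(i < n) ((i%:R + 1 / 2)^-1 ^+ 4 - (-1) ^+ 4 * (i%:R + 1)^-1 ^+ 4)
  + (-1) ^+ 4 * zeta R 4); first exact: node_sum_cvg.
rewrite (_ : 2 * _ = 2 ^+ 4 * harmonic_number R 4 (2 * n) - 2 * harmonic_number R 4 n).
  rewrite harmonic_number_double harmonic_numberE mulr_sumr -sumrB; congr (_ + _); last by ring.
  by apply: eq_bigr => i _; ring.
by ring.
Qed.

Lemma node_sum7 n : (\sum_(i < N) (node n i : R) ^+ 7) @[N --> \oo] -->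
  128 * harmonic_number R 7 (2 * n) - zeta R 7.
Proof.
rewrite (_ : _ - _ = \sum_(i < n) ((i%:R + 1 / 2)^-1 ^+ 7 - (-1) ^+ 7 * (i%:R + 1)^-1 ^+ 7)
  + (-1) ^+ 7 * zeta R 7); first exact: node_sum_cvg.
rewrite (_ : 128 = 2 ^+ 7); last by ring.
rewrite harmonic_number_double; congr (_ + _); last by ring.
by apply: eq_bigr => i _; ring.
Qed.

Lemma node_le n i : `|node n i : R| <= 2 * (i%:R + 1)^-1.
Proof.
have i0 : 0 <= i%:R :> R by [].
rewrite /node; case: ifP => _; rewrite ?normrN ger0_norm ?invr_ge0; try lra.
  rewrite -[2]invrK -invfM lef_pV2 ?posrE; lra.
by rewrite ler_peMl ?invr_ge0; lra.
Qed.

(** With w = |node| and z = 1 / (i + 1), w <= 2 z <= 2 gives w^2 (1 + w)^2 <= 36 z^2, and the z^2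
    add up to at most 2: hence 72. The bound is uniform in n and N. *)
Lemma node_bound n N : \prod_(i < N) (1 + (`|(node n i : R) ^+ 4| +
  2 * `|(node n i : R) ^+ 3| + `|(node n i : R) ^+ 2|)) <= expR 72.
Proof.
have h i : `|(node n i : R) ^+ 4| + 2 * `|(node n i : R) ^+ 3| + `|(node n i : R) ^+ 2| <=
    36 * (i%:R + 1)^-1 ^+ 2.
  have key (w z : R) : 0 <= w -> 0 <= z -> z <= 1 -> w <= 2 * z ->
      w ^+ 4 + 2 * w ^+ 3 + w ^+ 2 <= 36 * z ^+ 2.
    move=> w0 z0 z1 wz; have w2 : w <= 2 by lra.
    have wz2 : w ^+ 2 <= 4 * z ^+ 2 by nra.
    have w2sq : w ^+ 2 <= 4 by nra.
    have -> : w ^+ 4 + 2 * w ^+ 3 + w ^+ 2 = w ^+ 2 * (w ^+ 2 + 2 * w + 1) by ring.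
    apply: le_trans (_ : 4 * z ^+ 2 * 9 <= _); last by lra.
    by apply: ler_pM => //; [exact: sqr_ge0|rewrite !addr_ge0 ?sqr_ge0 ?mulr_ge0|lra].
  rewrite !normrX; apply: key (node_le n i) => //.
  by rewrite invf_le1 ?lerDr // ltr_wpDl.
apply: le_trans (_ : \prod_(i < N) expR (36 * (i%:R + 1)^-1 ^+ 2) <= _).
  apply: ler_prod => i _; rewrite !addr_ge0 ?mulr_ge0 //=.
  by apply: le_trans (expR_ge1Dx _); rewrite lerD2l.
rewrite -expR_sum ler_expR -mulr_sumr (_ : 72 = 36 * 2); last by ring.
by rewrite ler_pM2l // sum_inv_sqr_le.
Qed.

End PowerSums.

(** * Comparison of coefficients and the left-hand side *)

Section WeightedHarmonicSum.
Context {R : realType}.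
Implicit Types (x y p q M : R) (n N : nat).

Definition weight n : R := (4 * n%:R + 1) * cbin n ^+ 6.

Lemma weight_ge0 n : 0 <= weight n.
Proof. by rewrite mulr_ge0 ?addr_ge0 ?mulr_ge0 ?exprn_ge0 // ltW // cbin_gt0. Qed.

(** As c_n^2 <= 1 / (2 n + 1), the weights are O(n^-2). *)
Lemma weight_cvg : cvgn (series weight).
Proof.
apply: (@series_ge0_cvg _ _ 4) => [|N]; first exact: weight_ge0.
apply: le_trans (_ : 2 * \sum_(i < N) (i%:R + 1)^-1 ^+ 2 <= _); last first.
  by have := @sum_inv_sqr_le R N; lra.
rewrite /series /= big_mkord mulr_sumr; apply: ler_sum => i _.
have i0 : 0 <= i%:R :> R by [].
have c2 : (cbin i : R) ^+ 2 <= (2 * i%:R + 1)^-1.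
  by rewrite -[X in _ <= X]mul1r ler_pdivlMr ?cbin_sqr_le //; lra.
have c6 : (cbin i : R) ^+ 6 <= (2 * i%:R + 1)^-1 ^+ 3.
  rewrite (_ : cbin i ^+ 6 = (cbin i ^+ 2) ^+ 3); last by ring.
  by rewrite lerXn2r // ?nnegrE ?sqr_ge0 // invr_ge0; lra.
apply: le_trans (_ : (4 * i%:R + 1) * (2 * i%:R + 1)^-1 ^+ 3 <= _).
  by rewrite ler_wpM2l //; lra.
rewrite !exprVn ler_pdivrMr; last by rewrite exprn_gt0 //; lra.
rewrite mulrAC ler_pdivlMr; last by rewrite exprn_gt0 //; lra.
nra.
Qed.

Lemma linear_bound_eq0 p M y0 : 0 < y0 -> 0 <= M ->
  (forall y, 0 < y <= y0 -> `|p| <= M * y) -> p = 0.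
Proof.
move=> y00 M0 h; apply/eqP; rewrite -normr_eq0 eq_le normr_ge0 andbT.
apply/ler_addgt0Pr => e e0; rewrite add0r.
pose y := Num.min y0 (e / (M + 1)).
have M1 : 0 < M + 1 by lra.
have yp : 0 < y by rewrite lt_min y00 divr_gt0.
have yy : y <= y0 by rewrite ge_min lexx.
apply: le_trans (h y _) _; first by rewrite yp.
apply: le_trans (_ : (M + 1) * y <= _); first by nra.
by rewrite mulrC -ler_pdivlMr // ge_min lexx orbT.
Qed.

Lemma quadratic_bound_eq0 p q M y0 : 0 < y0 -> 0 <= M ->
  (forall y, 0 < y <= y0 -> `|p - q * y| <= M * y ^+ 2) -> p = 0 /\ q = 0.
Proof.
move=> y00 M0 h.
have p0 : p = 0.
  apply: (@linear_bound_eq0 _ (`|q| + M * y0) y0) => //.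
    by rewrite addr_ge0 // mulr_ge0 // ltW.
  move=> y /andP[yp yy]; have := h y; rewrite yp yy => /(_ isT) hy.
  rewrite -[p](subrK (q * y)); apply: le_trans (ler_normD _ _) _.
  rewrite normrM (gtr0_norm yp) mulrDl addrC lerD2l.
  apply: le_trans hy _; rewrite expr2 mulrA.
  by apply: ler_wpM2r; [exact: ltW|exact: ler_wpM2l].
split=> //; apply: (@linear_bound_eq0 _ M y0) => // y /andP[yp yy].
have := h y; rewrite yp yy p0 sub0r normrN normrM (gtr0_norm yp) => /(_ isT).
by rewrite expr2 mulrA ler_pM2r.
Qed.

(** For s = e x^3 and y = x^2 a factor is 1 - y w^4 - 2 e y^2 w^3 - y^3 w^2, where w is a node: the
    form of [prod_trunc]. The difference of e = 1 and e = -1 leaves the odd parts. Since the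
    coefficients are bounded for both signs, so are B and A B - D. *)
Lemma node_prod_trunc n N x : 0 < x <= 1 / 8 ->
  let A := \sum_(i < N) (node n i : R) ^+ 4 in
  let B := \sum_(i < N) (node n i : R) ^+ 3 in
  let D := \sum_(i < N) (node n i : R) ^+ 7 in
  [/\ `|B| <= expR 72, `|A * B - D| <= expR 72, `|node_prod (x ^+ 3) x n N| <= expR 72,
    `|node_prod (- x ^+ 3) x n N| <= expR 72 &
  `|node_prod (x ^+ 3) x n N - node_prod (- x ^+ 3) x n N
    + 4 * (x ^+ 2) ^+ 2 * B - 4 * (x ^+ 2) ^+ 3 * (A * B - D)|
    <= 2 * expR 72 * (x ^+ 2) ^+ 4].
Proof.
move=> /andP[x0 x8] A B D; set C := expR 72.
have [E2 [E3]] := @prod_trunc R (fun i => node n i ^+ 4) (fun i => node n i ^+ 3)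
  (fun i => node n i ^+ 2) N.
rewrite -/A -/B (_ : \sum_(i < N) _ * _ = D); last first.
  by apply: eq_bigr => i _; rewrite -exprD.
have := @node_bound R n N; rewrite -/C.
move: (\prod_(i < N) (1 + (_ + _))) => M MC h.
have y01 : 0 <= x ^+ 2 <= 1 by rewrite sqr_ge0 /= exprn_ile1 //; lra.
have prodE e : \prod_(i < N) (1 - x ^+ 2 * node n i ^+ 4 -
    2 * e * (x ^+ 2) ^+ 2 * node n i ^+ 3 - (x ^+ 2) ^+ 3 * node n i ^+ 2) =
    \prod_(i < N) (1 - x ^+ 2 * node n i ^+ 4 -
    2 * e * (x ^+ 2) ^+ 2 * node n i ^+ 3 - x ^+ 6 * node n i ^+ 2) :> R.
  by apply: eq_bigr => i _; congr (_ - _); ring.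
have [r1 [r10 r1M h1]] := h 1 (x ^+ 2) ltac:(by rewrite normr1) y01.
have [r2 [r20 r2M h2]] := h (-1) (x ^+ 2) ltac:(by rewrite normrN normr1) y01.
have e1 : node_prod (x ^+ 3) x n N = \prod_(i < N) (1 - x ^+ 2 * node n i ^+ 4 -
    2 * 1 * (x ^+ 2) ^+ 2 * node n i ^+ 3 - (x ^+ 2) ^+ 3 * node n i ^+ 2).
  by apply: eq_bigr => i _; ring.
have e2 : node_prod (- x ^+ 3) x n N = \prod_(i < N) (1 - x ^+ 2 * node n i ^+ 4 -
    2 * -1 * (x ^+ 2) ^+ 2 * node n i ^+ 3 - (x ^+ 2) ^+ 3 * node n i ^+ 2).
  by apply: eq_bigr => i _; ring.
rewrite -{}e1 in h1; rewrite -{}e2 in h2.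
move: h1 h2 r1M r2M; move: (node_prod (x ^+ 3) x n N) (node_prod (- x ^+ 3) x n N) => P1 P2.
rewrite (_ : 2 * 1 = 2) ?mulr1 // (_ : 2 * -1 * B = - (2 * B)); last by ring.
rewrite (_ : 2 * -1 * (A * B - D) = - (2 * (A * B - D))); last by ring.
set F := A * B - D; move: (x ^+ 2) y01 {h prodE} => y /andP[y0 y1] h1 h2 r1M r2M.
rewrite opprK in h2 r2M.
have nA := normr_ge0 A.
have n1 := normr_ge0 (E2 - 2 * B); have n2 := normr_ge0 (E2 + 2 * B).
have n3 := normr_ge0 (E3 + 2 * F); have n4 := normr_ge0 (E3 - 2 * F).
have ny k z : `|z * y ^+ k| <= `|z|.
  by rewrite normrM normrX (ger0_norm y0) ler_piMr // exprn_ile1.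
have y4 : y ^+ 4 <= 1 by rewrite exprn_ile1.
have y40 : 0 <= y ^+ 4 by rewrite exprn_ge0.
have bnd P r t2 t3 : 0 <= r -> 1 + `|A| + `|t2| + `|t3| + r <= M ->
    `|P - (1 - A * y + t2 * y ^+ 2 + t3 * y ^+ 3)| <= r * y ^+ 4 -> `|P| <= C.
  move=> r0 rM hP; rewrite -[P](subrK (1 - A * y + t2 * y ^+ 2 + t3 * y ^+ 3)).
  have := ler_normD (P - (1 - A * y + t2 * y ^+ 2 + t3 * y ^+ 3))
    (1 - A * y + t2 * y ^+ 2 + t3 * y ^+ 3).
  have := ler_normD (1 - A * y + t2 * y ^+ 2) (t3 * y ^+ 3).
  have := ler_normD (1 - A * y) (t2 * y ^+ 2).
  have := ler_normB 1 (A * y); rewrite normr1.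
  have := ny 1%N A; have := ny 2%N t2; have := ny 3%N t3; rewrite expr1.
  have : r * y ^+ 4 <= r by rewrite ler_piMr.
  lra.
split.
- have : `|4 * B| <= `|E2 + 2 * B| + `|E2 - 2 * B|.
    by apply: le_trans (ler_normB _ _); rewrite le_eqVlt; apply/orP; left; apply/eqP; congr `|_|; ring.
  rewrite normrM (@ger0_norm _ 4) //; lra.
- have : `|4 * F| <= `|E3 + 2 * F| + `|E3 - 2 * F|.
    by apply: le_trans (ler_normB _ _); rewrite le_eqVlt; apply/orP; left; apply/eqP; congr `|_|; ring.
  rewrite normrM (@ger0_norm _ 4) //; lra.
- exact: bnd r10 r1M h1.
- exact: bnd r20 r2M h2.
rewrite (_ : P1 - P2 + _ - _ =
  (P1 - (1 - A * y + (E2 - 2 * B) * y ^+ 2 + (E3 + 2 * F) * y ^+ 3)) -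
  (P2 - (1 - A * y + (E2 + 2 * B) * y ^+ 2 + (E3 - 2 * F) * y ^+ 3))); last by ring.
apply: le_trans (ler_normB _ _) _; apply: le_trans (lerD h1 h2) _.
rewrite -mulrDl ler_wpM2r //; lra.
Qed.

Lemma node_prod_is_cvg (s t : R) n : `|s| * 2 + `|t| * 4 <= 1 ->
  cvgn (node_prod s t n) /\ 0 <= limn (node_prod s t n).
Proof.
move=> st.
have f01 i : 0 <= 1 - (s * node n i + t * node n i ^+ 2) ^+ 2 <= 1.
  rewrite subr_ge0 gerBl sqr_ge0 andbT -[X in X <= _]real_normK ?num_real //.
  have n2 : `|node n i : R| <= 2.
    apply: le_trans (node_le _ _) _; rewrite -[X in _ <= X]mulr1 ler_pM2l //.
    by rewrite invf_le1 ?lerDr // ltr_wpDl.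
  rewrite exprn_ile1 //; apply: le_trans (ler_normD _ _) (le_trans _ st).
  rewrite !normrM; apply: lerD; apply: ler_wpM2l => //.
  by have := normr_ge0 (node n i : R); nra.
have p0 N : 0 <= node_prod s t n N by apply: prodr_ge0 => i _; case/andP: (f01 i).
have cv : cvgn (node_prod s t n).
  apply: nonincreasing_is_cvgn; last by exists 0 => _ [m _ <-].
  apply/nonincreasing_seqP => N; rewrite /node_prod big_ord_recr /= ler_piMr ?p0 //.
  by case/andP: (f01 N).
by split=> //; apply: limr_ge => //; apply: nearW.
Qed.

Let O3 n : R := 8 * harmonic_number R 3 (2 * n) - zeta R 3.
Let O4 n : R := 2 * (8 * harmonic_number R 4 (2 * n) - harmonic_number R 4 n) + zeta R 4.
Let O7 n : R := 128 * harmonic_number R 7 (2 * n) - zeta R 7.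

Lemma node_prod_lim_trunc n x : 0 < x <= 1 / 8 ->
  let q s := limn (node_prod s x n) in
  [/\ `|O3 n| <= expR 72, `|O4 n * O3 n - O7 n| <= expR 72, 0 <= q (x ^+ 3) <= expR 72,
    0 <= q (- x ^+ 3) <= expR 72 &
  `|q (x ^+ 3) - q (- x ^+ 3)
    + 4 * (x ^+ 2) ^+ 2 * O3 n - 4 * (x ^+ 2) ^+ 3 * (O4 n * O3 n - O7 n)|
    <= 2 * expR 72 * (x ^+ 2) ^+ 4].
Proof.
move=> x08 q.
have xs : `|x ^+ 3| * 2 + `|x| * 4 <= 1.
  case/andP: x08 => x0 x8; rewrite normrX (gtr0_norm x0).
  have : x ^+ 2 <= 1 / 8 * x by rewrite expr2 ler_wpM2r // ltW.
  rewrite exprS; nra.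
have [c1 q1] := @node_prod_is_cvg (x ^+ 3) x n xs.
have [c2 q2] := @node_prod_is_cvg (- x ^+ 3) x n ltac:(by rewrite normrN).
have l3 := @node_sum3 R n; have l4 := @node_sum4 R n; have l7 := @node_sum7 R n.
rewrite -/(O3 n) -/(O4 n) -/(O7 n) in l3 l4 l7.
have l43 : ((\sum_(i < N) (node n i : R) ^+ 4) * (\sum_(i < N) (node n i : R) ^+ 3)
  - \sum_(i < N) (node n i : R) ^+ 7) @[N --> \oo] --> (O4 n * O3 n - O7 n : R).
  by apply: cvgB => //; exact: cvgM.
have tr N := @node_prod_trunc n N x x08.
have bound (f : nat -> R) (l M : R) : f @ \oo --> l -> (forall N, `|f N| <= M) -> `|l| <= M.
  move=> fl fM; apply: (ler_cvg_to (cvg_norm fl) (cvg_cst M)).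
  by apply: nearW.
split.
- by apply: bound l3 _ => N; case: (tr N).
- by apply: bound l43 _ => N; case: (tr N).
- by rewrite q1 -[X in X <= _]ger0_norm //; apply: bound c1 _ => N; case: (tr N).
- by rewrite q2 -[X in X <= _]ger0_norm //; apply: bound c2 _ => N; case: (tr N).
apply: (bound (fun N => node_prod (x ^+ 3) x n N - node_prod (- x ^+ 3) x n N
    + 4 * (x ^+ 2) ^+ 2 * \sum_(i < N) (node n i : R) ^+ 3 - 4 * (x ^+ 2) ^+ 3 *
    ((\sum_(i < N) (node n i : R) ^+ 4) * (\sum_(i < N) (node n i : R) ^+ 3)
  - \sum_(i < N) (node n i : R) ^+ 7))); last by move=> N; case: (tr N).
apply: cvgB; last exact: cvgMr.
by apply: cvgD; [exact: cvgB|exact: cvgMr].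
Qed.

Let weighted_cvg (f : nat -> R) M : (forall n, `|f n| <= M) ->
  cvgn (series (fun n => weight n * f n)).
Proof.
move=> fM; apply: normed_cvg.
apply: (@series_le_cvg _ _ (fun n => M * weight n)) => [n|n|n|].
- exact: normr_ge0.
- by rewrite mulr_ge0 ?weight_ge0 // (le_trans _ (fM n)).
- by rewrite /= normrM (ger0_norm (weight_ge0 n)) mulrC ler_wpM2r ?weight_ge0.
- by apply: is_cvg_seriesZ; exact: weight_cvg.
Qed.

(* With [t = x] and [s = +-x ^ 3], the terms of [node_prod_even] expand in powers of [y = x ^ 2];
   the coefficients of [y ^ 2] and [y ^ 3] in the difference of both sides vanish. *)
Lemma weighted_sums :
  limn (series (fun n => weight n * O3 n)) = 0 /\
  limn (series (fun n => weight n * (O4 n * O3 n - O7 n))) = 0.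
Proof.
have x8 : 0 < (1 / 8 : R) <= 1 / 8 by lra.
have b3 n : `|O3 n| <= expR 72 by case: (node_prod_lim_trunc n x8).
have b43 n : `|O4 n * O3 n - O7 n| <= expR 72 by case: (node_prod_lim_trunc n x8).
have c3 := weighted_cvg b3; have c43 := weighted_cvg b43.
(* The constant is what remains of 2 e^72 y^4 times the sum of the weights after division by 4
   y^2. *)
apply: (@quadratic_bound_eq0 _ _ (expR 72 / 2 * limn (series weight)) ((1 / 8) ^+ 2)).
- by rewrite exprn_gt0.
- rewrite mulr_ge0 ?divr_ge0 ?expR_ge0 //; apply: limr_ge; first exact: weight_cvg.
  by apply: nearW => N; apply: sumr_ge0 => i _; exact: weight_ge0.
move=> y /andP[y0 y8].
have [x [x0 x18 xy]] : exists x, [/\ 0 < x, x <= 1 / 8 & x ^+ 2 = y].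
  exists (Num.sqrt y); split; first by rewrite sqrtr_gt0.
    have e : Num.sqrt ((1 / 8 : R) ^+ 2) = 1 / 8 by rewrite sqrtr_sqr ger0_norm.
    by rewrite -e ler_wsqrtr.
  by rewrite sqr_sqrtr // ltW.
have x08 : 0 < x <= 1 / 8 by rewrite x0.
pose q s n := limn (node_prod s x n).
have tr n := node_prod_lim_trunc n x08.
have q1 n : 0 <= q (x ^+ 3) n <= expR 72 by case: (tr n).
have q2 n : 0 <= q (- x ^+ 3) n <= expR 72 by case: (tr n).
have cq1 := @weighted_cvg (q (x ^+ 3)) (expR 72) ltac:(by move=> n; case/andP: (q1 n) => *; rewrite ger0_norm).
have cq2 := @weighted_cvg (q (- x ^+ 3)) (expR 72) ltac:(by move=> n; case/andP: (q2 n) => *; rewrite ger0_norm).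
have x3 : 0 <= x ^+ 3 <= 1 / 512.
  have x0' := ltW x0; rewrite exprn_ge0 //= (_ : 1 / 512 = (1 / 8) ^+ 3); last by field.
  by rewrite lerXn2r ?nnegrE.
(* Evenness in s: in the difference for s = x^3 and s = - x^3 only the expansion terms remain. *)
have eqq : limn (series (fun n => weight n * q (x ^+ 3) n)) =
    limn (series (fun n => weight n * q (- x ^+ 3) n)).
  apply: EFin_inj; rewrite -!nneseries_EFin //; first last.
  - by move=> n; rewrite mulr_ge0 ?weight_ge0 //; case/andP: (q1 n).
  - by move=> n; rewrite mulr_ge0 ?weight_ge0 //; case/andP: (q2 n).
  have adm s t : `|s| <= 1 / 512 -> `|t| <= 1 / 8 -> admissible s t.
    move=> /ler_normlP[s1 s2] /ler_normlP[t1 t2]; apply/and3P; split; lra.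
  have nx3 : `|x ^+ 3| <= 1 / 512 by rewrite ger0_norm; case/andP: x3.
  have nx : `|x| <= 1 / 8 by rewrite ger0_norm // ltW.
  have := @node_prod_even R (x ^+ 3) x.
  rewrite !adm ?normrN // => /(_ _ _ isT isT isT isT) e.
  under eq_eseriesr do rewrite /weight -mulrA.
  under [RHS]eq_eseriesr do rewrite /weight -mulrA.
  apply: e; last by lra.
  by case/andP: x3 => *; nra.
have lim1 : (series (fun n => weight n * q (x ^+ 3) n) N - series (fun n => weight n * q (- x ^+ 3) n) N
  + 4 * y ^+ 2 * series (fun n => weight n * O3 n) N
  - 4 * y ^+ 3 * series (fun n => weight n * (O4 n * O3 n - O7 n)) N) @[N --> \oo] -->
  (4 * y ^+ 2 * limn (series (fun n => weight n * O3 n))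
   - 4 * y ^+ 3 * limn (series (fun n => weight n * (O4 n * O3 n - O7 n))) : R).
  rewrite -[X in _ --> X - _]add0r -[X in _ --> X + _ - _](subrr (limn (series (fun n => weight n * q (x ^+ 3) n)))).
  rewrite {2}eqq; apply: cvgB; last exact: cvgMr.
  by apply: cvgD; [exact: cvgB|exact: cvgMr].
have lim2 : (2 * expR 72 * y ^+ 4 * series weight N) @[N --> \oo] -->
    (2 * expR 72 * y ^+ 4 * limn (series weight) : R).
  by apply: cvgMr; exact: weight_cvg.
have y0' := ltW y0; have := ler_cvg_to (cvg_norm lim1) lim2.
set S3 := limn (series (fun n => weight n * O3 n)).
set S43 := limn (series (fun n => weight n * (O4 n * O3 n - O7 n))).
rewrite (_ : 4 * y ^+ 2 * S3 - 4 * y ^+ 3 * S43 = 4 * y ^+ 2 * (S3 - S43 * y)); last by ring.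
rewrite normrM (@ger0_norm _ (4 * y ^+ 2)) ?mulr_ge0 ?sqr_ge0 //.
rewrite (_ : 2 * expR 72 * y ^+ 4 * _ =
   4 * y ^+ 2 * (expR 72 / 2 * limn (series weight) * y ^+ 2)); last by field.
rewrite ler_pM2l ?mulr_gt0 ?exprn_gt0 //; apply; apply: nearW => N.
rewrite /series /= !mulr_sumr -sumrB -big_split -sumrB.
apply: le_trans (ler_norm_sum _ _ _) _; apply: ler_sum => n _ /=.
have [_ _ _ _] := tr n; rewrite xy -!/(q _ n) => h.
rewrite (_ : _ - _ = weight n * (q (x ^+ 3) n - q (- x ^+ 3) n
    + 4 * y ^+ 2 * O3 n - 4 * y ^+ 3 * (O4 n * O3 n - O7 n))); last by ring.
by rewrite normrM (ger0_norm (weight_ge0 n)) mulrC ler_wpM2r ?weight_ge0.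
Qed.

(** The bracket equals (zeta(7) - (O4 O3 - O7) + zeta(4) O3) / 2, and only its constant survives
    [weighted_sums]. *)
Lemma weighted_harmonic_sum :
  series (fun n : nat =>
    weight n * (64 * harmonic_number R 7 (2 * n)
     - (8 * harmonic_number R 3 (2 * n) - zeta R 3)
       * (8 * harmonic_number R 4 (2 * n) - harmonic_number R 4 n))) @ \oo -->
  zeta R 7 / 2 * limn (series weight).
Proof.
have x8 : 0 < (1 / 8 : R) <= 1 / 8 by lra.
have b3 n : `|O3 n| <= expR 72 by case: (node_prod_lim_trunc n x8).
have b43 n : `|O4 n * O3 n - O7 n| <= expR 72 by case: (node_prod_lim_trunc n x8).
have c3 := weighted_cvg b3; have c43 := weighted_cvg b43.
have [s3 s43] := weighted_sums.
have : (zeta R 7 / 2 * series weight N - 1 / 2 * series (fun n => weight n * (O4 n * O3 n - O7 n)) N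
  + zeta R 4 / 2 * series (fun n => weight n * O3 n) N) @[N --> \oo] -->
  (zeta R 7 / 2 * limn (series weight)
   - 1 / 2 * limn (series (fun n => weight n * (O4 n * O3 n - O7 n)))
   + zeta R 4 / 2 * limn (series (fun n => weight n * O3 n)) : R).
  by apply: cvgD; [apply: cvgB|]; apply: cvgMr => //; exact: weight_cvg.
rewrite s3 s43 !mulr0 subr0 addr0; apply: cvg_trans; apply: near_eq_cvg; apply: nearW => N.
rewrite /series /= !mulr_sumr -sumrB -big_split; apply: eq_bigr => n _ /=.
by rewrite /O7 /O4 /O3; field.
Qed.

End WeightedHarmonicSum.

(** * Integrals over the real line *)

Section RealLineIntegrals.
Context {R : realType}.
Local Notation mu := (@lebesgue_measure R).
Implicit Types (f g F G : R -> R) (a b l : R) (n : nat).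

Let sym n : set R := [set` `[- n.+1%:R, n.+1%:R]].

Let symE n x : sym n x <-> - n.+1%:R <= x <= n.+1%:R.
Proof. by rewrite /sym /= in_itv. Qed.

Let sym_nd : {homo sym : n m / (n <= m)%N >-> (n <= m)%O}.
Proof.
move=> n m nm; apply/subsetPset => x /symE /andP[h1 h2]; apply/symE.
have : (n.+1%:R : R) <= m.+1%:R by rewrite ler_nat.
by move=> ?; apply/andP; split; lra.
Qed.

Let sym_cup : \bigcup_n sym n = setT.
Proof.
rewrite -subTset => x _; exists (Num.truncn `|x|) => //; apply/symE.
have := truncnS_gt `|x|; rewrite ltr_norml => /andP[h1 h2].
by apply/andP; split; apply: ltW.
Qed.

Let cvg_integral_line f : (forall x, 0 <= f x) -> continuous f ->
  (\int[mu]_(x in sym n) (f x)%:E)%E @[n --> \oo] --> (\int[mu]_x (f x)%:E)%E.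
Proof.
move=> f0 cf; rewrite -sym_cup.
apply: ge0_nondecreasing_set_cvg_integral => //.
- by move=> n; exact: measurable_itv.
- move=> n; apply/measurable_EFinP; apply: measurable_funTS.
  exact: continuous_measurable_fun.
- by move=> n x _; rewrite lee_fin.
Qed.

Lemma is_derive_continuous F f : (forall x : R, is_derive x 1 F (f x)) -> continuous F.
Proof.
by move=> dF x; apply: differentiable_continuous; apply/derivable1_diffP; case: (dF x).
Qed.

Let derive_eq F f : (forall x : R, is_derive x 1 F (f x)) -> F^`()%classic = f.
Proof. by move=> dF; apply/funext => x; rewrite derive1E; apply: derive_val. Qed.

Let integral_sym_derive F f n : (forall x : R, is_derive x 1 F (f x)) -> continuous f ->
  (\int[mu]_(x in sym n) (f x)%:E = (F n.+1%:R - F (- n.+1%:R))%:E)%E.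
Proof.
move=> dF cf; rewrite (@continuous_FTC2 _ f F) //.
- by have : 0 < n.+1%:R :> R by []; lra.
- exact: continuous_subspaceT.
- have cF := is_derive_continuous dF; split; first by move=> x _; case: (dF x).
  - exact: cvg_at_right_filter (cF _).
  - exact: cvg_at_left_filter (cF _).
- by move=> x _; rewrite (derive_eq dF).
Qed.

Lemma integral_line_derive F f l l' : (forall x, 0 <= f x) -> continuous f ->
  (forall x : R, is_derive x 1 F (f x)) ->
  F n.+1%:R @[n --> \oo] --> l -> F (- n.+1%:R) @[n --> \oo] --> l' ->
  (\int[mu]_x (f x)%:E = (l - l')%:E)%E.
Proof.
move=> f0 cf dF Fl Fl'.
have h := cvg_integral_line f0 cf.
have h' : (\int[mu]_(x in sym n) (f x)%:E)%E @[n --> \oo] --> (l - l')%:E.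
  have -> : (fun n => \int[mu]_(x in sym n) (f x)%:E)%E =
     (fun n => (F n.+1%:R - F (- n.+1%:R))%:E).
    by apply/funext => n; rewrite (integral_sym_derive n dF).
  by apply: cvg_EFin; [exact: nearW|exact: cvgB].
exact: (cvg_unique _ h h').
Qed.

(** On symmetric intervals the two integrals differ by an increment of G, which tends to 0.
    Finiteness of the first one permits the subtraction in the extended reals. *)
Lemma eq_integral_line_derive G f g l : (forall x, 0 <= f x) -> (forall x, 0 <= g x) ->
  continuous f -> continuous g -> (forall x : R, is_derive x 1 G (f x - g x)) ->
  G n.+1%:R @[n --> \oo] --> l -> G (- n.+1%:R) @[n --> \oo] --> l ->
  (\int[mu]_x (f x)%:E)%E \is a fin_num ->
  (\int[mu]_x (f x)%:E = \int[mu]_x (g x)%:E)%E.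
Proof.
move=> f0 g0 cf cg dG Gl Gl' ffin.
have hf := cvg_integral_line f0 cf; have hg := cvg_integral_line g0 cg.
have h : (\int[mu]_(x in sym n) (f x)%:E -
    (G n.+1%:R - G (- n.+1%:R))%:E)%E @[n --> \oo] --> (\int[mu]_x (f x)%:E - 0%:E)%E.
  apply: cvgeB => //; first exact: fin_num_adde_defl.
  rewrite -[X in X%:E](subrr l).
  by apply: cvg_EFin; [exact: nearW|exact: cvgB].
rewrite sube0 in h.
have e n : (\int[mu]_(x in sym n) (g x)%:E = \int[mu]_(x in sym n) (f x)%:E -
    (G n.+1%:R - G (- n.+1%:R))%:E)%E.
  rewrite -(@integral_sym_derive G (f \- g)) //; last first.
    by move=> x; apply: cvgB; [exact: cf|exact: cg].
  have int (k : R -> R) : continuous k -> mu.-integrable (sym n) (EFin \o k).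
    move=> ck; apply: continuous_compact_integrable; first exact: segment_compact.
    exact: continuous_subspaceT.
  have msym : measurable (sym n) := measurable_itv _.
  have fing : (\int[mu]_(x in sym n) (g x)%:E)%E \is a fin_num.
    by apply: (@integrable_fin_num _ _ _ mu _ msym (EFin \o g)); exact: int.
  have finf : (\int[mu]_(x in sym n) (f x)%:E)%E \is a fin_num.
    by apply: (@integrable_fin_num _ _ _ mu _ msym (EFin \o f)); exact: int.
  rewrite integralB_EFin //; [|exact: int|exact: int].
  by rewrite -(fineK fing) -(fineK finf) -!EFinB; congr EFin; ring.
by move: hg; under eq_fun do rewrite e; move=> /(cvg_unique _ h) <-.
Qed.

(** Substitution on symmetric intervals; the last two hypotheses make their images under F exhaust
    the line. *)
Lemma integral_line_subst F f G : (forall x : R, is_derive x 1 F (f x)) ->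
  (forall x, 0 < f x) -> continuous f -> continuous G -> (forall x, 0 <= G x) ->
  (forall y, exists n, y <= F n%:R) -> (forall y, exists n, F (- n%:R) <= y) ->
  (\int[mu]_x (G x)%:E = \int[mu]_x (G (F x) * f x)%:E)%E.
Proof.
move=> dF f0 cf cG G0 Fy FNy.
have cF := is_derive_continuous dF; have DF := derive_eq dF.
have incrF : {homo F : x y / x < y}.
  move=> x y xy.
  have cW : {within `[x, y], continuous F} by exact: continuous_subspaceT.
  have [c _ e] := MVT xy (fun z _ => dF z) cW.
  by rewrite -subr_gt0 e mulr_gt0 // subr_gt0.
have leF : {mono F : x y / x <= y} := le_mono incrF.
have h : (\int[mu]_(x in sym n) (G (F x) * f x)%:E)%E @[n --> \oo] -->
  (\int[mu]_x (G (F x) * f x)%:E)%E.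
  apply: cvg_integral_line => x; first by rewrite mulr_ge0 // ltW.
  by apply: cvgM; [exact: (continuous_comp (cF x) (cG (F x)))|exact: cf].
pose D n : set R := [set` `[F (- n.+1%:R), F n.+1%:R]].
have DE n x : D n x <-> F (- n.+1%:R) <= x <= F n.+1%:R by rewrite /D /= in_itv.
have h' : (\int[mu]_(x in D n) (G x)%:E)%E @[n --> \oo] --> (\int[mu]_x (G x)%:E)%E.
  have <- : \bigcup_n D n = setT.
    rewrite -subTset => x _; have [n nx] := Fy x; have [m mx] := FNy x.
    exists (maxn n m) => //; apply/DE; apply/andP; split.
      apply: le_trans mx; rewrite leF lerN2 ler_nat; lia.
    by apply: (le_trans nx); rewrite leF ler_nat; lia.
  apply: ge0_nondecreasing_set_cvg_integral => //.
  - move=> n m nm; apply/subsetPset => x /DE /andP[h1 h2]; apply/DE; apply/andP; split.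
      by apply: le_trans h1; rewrite leF lerN2 ler_nat.
    by apply: le_trans h2 _; rewrite leF ler_nat.
  - by move=> n; exact: measurable_itv.
  - move=> n; apply/measurable_EFinP; apply: measurable_funTS.
    exact: continuous_measurable_fun.
  - by move=> n x _; rewrite lee_fin.
have e n : (\int[mu]_(x in D n) (G x)%:E = \int[mu]_(x in sym n) (G (F x) * f x)%:E)%E.
  rewrite (@integration_by_substitution_increasing _ F G).
  - by apply: eq_integral => x _; rewrite DF.
  - by have : 0 < n.+1%:R :> R by []; lra.
  - by move=> x y _ _; exact: incrF.
  - by rewrite DF => x _; exact: cf.
  - by rewrite DF; apply/cvg_ex; exists (f (- n.+1%:R)); exact: cvg_at_right_filter (cf _).
  - by rewrite DF; apply/cvg_ex; exists (f n.+1%:R); exact: cvg_at_left_filter (cf _).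
  - split; first by move=> x _; case: (dF x).
    + exact: cvg_at_right_filter (cF _).
    + exact: cvg_at_left_filter (cF _).
  - exact: continuous_subspaceT.
by move: h'; under eq_fun do rewrite e; move=> /(cvg_unique _ h) <-.
Qed.

End RealLineIntegrals.

(** * Rules of differentiation *)

Section DerivativeRules.
Context {R : realType}.
Implicit Types (f g : R -> R) (x a b : R).

Lemma is_derive1D f g x a b : is_derive x 1 f a -> is_derive x 1 g b ->
  is_derive x 1 (fun y => f y + g y) (a + b).
Proof. by move=> df dg; exact: is_deriveD. Qed.

Lemma is_derive1B f g x a b : is_derive x 1 f a -> is_derive x 1 g b ->
  is_derive x 1 (fun y => f y - g y) (a - b).
Proof. by move=> df dg; exact: is_deriveB. Qed.

Lemma is_derive1M f g x a b : is_derive x 1 f a -> is_derive x 1 g b ->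
  is_derive x 1 (fun y => f y * g y) (f x * b + g x * a).
Proof. by move=> df dg; exact: is_deriveM. Qed.

Lemma is_derive1V f x a : f x != 0 -> is_derive x 1 f a ->
  is_derive x 1 (fun y => (f y)^-1) (- a / f x ^+ 2).
Proof.
move=> fx df; apply: (is_derive_eq (is_deriveV fx df)).
by rewrite /GRing.scale /= !mulNr mulrC.
Qed.

Lemma is_derive1X f x a n : is_derive x 1 f a ->
  is_derive x 1 (fun y => f y ^+ n) (n%:R * f x ^+ n.-1 * a).
Proof.
move=> df; elim: n => [|n IH].
  by rewrite mul0r mul0r; exact: is_derive_cst.
have := is_derive1M df IH; under [X in is_derive _ _ X]eq_fun do rewrite -exprS.
move=> h; apply: (is_derive_eq h); case: n {IH h} => [|n] /=.
  by rewrite expr0; ring.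
by rewrite -natr1 exprS; ring.
Qed.

End DerivativeRules.

(** * Integrals of hyperbolic functions *)

Section Hyperbolic.
Context {R : realType}.
Local Notation mu := (@lebesgue_measure R).
Implicit Types (x : R) (i j k n : nat).

Definition sinh x : R := (expR x - expR (- x)) / 2.
Definition sech x : R := (cosh x)^-1.
Definition tanh x : R := sinh x / cosh x.

Lemma cosh_ge1 x : 1 <= cosh x.
Proof.
have e : expR x * expR (- x) = 1 by rewrite -expRD subrr expR0.
have := expR_gt0 x; have := expR_gt0 (- x); rewrite /cosh.
have := sqr_ge0 (expR x - expR (- x)); nra.
Qed.

Lemma cosh_gt0 x : 0 < cosh x. Proof. exact: lt_le_trans (cosh_ge1 x). Qed.

Lemma cosh2_sinh2 x : cosh x ^+ 2 = 1 + sinh x ^+ 2.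
Proof.
have e : expR x * expR (- x) = 1 by rewrite -expRD subrr expR0.
rewrite /cosh /sinh; move: e; move: (expR x) (expR (- x)) => p q e.
have -> : ((p + q) / 2) ^+ 2 = p * q + ((p - q) / 2) ^+ 2 by field.
by rewrite e.
Qed.

Let is_derive_expRN x : is_derive x 1 (fun y : R => expR (- y)) (- expR (- x)).
Proof.
have h := @is_derive1_comp R expR -%R x _ _ (is_derive_expR (- x)) (is_deriveNid x 1).
by apply: (is_derive_eq h); rewrite mulrN1.
Qed.

Lemma is_derive_cosh x : is_derive x 1 (@cosh R) (sinh x).
Proof.
have h := is_derive1M (is_derive1D (is_derive_expR x) (is_derive_expRN x)) (is_derive_cst (2^-1 : R) x 1).
by apply: (is_derive_eq h); rewrite /sinh /cst /=; field.
Qed.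

Lemma is_derive_sinh x : is_derive x 1 sinh (cosh x).
Proof.
have h := is_derive1M (is_derive1B (is_derive_expR x) (is_derive_expRN x)) (is_derive_cst (2^-1 : R) x 1).
by apply: (is_derive_eq h); rewrite /cosh /cst /=; field.
Qed.

Lemma is_derive_sech x : is_derive x 1 sech (- tanh x * sech x).
Proof.
have h := is_derive1V (lt0r_neq0 (cosh_gt0 x)) (is_derive_cosh x).
by apply: (is_derive_eq h); rewrite /sech /tanh; field; rewrite gt_eqF // cosh_gt0.
Qed.

Lemma is_derive_tanh x : is_derive x 1 tanh (sech x ^+ 2).
Proof.
have h := is_derive1M (is_derive_sinh x) (is_derive_sech x).
apply: (is_derive_eq h); have c0 := lt0r_neq0 (cosh_gt0 x).
transitivity ((cosh x ^+ 2 - sinh x ^+ 2) / cosh x ^+ 2).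
  by rewrite /sech /tanh; field.
by rewrite [X in (X - _) / _]cosh2_sinh2 addrK /sech exprVn mul1r.
Qed.

Lemma tanh2_sech2 x : tanh x ^+ 2 + sech x ^+ 2 = 1.
Proof.
have c0 := lt0r_neq0 (cosh_gt0 x).
transitivity ((1 + sinh x ^+ 2) / cosh x ^+ 2); first by rewrite /tanh /sech; field.
by rewrite -cosh2_sinh2 mulfV // expf_neq0.
Qed.

Lemma sech_gt0 x : 0 < sech x. Proof. by rewrite invr_gt0 cosh_gt0. Qed.

Lemma sech_le1 x : sech x <= 1.
Proof. by rewrite invf_le1 ?cosh_gt0 // cosh_ge1. Qed.

Lemma tanh_le1 x : `|tanh x| <= 1.
Proof.
rewrite -(@expr_le1 _ 2) // real_normK ?num_real //.
by have := tanh2_sech2 x; have := sqr_ge0 (sech x); lra.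
Qed.

Lemma continuousX (f : R -> R) m : continuous f -> continuous (fun x => f x ^+ m).
Proof. by move=> cf x; exact: (continuous_comp (cf x) (@exprn_continuous R m (f x))). Qed.

Lemma continuous_cosh : continuous (@cosh R).
Proof. exact: is_derive_continuous is_derive_cosh. Qed.

Lemma continuous_sech : continuous sech.
Proof. exact: is_derive_continuous is_derive_sech. Qed.

Lemma continuous_tanh : continuous tanh.
Proof. exact: is_derive_continuous is_derive_tanh. Qed.

Lemma sech_le x : sech x <= 2 / (1 + `|x|).
Proof.
have d : 0 < 1 + `|x| by rewrite ltr_wpDr.
rewrite /sech -[2]invrK -invfM lef_pV2 ?posrE ?cosh_gt0 ?mulr_gt0 ?invr_gt0 //.
rewrite /cosh mulrC ler_pM2r ?invr_gt0 //.
have := expR_ge1Dx x; have := expR_ge1Dx (- x); have := expR_gt0 x; have := expR_gt0 (- x).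
by case: (ger0P x) => *; lra.
Qed.

Let inv_cvg0 C : (C / (1 + n.+1%:R)) @[n --> \oo] --> (0 : R).
Proof.
rewrite -[X in _ --> X](mulr0 C); apply: cvgMr.
apply: (@squeeze_cvgr _ _ _ _ (fun=> 0) (@harmonic R)).
- apply: nearW => n; have n0 : 0 < n.+1%:R :> R by [].
  rewrite invr_ge0 addr_ge0 //= /harmonic /= lef_pV2 ?posrE ?addr_gt0 //; lra.
- exact: cvg_cst.
- exact: cvg_harmonic.
Qed.

Let cvg_sech_bound (f : R -> R) : (forall x, `|f x| <= sech x) ->
  f n.+1%:R @[n --> \oo] --> 0 /\ f (- n.+1%:R) @[n --> \oo] --> 0.
Proof.
move=> fs.
have h (u : nat -> R) : (forall n, `|u n| = n.+1%:R) -> f (u n) @[n --> \oo] --> 0.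
  move=> un; apply/norm_cvg0P.
  apply: (@squeeze_cvgr _ _ _ _ (fun=> 0) (fun n => 2 / (1 + n.+1%:R))) => //.
    apply: nearW => n; rewrite normr_ge0 /=; apply: le_trans (fs _) _.
    by rewrite -(un n) sech_le.
  exact: cvg_cst.
by split; apply: h => n; rewrite ?normrN ger0_norm.
Qed.

Lemma integral_sech : (\int[mu]_x (sech x)%:E = pi%:E)%E.
Proof.
rewrite -[pi]subr0; apply: (@integral_line_derive R (fun x => 2 * atan (expR x))).
- by move=> x; rewrite ltW // sech_gt0.
- exact: continuous_sech.
- move=> x; have h := is_derive1M (is_derive_cst (2 : R) x 1)
    (is_derive1_comp (is_derive1_atan (expR x)) (is_derive_expR x)).
  apply: (is_derive_eq h); rewrite /sech /cosh expRN /cst /=.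
  have := expR_gt0 x; move: (expR x) => p p0; field.
  by rewrite !gt_eqF ?addr_gt0 ?mulr_gt0 ?exprn_gt0.
- rewrite (_ : pi = 2 * (pi / 2)); last by field.
  apply: cvgMr; have /cvg_pinftyP := @cvgy_atan R; apply.
  apply/cvgryPge => A; near=> n; have n0 := expR_ge1Dx (n.+1%:R : R).
  have : A <= n%:R by near: n; exact: nbhs_infty_ger.
  by move=> ?; rewrite -natr1 in n0 *; lra.
- have : (2 * atan (expR (- n.+1%:R))) @[n --> \oo] --> (2 * atan 0 : R).
    apply: cvgMr; apply: (@cvg_comp _ _ _ _ (@atan R) _ (nbhs (0 : R))); last exact: continuous_atan.
    by rewrite (cvg_shiftS (fun n => expR (- n%:R) : R)); exact: cvgn_expR.
  by rewrite atan0 mulr0.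
Unshelve. all: by end_near. Qed.

Lemma integral_sech2 : (\int[mu]_x (sech x ^+ 2)%:E = 2%:E)%E.
Proof.
rewrite (_ : 2 = 1 - -1 :> R); last by ring.
have c1 : tanh n.+1%:R @[n --> \oo] --> (1 : R).
  have hb x : `|expR (- `|x|) * sech x| <= sech x.
    rewrite normrM (gtr0_norm (sech_gt0 x)) ger0_norm ?expR_ge0 //.
    by rewrite ler_piMl ?(ltW (sech_gt0 x)) // expR_le1 oppr_le0.
  have [h _] := cvg_sech_bound hb.
  suff: (1 - expR (- `|n.+1%:R|) * sech n.+1%:R) @[n --> \oo] --> (1 - 0 : R).
    rewrite subr0; under eq_fun => n.
      rewrite (_ : 1 - _ = tanh n.+1%:R); first over.
      rewrite ger0_norm // /tanh /sech /sinh /cosh expRN.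
      have := expR_gt0 (n.+1%:R : R); move: (expR _) => p p0; field.
      by rewrite !gt_eqF ?addr_gt0 ?mulr_gt0 ?exprn_gt0.
    by [].
  by apply: cvgB => //; exact: cvg_cst.
apply: (@integral_line_derive R tanh) => //.
- by move=> x; rewrite sqr_ge0.
- by move=> x; apply: cvgM; exact: continuous_sech.
- exact: is_derive_tanh.
- have -> : (fun n : nat => tanh (- n.+1%:R)) = (fun n : nat => - tanh n.+1%:R).
    apply/funext => n; rewrite /tanh /sinh /cosh opprK [expR (- _) + _]addrC -mulNr.
    by congr (_ / _); field.
  exact: cvgN.
Qed.

(* The integral of the derivative of [G] vanishes, so [a * g] and [b * f] have the same integral. *)
Lemma split_integral (G f g : R -> R) (a b v : R) : 0 < a -> 0 < b ->
    (forall x, 0 <= f x) -> (forall x, 0 <= g x) -> continuous f -> continuous g ->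
    (forall x : R, is_derive x 1 G (a * g x - b * f x)) -> (forall x, `|G x| <= sech x) ->
    (\int[mu]_x (f x + g x)%:E = v%:E)%E ->
  (\int[mu]_x (f x)%:E = (v * (a / (a + b)))%:E)%E /\
  (\int[mu]_x (g x)%:E = (v * (b / (a + b)))%:E)%E.
Proof.
move=> a0 b0 f0 g0 cf cg dG Gs fg.
have mf : measurable_fun setT (EFin \o f).
  by apply/measurable_EFinP; exact: continuous_measurable_fun.
have mg : measurable_fun setT (EFin \o g).
  by apply/measurable_EFinP; exact: continuous_measurable_fun.
have sum : (\int[mu]_x (f x)%:E + \int[mu]_x (g x)%:E = v%:E)%E.
  rewrite -fg; under [RHS]eq_integral do rewrite EFinD.
  by rewrite ge0_integralD // => x _; rewrite lee_fin.
have fin0 : (0 <= \int[mu]_x (f x)%:E)%E by apply: integral_ge0 => x _; rewrite lee_fin.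
have gin0 : (0 <= \int[mu]_x (g x)%:E)%E by apply: integral_ge0 => x _; rewrite lee_fin.
have [f_fin g_fin] : (\int[mu]_x (f x)%:E)%E \is a fin_num /\
    (\int[mu]_x (g x)%:E)%E \is a fin_num.
  by apply/andP; rewrite -fin_numD sum.
have [Gl Gl'] := cvg_sech_bound Gs.
have := @eq_integral_line_derive R G (fun x => a * g x) (fun x => b * f x) 0 _ _ _ _ dG Gl Gl'.
have Zl (k : R) (h : R -> R) : 0 < k -> (forall x, 0 <= h x) -> measurable_fun setT (EFin \o h) ->
    (\int[mu]_x (k * h x)%:E = k%:E * \int[mu]_x (h x)%:E)%E.
  move=> k0 h0 mh; have k0' := ltW k0; rewrite -ge0_integralZl_EFin //.
  by move=> x _; rewrite lee_fin.
rewrite (Zl a g) // (Zl b f) //.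
move: sum; rewrite -(fineK f_fin) -(fineK g_fin).
move: (fine _) (fine _) => Y X; rewrite -!EFinD -!EFinM => -[] XY h.
have [e] : (a * Y)%:E = (b * X)%:E.
  apply: h => // x; rewrite ?mulr_ge0 ?f0 ?g0 ?ltW //.
    by apply: cvgM; [exact: cvg_cst|exact: cg].
  by apply: cvgM; [exact: cvg_cst|exact: cf].
have ab : a + b != 0 by lra.
split; congr EFin; apply: (mulIf ab); rewrite -XY.
  by transitivity (a * X + b * X); [ring|rewrite -e; field].
by transitivity (a * Y + b * Y); [ring|rewrite e; field].
Qed.

(** With p = (1 + tanh x) / 2 this is the Beta integral B(k + 1/2, 1/2). Its recurrence comes from
    the derivative of p^k sech x and the splitting 1 = p + (1 - p). *)
Lemma integral_logistic k :
  (\int[mu]_x (((1 + tanh x) / 2) ^+ k * sech x)%:E = (pi * cbin k)%:E)%E.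
Proof.
have s0 x : 0 <= (1 + tanh x) / 2.
  by have := tanh_le1 x; rewrite ler_norml => /andP[? ?]; rewrite divr_ge0 //; lra.
have s1 x : (1 + tanh x) / 2 <= 1.
  by have := tanh_le1 x; rewrite ler_norml => /andP[? ?]; lra.
have cs : continuous (fun x => (1 + tanh x) / 2).
  move=> x; apply: cvgM; last exact: cvg_cst.
  by apply: cvgD; [exact: cvg_cst|exact: continuous_tanh].
have csk m : continuous (fun x => ((1 + tanh x) / 2) ^+ m).
  exact: continuousX cs.
elim: k => [|k IH].
  by rewrite cbin0 mulr1 -integral_sech; apply: eq_integral => x _; rewrite expr0 mul1r.
have [|||||||||+ _] := @split_integral (fun x => ((1 + tanh x) / 2) ^+ k * sech x)
  (fun x => ((1 + tanh x) / 2) ^+ k.+1 * sech x)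
  (fun x => ((1 + tanh x) / 2) ^+ k * (1 - (1 + tanh x) / 2) * sech x)
  (2 * k%:R + 1) 1 (pi * cbin k).
- by have : 0 <= k%:R :> R by []; lra.
- by [].
- by move=> x; rewrite mulr_ge0 ?exprn_ge0 // ltW // sech_gt0.
- by move=> x; rewrite !mulr_ge0 ?exprn_ge0 ?subr_ge0 // ltW // sech_gt0.
- by move=> x; apply: cvgM; [exact: csk|exact: continuous_sech].
- move=> x; apply: cvgM; last exact: continuous_sech.
  by apply: cvgM; [exact: csk|apply: cvgB; [exact: cvg_cst|exact: cs]].
- move=> x.
  have h := is_derive1M (is_derive1X k (is_derive1M (is_derive1D (is_derive_cst (1 : R) x 1)
     (is_derive_tanh x)) (is_derive_cst (2^-1 : R) x 1))) (is_derive_sech x).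
  apply: (is_derive_eq h); rewrite /cst /=.
  have e : sech x ^+ 2 = 1 - tanh x ^+ 2 by rewrite -(tanh2_sech2 x) addrC addKr.
  rewrite e; move: (tanh x) (sech x) => T S.
  case: k {IH h} => [|k]; first by rewrite expr0; field.
  by rewrite /= !exprS -natr1; field.
- move=> x; rewrite normrM (gtr0_norm (sech_gt0 x)) ler_piMl ?(ltW (sech_gt0 x)) //.
  by rewrite normrX ger0_norm // exprn_ile1.
- rewrite -IH; apply: eq_integral => x _; congr EFin; rewrite exprS; ring.
move=> ->; congr EFin; rewrite cbinS -mulrA; congr (_ * _); congr (_ * _).
by congr (_ / _); ring.
Qed.

(** The Wallis integrals, shifted by one: [walseq n] is the value for sech^(n + 1), since sech^0 is
    not integrable. *)
Fixpoint walseq n : R := if n is m.+1 then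
  (if m is p.+1 then walseq p * ((p%:R + 1) / (p%:R + 2)) else 2) else pi.

Lemma integral_sechX n : (\int[mu]_x (sech x ^+ n.+1)%:E = (walseq n)%:E)%E.
Proof.
suff : (\int[mu]_x (sech x ^+ n.+1)%:E = (walseq n)%:E)%E /\
       (\int[mu]_x (sech x ^+ n.+2)%:E = (walseq n.+1)%:E)%E by case.
have cs m : continuous (fun x => sech x ^+ m).
  exact: continuousX continuous_sech.
have ct m : continuous (fun x => tanh x ^+ m).
  exact: continuousX continuous_tanh.
elim: n => [|n [IH1 IH2]]; first by split; [exact: integral_sech|exact: integral_sech2].
split=> //.
have [|||||||||_ +] := @split_integral (fun x => tanh x * sech x ^+ n.+1)
  (fun x => tanh x ^+ 2 * sech x ^+ n.+1) (fun x => sech x ^+ n.+3) 1 (n%:R + 1) (walseq n).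
- by [].
- by rewrite ltr_wpDl.
- by move=> x; rewrite mulr_ge0 ?sqr_ge0 // exprn_ge0 // ltW // sech_gt0.
- by move=> x; rewrite exprn_ge0 // ltW // sech_gt0.
- by move=> x; apply: cvgM; [exact: ct|exact: cs].
- exact: cs.
- move=> x; have h := is_derive1M (is_derive_tanh x) (is_derive1X n.+1 (is_derive_sech x)).
  apply: (is_derive_eq h); rewrite /= -natr1 !exprS; ring.
- move=> x; rewrite normrM normrX (gtr0_norm (sech_gt0 x)).
  apply: le_trans (_ : 1 * sech x <= _); last by rewrite mul1r.
  apply: ler_pM; rewrite ?exprn_ge0 ?tanh_le1 // ?(ltW (sech_gt0 x)) //.
  by rewrite exprS ler_piMr ?(ltW (sech_gt0 x)) // exprn_ile1 ?sech_le1 // ltW // sech_gt0.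
- rewrite -IH1; apply: eq_integral => x _; congr EFin.
  by rewrite -[n.+3]/(2 + n.+1)%N exprD -mulrDl tanh2_sech2 mul1r.
move=> ->; congr EFin; rewrite /=; congr (_ * (_ / _)); ring.
Qed.

(** With p = tanh^2 x this is the Beta integral B(i + 1/2, j + 1/2). The induction on i + j splits
    by tanh^2 + sech^2 = 1 and uses the derivative of tanh^(2i + 1) sech^(2j + 1). *)
Lemma integral_tanh_sech i j :
  (\int[mu]_x (tanh x ^+ (2 * i) * sech x ^+ (2 * j).+1)%:E =
   (pi * (cbin i * cbin j / 'C(i + j, i)%:R))%:E)%E.
Proof.
have cs m : continuous (fun x => sech x ^+ m).
  exact: continuousX continuous_sech.
have ct m : continuous (fun x => tanh x ^+ m).
  exact: continuousX continuous_tanh.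
pose f i' j' x := tanh x ^+ (2 * i') * sech x ^+ (2 * j').+1.
have f0 i' j' x : 0 <= f i' j' x.
  apply: mulr_ge0; first by rewrite exprn_even_ge0 ?oddM.
  by apply: exprn_ge0; rewrite ltW ?sech_gt0.
have cf i' j' : continuous (f i' j').
  by move=> x; apply: cvgM; [exact: ct|exact: cs].
suff H m : forall i' j', (i' + j' = m)%N -> (\int[mu]_x (f i' j' x)%:E =
   (pi * (cbin i' * cbin j' / 'C(i' + j', i')%:R))%:E)%E by exact: H.
have step i' j' v : (\int[mu]_x (f i' j' x)%:E = v%:E)%E ->
   (\int[mu]_x (f i'.+1 j' x)%:E = (v * ((2 * i'%:R + 1) / (2 * i'%:R + 1 + (2 * j'%:R + 1))))%:E)%E /\
   (\int[mu]_x (f i' j'.+1 x)%:E = (v * ((2 * j'%:R + 1) / (2 * i'%:R + 1 + (2 * j'%:R + 1))))%:E)%E.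
  move=> IH; apply: (@split_integral (fun x => tanh x ^+ (2 * i').+1 * sech x ^+ (2 * j').+1)) => //.
  - move=> x; have h := is_derive1M (is_derive1X (2 * i').+1 (is_derive_tanh x))
      (is_derive1X (2 * j').+1 (is_derive_sech x)).
    apply: (is_derive_eq h); rewrite /f /= !mulnS !add2n -!natr1 !natrM !exprS; ring.
  - move=> x; rewrite normrM !normrX (gtr0_norm (sech_gt0 x)).
    apply: le_trans (_ : 1 * sech x <= _); last by rewrite mul1r.
    apply: ler_pM; rewrite ?exprn_ge0 ?(ltW (sech_gt0 x)) //.
      by rewrite exprn_ile1 ?tanh_le1.
    by rewrite exprS ler_piMr ?(ltW (sech_gt0 x)) // exprn_ile1 ?sech_le1 // ltW // sech_gt0.
  - rewrite -IH; apply: eq_integral => x _; congr EFin.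
    rewrite /f !mulnS !add2n !exprS; have := tanh2_sech2 x => e.
    transitivity (tanh x ^+ (2 * i') * (sech x * sech x ^+ (2 * j')) * (tanh x ^+ 2 + sech x ^+ 2)).
      by ring.
    by rewrite e mulr1.
elim: m => [|m IH] i' j' ij.
  have [-> ->] : i' = 0%N /\ j' = 0%N by lia.
  rewrite /= !cbin0 bin0 mulr1 divr1 mulr1 -integral_sech.
  by apply: eq_integral => x _; rewrite /f muln0 expr0 mul1r expr1.
have bn0 a b : ('C(a + b, a)%:R : R) != 0 by rewrite pnatr_eq0 -lt0n bin_gt0 leq_addr.
case: i' ij => [|i'] ij.
  case: j' ij => [|j'] ij; first by lia.
  have [_ ->] := step _ _ _ (IH 0%N j' ltac:(lia)).
  congr EFin; rewrite !add0n !bin0 !cbin0 cbinS.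
  have j0 : 0 <= j'%:R :> R by [].
  by field; apply: lt0r_neq0; lra.
have [-> _] := step _ _ _ (IH i' j' ltac:(lia)).
congr EFin; have := mul_bin_diag (i' + j').+1 i'.
move=> /(congr1 (fun m => m%:R : R)); rewrite !natrM addSn => e.
have n0 := bn0 i' j'; have n1 := bn0 i'.+1 j'; rewrite addSn in n1.
have i0 : 0 <= i'%:R :> R by []; have j0 : 0 <= j'%:R :> R by [].
have -> : ('C((i' + j').+1, i'.+1)%:R : R) = (i'%:R + j'%:R + 1) * 'C(i' + j', i')%:R / (i'%:R + 1).
  apply: (canRL (mulfK _)); first by apply: lt0r_neq0; lra.
  by rewrite mulrC natr1 -e /= -natr1 natrD.
rewrite cbinS; field.
by rewrite n0 /= !lt0r_neq0 //; lra.
Qed.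

End Hyperbolic.

(** * Wallis's product and the sum of c_k^2 M_k *)

Section Wallis.
Context {R : realType}.
Local Notation mu := (@lebesgue_measure R).
Implicit Types n k : nat.

Let cb n : R := cbin n.

Let walseqSS n : walseq n.+2 = walseq n * ((n%:R + 1) / (n%:R + 2)) :> R.
Proof. by []. Qed.

Let walseqE n : walseq (2 * n) = pi * cb n /\ walseq (2 * n).+1 = 2 / (cb n * (2 * n%:R + 1)).
Proof.
elim: n => [|n [IH1 IH2]]; first by rewrite muln0 /= /cb cbin0; split; field.
have n0 : 0 <= n%:R :> R by []; have c0 : cb n != 0 by rewrite gt_eqF ?cbin_gt0.
rewrite mulnS add2n !walseqSS IH1 IH2.
split; first by rewrite natrM /cb cbinS; field; apply: lt0r_neq0; lra.
rewrite /cb cbinS -/(cb n) -!natr1 natrM; field.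
by rewrite c0 /= !lt0r_neq0 //; lra.
Qed.

Let walseq_nincr n : walseq n.+1 <= walseq n :> R.
Proof.
have mX m : measurable_fun setT (fun x : R => (sech x ^+ m)%:E).
  apply/measurable_EFinP; apply: continuous_measurable_fun.
  exact: continuousX continuous_sech.
rewrite -lee_fin -!integral_sechX; apply: ge0_le_integral; [exact: measurableT| |exact: mX|exact: mX|].
  by move=> x _; rewrite lee_fin exprn_ge0 // ltW // sech_gt0.
move=> x _; rewrite lee_fin [leLHS]exprS ler_piMl ?sech_le1 //.
by rewrite exprn_ge0 // ltW // sech_gt0.
Qed.

Lemma admissible00 : admissible (0 : R) 0.
Proof. by apply/and3P; split; lra. Qed.

(* The summands [0 * _] and [- 0] are those of [lcoef0E] at [s = t = 0]. *)
Let wallis_prod n : \prod_(j < n) (((j%:R + 1) ^+ 2 - 0 * (j%:R + 1) + 0) /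
    ((j%:R + 3 / 2) * (j%:R + 1 / 2 - 0))) = (cb n ^+ 2 * (2 * n%:R + 1))^-1 :> R.
Proof.
elim: n => [|n IH]; first by rewrite big_ord0 /cb cbin0 mulr0 add0r expr1n mulr1 invr1.
have n0 : 0 <= n%:R :> R by []; have c0 : cb n != 0 by rewrite gt_eqF ?cbin_gt0.
rewrite big_ord_recr IH /= /cb cbinS -/(cb n) -natr1; field.
by rewrite c0 /= !lt0r_neq0 //; lra.
Qed.

(** At s = t = 0 the Gauss product is Wallis's; since the integrals of sech^n decrease in n, it lies
    between (pi/2) (2n + 1) / (2n + 2) and pi/2. *)
Lemma lcoef000 : lcoef 0 0 0 = pi / 2 :> R.
Proof.
have h := lcoef0E admissible00.
suff h' : (\prod_(j < N) (((j%:R + 1) ^+ 2 - 0 * (j%:R + 1) + 0) /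
    ((j%:R + 3 / 2) * (j%:R + 1 / 2 - 0)))) @[N --> \oo] --> (pi / 2 : R).
  exact: (cvg_unique _ h h').
apply: (@squeeze_cvgr _ _ _ _ (fun n => pi / 2 - pi / 2 * (2 * n.+1%:R)^-1) (fun=> pi / 2)).
- apply: nearW => n; rewrite wallis_prod.
  have [e1 e2] := walseqE n; have [e3 _] := walseqE n.+1.
  have n0 : 0 <= n%:R :> R by []; have c0 : 0 < cb n := cbin_gt0 n.
  have d0 : 0 < 2 * n%:R + 1 :> R by lra.
  have tc0 : 0 < 2 * cb n by exact: mulr_gt0.
  apply/andP; split; last first.
    have := walseq_nincr (2 * n); rewrite e1 e2 => h1.
    rewrite -(ler_pM2l tc0).
    rewrite (_ : _ * (pi / 2) = pi * cb n); last by field.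
    apply: le_trans h1; rewrite le_eqVlt; apply/orP; left; apply/eqP; field.
    by rewrite !lt0r_neq0.
  have := walseq_nincr (2 * n).+1; rewrite e2 -[(2 * n).+2]/(2 + 2 * n)%N -mulnS e3 => h1.
  rewrite -(ler_pM2l tc0).
  apply: le_trans (le_trans h1 _); rewrite le_eqVlt; apply/orP; left; apply/eqP.
    by rewrite /cb cbinS -natr1; field; rewrite !lt0r_neq0 //; lra.
  by field; rewrite !lt0r_neq0.
- have : (pi / 2 - pi / 2 * (2^-1 * n.+1%:R^-1)) @[n --> \oo] --> (pi / 2 - pi / 2 * (2^-1 * 0) : R).
    apply: cvgB; first exact: cvg_cst.
    by apply: cvgMr; apply: cvgMr; exact: cvg_harmonic.
  by rewrite !mulr0 subr0; under eq_fun do rewrite -invfM.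
- exact: cvg_cst.
Qed.

(** The quotient of the two products in [lcoefE] is c_n^2, and one more c_n stands in front. *)
Let lcoef00 n : lcoef 0 0 n = pi / 2 * cb n ^+ 3.
Proof.
have := lcoefE admissible00 n; rewrite lcoef000 -/(cb n).
have e m : \prod_(j < m) ((j%:R + 1 / 2) ^+ 2 + 0 * (j%:R + 1 / 2) + 0) =
   cb m ^+ 2 * \prod_(j < m) ((j%:R + 1) ^+ 2 - 0 * (j%:R + 1) + 0) :> R.
  elim: m => [|m IH]; first by rewrite !big_ord0 /cb cbin0 expr1n mulr1.
  rewrite !big_ord_recr IH /= /cb cbinS; have : 0 <= m%:R :> R by [].
  by move=> m0; field; apply: lt0r_neq0; lra.
rewrite e mulrA => /mulIf -> //; first by ring.
apply/prodf_neq0 => j _.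
by have : 0 <= j%:R :> R by []; move=> j0; apply: lt0r_neq0; nra.
Qed.

Lemma cauchy_prod_weight :
  (\sum_(k <oo) (cb k ^+ 2 * cauchy_prod (fun n => cb n ^+ 2) cb k)%:E =
   (pi / 2 * limn (series (@weight R)))%:E)%E.
Proof.
pose g k n : \bar R := ((4 * n%:R + 1) * cb n ^+ 3 * (hyp 0 0 k * legm k n))%:E.
have c0 n : 0 <= (4 * n%:R + 1) * cb n ^+ 3.
  by rewrite mulr_ge0 ?exprn_ge0 ?addr_ge0 ?mulr_ge0 // ltW // cbin_gt0.
have g0 k n : (0 <= g k n)%E.
  by rewrite lee_fin mulr_ge0 // (lcoef_term_ge0 admissible00).
transitivity (\sum_(k <oo) \sum_(n <oo) g k n)%E.
  apply: eq_eseriesr => k _; rewrite (@nneseries_fin _ _ k.+1) //; last first.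
    by move=> n kn; rewrite /g legm_gt ?mulr0.
  rewrite sumEFin cauchy_prod_cbin mulr_sumr; congr EFin.
  by apply: eq_bigr => n _; rewrite hyp00 /cb; ring.
rewrite nneseries_interchange //.
transitivity (\sum_(n <oo) ((pi / 2 : R)%:E * (weight n)%:E))%E.
  apply: eq_eseriesr => n _; under eq_eseriesr do rewrite /g EFinM.
  rewrite nneseriesZl; last by move=> k _; rewrite lee_fin (lcoef_term_ge0 admissible00).
  by rewrite (lcoef_nneseries admissible00) lcoef00 -!EFinM /weight -/(cb n); congr EFin; ring.
rewrite nneseriesZl; last by move=> n _; rewrite lee_fin weight_ge0.
by rewrite nneseries_EFin ?EFinM //; [exact: weight_ge0|exact: weight_cvg].
Qed.

End Wallis.

(** * K_0 as an integral over the line *)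

Section BesselK.
Context {R : realType}.
Local Notation mu := (@lebesgue_measure R).
Implicit Types (t u v x : R).

Lemma measurable_fun_cosh d (T : measurableType d) (f : T -> R) :
  measurable_fun setT f -> measurable_fun setT (fun z => cosh (f z)).
Proof.
by move=> mf; apply: measurableT_comp mf; exact: continuous_measurable_fun continuous_cosh.
Qed.

Lemma measurable_fun_expR d (T : measurableType d) (f : T -> R) :
  measurable_fun setT f -> measurable_fun setT (fun z => expR (f z)).
Proof. by move=> mf; apply: measurableT_comp mf; exact: measurable_expR. Qed.

Lemma continuous_fun_expR (f : R -> R) : continuous f -> continuous (fun x => expR (f x)).
Proof. by move=> cf x; exact: (continuous_comp (cf x) (@continuous_expR R (f x))). Qed.

Lemma integral_line_affine (G : R -> R) (a b : R) : 0 < b -> continuous G ->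
  (forall x, 0 <= G x) ->
  (\int[mu]_x (G x)%:E = \int[mu]_x (G (a + b * x) * b)%:E)%E.
Proof.
move=> b0 cG G0; apply: (@integral_line_subst R (fun x => a + b * x) (fun=> b)) => //.
- move=> x; have h := is_derive1D (is_derive_cst (a : R) x 1)
    (is_derive1M (is_derive_cst (b : R) x 1) (is_derive_id x 1)).
  by apply: (is_derive_eq h); rewrite /cst /=; ring.
- by move=> x; exact: cvg_cst.
- move=> y; exists (Num.truncn `|(y - a) / b|).+1.
  have := truncnS_gt `|(y - a) / b|; rewrite ltr_norml => /andP[_ h].
  by move: h; rewrite ltr_pdivrMr // mulrC; lra.
- move=> y; exists (Num.truncn `|(y - a) / b|).+1.
  have := truncnS_gt `|(y - a) / b|; rewrite ltr_norml => /andP[h _].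
  by move: h; rewrite ltr_pdivlMr // mulNr mulrN [b * _]mulrC; lra.
Qed.

(* Extended-real valued and over the whole line, so that Tonelli's theorem and translations of
   the variable apply without side conditions. *)
Definition besselK t : \bar R := (\int[mu]_u (expR (- (t * cosh u)))%:E)%E.

Lemma besselK_ge0 t : (0 <= besselK t)%E.
Proof. by apply: integral_ge0 => u _; rewrite lee_fin expR_ge0. Qed.

Lemma measurable_besselK : measurable_fun setT besselK.
Proof.
apply: (@measurable_fun_fubini_tonelli_F _ _ _ _ _ mu
  (fun z : R * R => (expR (- (z.1 * cosh z.2)))%:E)).
  apply/measurable_EFinP; apply: measurable_fun_expR; apply: measurable_funN.
  by apply: measurable_funM => //; exact: measurable_fun_cosh.
by move=> z; rewrite lee_fin expR_ge0.
Qed.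

Let continuous_kernel t : continuous (fun u => expR (- (t * cosh u))).
Proof.
apply: continuous_fun_expR => x.
by apply: cvgN; apply: cvgM; [exact: cvg_cst|exact: continuous_cosh].
Qed.

Let besselKZ (c t : R) : 0 <= c ->
  (\int[mu]_u (c * expR (- (t * cosh u)))%:E = c%:E * besselK t)%E.
Proof.
move=> c0; under eq_integral do rewrite EFinM; rewrite ge0_integralZl_EFin //.
by apply/measurable_EFinP; exact: continuous_measurable_fun (@continuous_kernel _).
Qed.

(** The factor 2 comes from evenness of cosh. The bound exp(- t cosh u) <= sech u / t gives
    finiteness, so that the real integral in [besselK0] loses nothing. *)
Lemma besselKE t : 0 < t -> besselK t = (2 * besselK0 t)%:E.
Proof.
move=> t0; have e : besselK t = (2 * \int[mu]_(u in `[0%R, +oo[) (expR (- (t * cosh u)))%:E)%E.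
  rewrite /besselK ge0_symfun_integralT //.
  - congr (_ * integral _ _ _)%E; apply/seteqP; split => x /=; rewrite in_itv /= andbT //.
  - by move=> x /=; rewrite /cosh opprK [expR (- x) + _]addrC.
have Kfin : besselK t \is a fin_num.
  rewrite ge0_fin_numE ?besselK_ge0 //.
  apply: (@le_lt_trans _ _ (t^-1%:E * \int[mu]_x (sech x)%:E)%E).
    rewrite -ge0_integralZl_EFin //; last 3 first.
    - by move=> x _; rewrite lee_fin ltW // sech_gt0.
    - by apply/measurable_EFinP; exact: continuous_measurable_fun continuous_sech.
    - by rewrite invr_ge0 ltW.
    apply: ge0_le_integral => //.
    - by apply/measurable_EFinP; exact: continuous_measurable_fun (@continuous_kernel t).
    - apply/measurable_EFinP; apply: measurable_funM => //.
      exact: continuous_measurable_fun continuous_sech.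
    move=> x _; have c0 := cosh_gt0 x; rewrite lee_fin /sech -invfM expRN.
    rewrite lef_pV2 ?posrE ?expR_gt0 //; last exact: mulr_gt0.
    by have := expR_ge1Dx (t * cosh x); lra.
  by rewrite integral_sech -EFinM ltry.
have K0E : (\int[mu]_(u in `[0%R, +oo[) (expR (- (t * cosh u)))%:E)%E = (besselK0 t)%:E.
  rewrite /besselK0 /Rintegral fineK // ge0_fin_numE; last first.
    by apply: integral_ge0 => x _; rewrite lee_fin expR_ge0.
  apply: le_lt_trans (_ : besselK t < +oo)%E; last by rewrite -ge0_fin_numE ?besselK_ge0.
  apply: ge0_subset_integral => //; apply/measurable_EFinP.
  exact: continuous_measurable_fun (@continuous_kernel t).
by rewrite e K0E -EFinM.
Qed.

(* In the double integral over [(v, w)], substitute [v = q - r] and [w = q + r]. *)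
Lemma besselK_sqr t :
  (besselK t * besselK t = 2%:E * \int[mu]_r besselK (2 * t * cosh r))%E.
Proof.
pose E u : \bar R := (expR (- (t * cosh u)))%:E.
have E0 u : (0 <= E u)%E by rewrite lee_fin expR_ge0.
have mE : measurable_fun setT E.
  by apply/measurable_EFinP; exact: continuous_measurable_fun (@continuous_kernel t).
pose G v r : R := expR (- (2 * t * cosh r * cosh (v + r))).
transitivity (\int[mu]_v \int[mu]_r (2 * G v r)%:E)%E.
  rewrite {1}/besselK -(@ge0_integralZr _ _ _ mu _ measurableT E mE) ?besselK_ge0 //.
  apply: eq_integral => v _; rewrite -/(E v).
  have <- : (\int[mu]_w (E v * E w) = E v * besselK t)%E.
    by rewrite (@ge0_integralZl _ _ _ mu _ measurableT E mE (E v)).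
  under eq_integral do rewrite -EFinM -expRD.
  (* Here w = v + 2 r; the shift q = v + r follows after Tonelli, so that each change of variable is
     affine in one variable. *)
  rewrite (@integral_line_affine _ v 2) //; last first.
    apply: continuous_fun_expR => x; apply: cvgD; first exact: cvg_cst.
    by apply: cvgN; apply: cvgM; [exact: cvg_cst|exact: continuous_cosh].
  apply: eq_integral => r _; rewrite mulrC /G; congr (_ * expR _)%:E.
  suff -> : cosh (v + 2 * r) = 2 * cosh r * cosh (v + r) - cosh v by ring.
  rewrite (_ : v + 2 * r = v + r + r); last by ring.
  rewrite /cosh !expRN !expRD.
  by have := expR_gt0 v; have := expR_gt0 r; move=> *; field; rewrite !gt_eqF.
rewrite (@fubini_tonelli _ _ _ _ _ mu mu (fun z : R * R => (2 * G z.1 z.2)%:E)); last 2 first.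
- apply/measurable_EFinP; apply: measurable_funM => //.
  apply: measurable_fun_expR; apply: measurable_funN; apply: measurable_funM.
    by apply: measurable_funM => //; exact: measurable_fun_cosh.
  by apply: measurable_fun_cosh; exact: measurable_funD.
- by move=> z; rewrite lee_fin mulr_ge0 // expR_ge0.
rewrite -ge0_integralZl //; last 2 first.
- apply: measurableT_comp measurable_besselK _.
  by apply: measurable_funM => //; exact: measurable_fun_cosh.
- by move=> r _; exact: besselK_ge0.
apply: eq_integral => r _ /=.
rewrite -besselKZ; last by [].
rewrite [RHS](@integral_line_affine (fun u => 2 * expR (- (2 * t * cosh r * cosh u))) r 1).
- by apply: eq_integral => v _; rewrite mul1r mulr1 [r + v]addrC.
- by [].
- by move=> x; apply: cvgM; [exact: cvg_cst|exact: continuous_kernel].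
- by move=> x; rewrite mulr_ge0 // expR_ge0.
Qed.

End BesselK.

(** * I_0, its Laplace transform and the binomial series *)

Section BesselI.
Context {R : realType}.
Local Notation mu := (@lebesgue_measure R).
Implicit Types (t a z : R) (n k : nat).

Definition besselI t : \bar R := (\sum_(k <oo) ((t / 2) ^+ (2 * k) / k`!%:R ^+ 2)%:E)%E.

Let besselI_term_ge0 t k : 0 <= (t / 2) ^+ (2 * k) / k`!%:R ^+ 2.
Proof. by rewrite mulr_ge0 ?exprn_even_ge0 ?oddM // invr_ge0 sqr_ge0. Qed.

Lemma besselI_ge0 t : (0 <= besselI t)%E.
Proof. by apply: nneseries_ge0 => k _ _; rewrite lee_fin. Qed.

Lemma besselIE t : besselI t = (besselI0 t)%:E.
Proof.
rewrite /besselI nneseries_EFin //.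
apply: (@series_le_cvg _ _ (exp_coeff ((t / 2) ^+ 2))) => // [k|k|].
- by rewrite /exp_coeff /= divr_ge0 // exprn_ge0 // sqr_ge0.
- rewrite /exp_coeff /= exprM; apply: ler_wpM2l; first by rewrite exprn_ge0 // sqr_ge0.
  have f1 : 1 <= k`!%:R :> R by rewrite ler1n fact_gt0.
  have f0 : 0 < k`!%:R :> R by exact: lt_le_trans f1.
  by rewrite lef_pV2 ?posrE ?exprn_gt0 // expr2 ler_peMl // ltW.
- exact: is_cvg_series_exp_coeff.
Qed.

Lemma measurable_besselI : measurable_fun setT besselI.
Proof.
apply: (@ge0_emeasurable_sum _ _ _ _ (fun k t => ((t / 2) ^+ (2 * k) / k`!%:R ^+ 2)%:E) xpredT).
  by move=> k t _ _; rewrite lee_fin.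
move=> k _; apply/measurable_EFinP; apply: measurable_funM => //.
by apply: measurable_funX; exact: measurable_funM.
Qed.

Let powexp_le n a t : 0 < a -> 0 < t ->
  0 <= t ^+ n * expR (- (t * a)) <= (n.+1)`!%:R / a ^+ n.+1 * t^-1.
Proof.
move=> a0 t0; rewrite mulr_ge0 ?expR_ge0 ?exprn_ge0 ?(ltW t0) //=.
have := expR_ge1Dxn n (ltW (mulr_gt0 t0 a0)) => h.
rewrite expRN ler_pdivrMr ?expR_gt0 //.
have f0 : 0 < (n.+1)`!%:R :> R by rewrite ltr0n fact_gt0.
rewrite (_ : t ^+ n = (n.+1)`!%:R / a ^+ n.+1 / t * ((t * a) ^+ n.+1 / (n.+1)`!%:R)); last first.
  by rewrite exprMn !exprS; field; rewrite !gt_eqF ?exprn_gt0.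
rewrite ler_wpM2l //; last by lra.
by rewrite !mulr_ge0 ?invr_ge0 ?exprn_ge0 // ltW.
Qed.

Let powexp_cvg n a : 0 < a -> (t ^+ n * expR (- (t * a))) @[t --> +oo] --> (0 : R).
Proof.
move=> a0.
apply: (@squeeze_cvgr _ _ _ _ (fun=> 0) (fun t => (n.+1)`!%:R / a ^+ n.+1 * t^-1)).
- by near=> t; apply: powexp_le.
- exact: cvg_cst.
- rewrite -[X in _ --> X](mulr0 ((n.+1)`!%:R / a ^+ n.+1)); apply: cvgMr.
  by apply/gtr0_cvgV0 => //; near=> t.
Unshelve. all: by end_near. Qed.

Let continuous_powexp n a : continuous (fun t => t ^+ n * expR (- (t * a))).
Proof.
move=> t; apply: cvgM; first exact: exprn_continuous.
have cf : continuous (fun t => - (t * a)).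
  by move=> s; apply: cvgN; apply: cvgM; [exact: cvg_id|exact: cvg_cst].
exact: (continuous_fun_expR cf).
Qed.

Lemma laplace_power n a : 0 < a ->
  (\int[mu]_(t in `]0%R, +oo[) (t ^+ n * expR (- (t * a)))%:E = (n`!%:R / a ^+ n.+1)%:E)%E.
Proof.
move=> a0; have an0 := lt0r_neq0 a0.
have [F [dF F0 Fl]] : exists F : R -> R,
    [/\ forall t : R, is_derive t 1 F (t ^+ n * expR (- (t * a))),
     F 0 = - (n`!%:R / a ^+ n.+1) & F t @[t --> +oo] --> (0 : R)].
  have dE t : is_derive t 1 (fun t => expR (- (t * a))) (- a * expR (- (t * a))).
    have h := is_derive1M (is_derive_id t 1) (is_derive_cst (- a : R) t 1).
    have h' := @is_derive1_comp R (@expR R) (fun y => y * - a) t _ _ (is_derive_expR (t * - a)) h.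
    under eq_fun do rewrite -mulrN; apply: (is_derive_eq h').
    by rewrite /cst /= mulrN; ring.
  elim: n => [|n [F [dF F0 Fl]]].
    exists (fun t => - a^-1 * (t ^+ 0 * expR (- (t * a)))); split.
    - move=> t; have h := is_derive1M (is_derive_cst (- a^-1 : R) t 1) (dE t).
      under eq_fun do rewrite expr0 mul1r.
      by apply: (is_derive_eq h); rewrite /cst /=; field.
    - by rewrite mul0r oppr0 expR0 expr0 fact0 expr1 !mulr1 mul1r.
    - by rewrite -[X in _ --> X](mulr0 (- a^-1)); apply: cvgMr; exact: powexp_cvg.
  exists (fun t => a^-1 * (n.+1%:R * F t - t ^+ n.+1 * expR (- (t * a)))); split.
  - move=> t; have h := is_derive1M (is_derive_cst (a^-1 : R) t 1)
      (is_derive1B (is_derive1M (is_derive_cst (n.+1%:R : R) t 1) (dF t))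
         (is_derive1M (is_derive1X n.+1 (is_derive_id t 1)) (dE t))).
    by apply: (is_derive_eq h); rewrite /cst /= exprS; field.
  - rewrite F0 expr0n /= mul0r subr0 factS natrM [a ^+ n.+2]exprS.
    by field; rewrite an0 /= expf_neq0.
  - rewrite -[X in _ --> X](mulr0 (a^-1)); apply: cvgMr.
    rewrite -[X in _ --> X](subr0 (0 : R)); apply: cvgB; last exact: powexp_cvg.
    by rewrite -[X in _ --> X](mulr0 (n.+1%:R : R)); exact: cvgMr.
rewrite integral_itv_obnd_cbnd; last first.
  apply/measurable_EFinP; apply: measurable_funTS.
  exact: continuous_measurable_fun (@continuous_powexp n a).
rewrite (@ge0_continuous_FTC2y _ _ F 0 0) //.
- by rewrite F0 -EFinB sub0r opprK.
- by move=> t t0; rewrite mulr_ge0 ?exprn_ge0 ?expR_ge0.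
- exact: continuous_subspaceT (@continuous_powexp n a).
- by apply: cvg_at_right_filter; exact: is_derive_continuous dF 0.
- by move=> t _; rewrite derive1E; apply: derive_val.
Qed.

(** By the symmetry of k and m - k, twice the sum T weighted by k is m times the convolution; (k +
    1) c_{k+1} = (k + 1/2) c_k relates T n.+1 to T n. *)
Lemma cauchy_prod_cbin1 n : cauchy_prod cbin cbin n = 1 :> R.
Proof.
pose T m : R := \sum_(k < m.+1) k%:R * (cbin k * cbin (m - k)%N).
have sym m : 2 * T m = m%:R * cauchy_prod cbin cbin m.
  rewrite /T mulr_natl mulr2n {2}(reindex_inj rev_ord_inj) /= -big_split /=.
  rewrite /cauchy_prod mulr_sumr; apply: eq_bigr => -[k /= km] _.
  by rewrite subSS subKn // natrB //; ring.
elim: n => [|n IH]; first by rewrite /cauchy_prod big_ord1 cbin0 mulr1.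
have n0 : n.+1%:R != 0 :> R by rewrite pnatr_eq0.
apply: (mulfI n0); rewrite -sym.
have -> : n.+1%:R * 1 = 2 * T n + cauchy_prod cbin cbin n by rewrite sym IH -natr1; ring.
rewrite {1}/T big_ord_recl mul0r add0r !mulr_sumr -big_split /=.
apply: eq_bigr => -[k kn] _ /=; rewrite /bump add1n subSS cbinS -natr1.
by have k0 : 0 <= k%:R :> R by []; field; apply: lt0r_neq0; lra.
Qed.

(** By [cauchy_prod_cbin1] the square of the series is the geometric series, and the sum is
    nonnegative. *)
Lemma binomial_series z : 0 <= z < 1 ->
  (\sum_(k <oo) (cbin k * z ^+ k)%:E = ((Num.sqrt (1 - z))^-1)%:E)%E.
Proof.
move=> /andP[z0 z1].
have cz k : 0 <= cbin k * z ^+ k by rewrite mulr_ge0 ?exprn_ge0 // ltW // cbin_gt0.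
have geo : series (geometric 1 z) @ \oo --> (1 / (1 - z)).
  by apply: cvg_geometric_series; rewrite ger0_norm.
have c1 k : cbin k <= 1 :> R.
  elim: k => [|k IH]; first by rewrite cbin0.
  rewrite cbinS (le_trans _ IH) // ler_piMr ?(ltW (cbin_gt0 _)) //.
  by have k0 : 0 <= k%:R :> R by []; rewrite ler_pdivrMr; lra.
have cv : cvgn (series (fun k => cbin k * z ^+ k)).
  apply: (@series_le_cvg _ _ (geometric 1 z)) => // [k|k|]; rewrite ?geometric_ge0 //.
    by rewrite /geometric /= ler_wpM2r ?exprn_ge0.
  by apply/cvg_ex; exists (1 / (1 - z)).
rewrite nneseries_EFin //; congr EFin.
set S := limn _; have S0 : 0 <= S.
  by apply: limr_ge => //; apply: nearW => m; apply: sumr_ge0.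
have SS : S * S = (1 - z)^-1.
  apply: EFin_inj; rewrite EFinM /S -nneseries_EFin // nneseriesM //; last first.
    by rewrite nneseries_EFin.
  rewrite nneseries_diag; last by move=> k l; rewrite -EFinM lee_fin mulr_ge0.
  transitivity (\sum_(N <oo) (geometric 1 z N)%:E)%E.
    apply: eq_eseriesr => N _; rewrite sumEFin; congr EFin.
    rewrite /geometric /= -(cauchy_prod_cbin1 N) /cauchy_prod mulr_suml.
    apply: eq_bigr => -[k kN] _ /=.
    by rewrite -[in z ^+ N](subnKC (_ : k <= N)%N) // exprD; ring.
  rewrite nneseries_EFin; first by rewrite (cvg_lim _ geo) // div1r.
    by move=> k; exact: geometric_ge0.
  by apply/cvg_ex; exists (1 / (1 - z)).
by rewrite -sqrtrV ?subr_ge0 ?(ltW z1) // -SS -expr2 sqrtr_sqr ger0_norm.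
Qed.

(** Termwise, (2k)! / (4^k k!^2) = c_k, which leaves the binomial series at z = a^-2. *)
Lemma laplace_besselI a : 1 < a ->
  (\int[mu]_(t in `]0%R, +oo[) (besselI t * (expR (- (t * a)))%:E) =
   ((Num.sqrt (a ^+ 2 - 1))^-1)%:E)%E.
Proof.
move=> a1; have a0 : 0 < a by lra.
pose f k t : \bar R := ((2 ^+ (2 * k) * k`!%:R ^+ 2)^-1 * (t ^+ (2 * k) * expR (- (t * a))))%:E.
transitivity (\int[mu]_(t in `]0%R, +oo[) \sum_(k <oo) f k t)%E.
  apply: eq_integral => t _; rewrite muleC -nneseriesZl; last by move=> k _; rewrite lee_fin.
  apply: eq_eseriesr => k _; rewrite -EFinM /f; congr EFin.
  rewrite exprMn exprVn [(2 ^+ _ * _)^-1]invfM.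
  by move: (t ^+ _) (2 ^+ _)^-1 (_ ^+ 2)^-1 => x y w; ring.
have f0 k t : (0 <= f k t)%E.
  by rewrite lee_fin !mulr_ge0 ?expR_ge0 ?exprn_even_ge0 ?oddM // invr_ge0 mulr_ge0 ?exprn_ge0.
have mpe k : measurable_fun (`]0%R, +oo[%classic : set R) (fun t => (t ^+ (2 * k) * expR (- (t * a)))%:E).
  apply/measurable_EFinP; apply: measurable_funTS.
  exact: continuous_measurable_fun (@continuous_powexp _ a).
rewrite integral_nneseries //; last first.
  move=> k; apply/measurable_EFinP; apply: measurable_funM => //.
  by apply/measurable_EFinP; exact: mpe.
have z01 : 0 <= a ^- 2 < 1.
  rewrite invr_ge0 sqr_ge0 /= invf_lt1 ?exprn_gt0 // expr2.
  by nra.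
transitivity (\sum_(k <oo) ((a^-1)%:E * (cbin k * (a ^- 2) ^+ k)%:E))%E.
  apply: eq_eseriesr => k _; rewrite /f; under eq_integral do rewrite EFinM.
  rewrite ge0_integralZl_EFin //; last 2 first.
  - by move=> t _; rewrite lee_fin mulr_ge0 ?expR_ge0 ?exprn_even_ge0 ?oddM.
  - exact: mpe.
  rewrite laplace_power // -!EFinM; congr EFin.
  rewrite /cbin [a ^+ _.+1]exprS exprVn -exprM.
  have -> : 2 ^+ (2 * k) = 4 ^+ k :> R by rewrite exprM; congr (_ ^+ _); ring.
  have := bin_fact (leq_pmull k (isT : 0 < 2)%N).
  rewrite mul2n -addnn addnK addnn -mul2n => /(congr1 (fun m => m%:R : R)).
  rewrite !natrM => <-.
  have f1 : (k`!%:R : R) != 0 by rewrite pnatr_eq0 -lt0n fact_gt0.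
  by field; rewrite !expf_neq0 ?lt0r_neq0 ?f1.
rewrite nneseriesZl; last first.
  by move=> k _; rewrite lee_fin mulr_ge0 ?exprn_ge0 ?(ltW (cbin_gt0 _)) //; case/andP: z01.
rewrite binomial_series // -EFinM -invfM; congr (_^-1)%:E.
rewrite -{1}[a](ger0_norm (ltW a0)) -sqrtr_sqr -sqrtrM ?sqr_ge0 //.
by congr (Num.sqrt _); field; exact: lt0r_neq0.
Qed.

End BesselI.

(** * Landen's transformation of the innermost integral *)

Section Theta.
Context {R : realType}.
Local Notation mu := (@lebesgue_measure R).
Implicit Types (x p u : R) (k : nat).

Let continuousV (f : R -> R) : (forall x, f x != 0) -> continuous f ->
  continuous (fun x => (f x)^-1).
Proof. by move=> f0 cf x; apply: cvgV => //; exact: cf. Qed.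

Let continuous_sqrt (f : R -> R) : continuous f -> continuous (fun x => Num.sqrt (f x)).
Proof. by move=> cf x; exact: (continuous_comp (cf x) (@sqrt_continuous R (f x))). Qed.

Let continuousM (f g : R -> R) : continuous f -> continuous g ->
  continuous (fun x => f x * g x).
Proof. by move=> cf cg x; apply: cvgM; [exact: cf|exact: cg]. Qed.

Let continuousD (f g : R -> R) : continuous f -> continuous g ->
  continuous (fun x => f x + g x).
Proof. by move=> cf cg x; apply: cvgD; [exact: cf|exact: cg]. Qed.

Let continuousC (c : R) : continuous (fun _ : R => c).
Proof. by move=> x; exact: cvg_cst. Qed.

Let continuous_sinh : continuous (@sinh R).
Proof. exact: is_derive_continuous is_derive_sinh. Qed.

Let continuous_expN : continuous (fun x : R => expR (- x)).
Proof. by apply: continuous_fun_expR => x; apply: cvgN; exact: cvg_id. Qed.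

Context (B : R) (B1 : 1 <= B).

Let B0 : 0 < B. Proof. exact: lt_le_trans B1. Qed.

(* A form of Landen's transformation: the substitutions [y = 2 sinh x sqrt (cosh x ^ 2 + B)] and
   [y = exp x - B exp (- x)] both lead to the integral of [G]. *)
Let G y : R := 2 / (Num.sqrt (y ^+ 2 + 4 * B) * Num.sqrt (4 * y ^+ 2 + (2 * B + 2) ^+ 2)).

Let G1_gt0 y : 0 < Num.sqrt (y ^+ 2 + 4 * B).
Proof. by rewrite sqrtr_gt0 ltr_wpDl ?sqr_ge0 // mulr_gt0. Qed.

Let G2_gt0 y : 0 < Num.sqrt (4 * y ^+ 2 + (2 * B + 2) ^+ 2).
Proof.
rewrite sqrtr_gt0; apply: ltr_wpDl; first by rewrite mulr_ge0 ?sqr_ge0.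
by rewrite exprn_gt0 //; have := B0; lra.
Qed.

Let G_ge0 y : 0 <= G y.
Proof. by rewrite /G divr_ge0 // mulr_ge0 // ltW. Qed.

Let continuous_G : continuous G.
Proof.
apply: continuousM; first exact: continuousC.
apply: continuousV => [y|]; first by apply: lt0r_neq0; exact: mulr_gt0.
have cX : continuous (fun y : R => y ^+ 2) by move=> y; exact: exprn_continuous.
apply: continuousM; apply: continuous_sqrt; apply: continuousD => //.
by apply: continuousM.
Qed.

Let f u : R := (Num.sqrt ((cosh u + 2 * B) ^+ 2 - 1))^-1.

(** The radicand is a difference of squares, with factors 2 (sinh^2 x + B) and 2 (cosh^2 x + B). *)
Let f_cosh2 x : f (2 * x) * 2 =
  (Num.sqrt (cosh x ^+ 2 + B))^-1 * (Num.sqrt (sinh x ^+ 2 + B))^-1.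
Proof.
rewrite /f (_ : cosh (2 * x) = 2 * cosh x ^+ 2 - 1); last first.
  rewrite (_ : 2 * x = x + x); last by ring.
  rewrite /cosh !expRN !expRD; have := expR_gt0 x; move: (expR x) => p p0.
  by field; rewrite gt_eqF.
have -> : (2 * cosh x ^+ 2 - 1 + 2 * B) ^+ 2 - 1 =
    2 ^+ 2 * ((cosh x ^+ 2 + B) * (sinh x ^+ 2 + B)).
  by rewrite cosh2_sinh2; ring.
rewrite sqrtrM ?sqr_ge0 // sqrtr_sqr ger0_norm // sqrtrM.
  by rewrite -invfM [in LHS]invfM mulrAC mulVf // mul1r.
by rewrite addr_ge0 ?sqr_ge0 // ltW.
Qed.

(** After u = 2 x, the substitution F turns both radicands of G into squares. *)
Let integral_f : (\int[mu]_u (f u)%:E = \int[mu]_y (G y)%:E)%E.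
Proof.
have c20 x : 0 < cosh x ^+ 2 + B by rewrite ltr_wpDl ?sqr_ge0.
have s20 x : 0 < sinh x ^+ 2 + B by rewrite ltr_wpDl ?sqr_ge0.
pose P x : R := Num.sqrt (cosh x ^+ 2 + B).
have P0 x : 0 < P x by rewrite sqrtr_gt0.
have P2 x : P x ^+ 2 = cosh x ^+ 2 + B by rewrite sqr_sqrtr // ltW.
pose F x : R := 2 * sinh x * P x.
pose F' x : R := 2 * cosh x * (P x ^+ 2 + sinh x ^+ 2) / P x.
have F'0 x : 0 < F' x.
  rewrite /F' divr_gt0 //; apply: mulr_gt0; first exact: mulr_gt0 (cosh_gt0 x).
  by apply: ltr_wpDr; [exact: sqr_ge0|exact: exprn_gt0].
have cP : continuous P.
  by apply: continuous_sqrt; apply: continuousD => //; exact: continuousX continuous_cosh.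
have cF' : continuous F'.
  apply: continuousM; last by apply: continuousV => // x; rewrite gt_eqF.
  apply: continuousM; first by apply: continuousM => //; exact: continuous_cosh.
  by apply: continuousD; [exact: continuousX cP|exact: continuousX continuous_sinh].
have dF x : is_derive x 1 F (F' x).
  have h1 := is_derive1D (is_derive1X 2 (is_derive_cosh x)) (is_derive_cst B x 1).
  have h2 := @is_derive1_comp R (@Num.sqrt R) _ x _ _ (is_derive1_sqrt (c20 x)) h1.
  have h3 := is_derive1M (is_derive1M (is_derive_cst (2 : R) x 1) (is_derive_sinh x)) h2.
  apply: (is_derive_eq h3); rewrite /cst /= -/(P x) /F'.
  by field; rewrite gt_eqF.
have sinh_ge x : 0 <= x -> x <= 2 * sinh x.
  move=> x0; rewrite /sinh mulrC divfK //; have := expR_ge1Dx x.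
  have : expR (- x) <= 1 by rewrite expR_le1 oppr_le0.
  lra.
have F_ge x : 0 <= x -> x <= F x.
  move=> x0; have := sinh_ge x x0 => h; apply: (le_trans h).
  rewrite /F ler_peMr //; first exact: le_trans h.
  rewrite -(@ler_pXn2r _ 2) ?nnegrE //; last exact: ltW (P0 x).
  by rewrite expr1n P2; have := sqr_ge0 (cosh x); have := B1; lra.
have FN x : F (- x) = - F x.
  have -> : F (- x) = 2 * sinh (- x) * P x.
    by rewrite /F /P /cosh opprK [expR (- x) + _]addrC.
  by rewrite /F /sinh opprK; field.
rewrite (@integral_line_subst R F F' G) //.
- have cf : continuous f.
    apply: continuousV => [u|].
      rewrite gt_eqF // sqrtr_gt0 subr_gt0 exprn_egt1 //.
      by have := cosh_ge1 u; have := B1; lra.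
    apply: continuous_sqrt; apply: continuousD => //; apply: continuousX.
    by apply: continuousD => //; exact: continuous_cosh.
  rewrite (@integral_line_affine _ f 0 2) //; last first.
    by move=> x; rewrite invr_ge0 sqrtr_ge0.
  apply: eq_integral => x _; rewrite add0r f_cosh2 -/(P x); congr EFin.
  have Q0 : 0 < Num.sqrt (sinh x ^+ 2 + B) by rewrite sqrtr_gt0.
  have Q2 : Num.sqrt (sinh x ^+ 2 + B) ^+ 2 = sinh x ^+ 2 + B by rewrite sqr_sqrtr // ltW.
  have c0 := cosh_gt0 x.
  rewrite /G (_ : F x ^+ 2 + 4 * B = (2 * (cosh x * Num.sqrt (sinh x ^+ 2 + B))) ^+ 2); last first.
    rewrite /F; transitivity (4 * sinh x ^+ 2 * P x ^+ 2 + 4 * B); first by ring.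
    rewrite P2; transitivity (4 * cosh x ^+ 2 * Num.sqrt (sinh x ^+ 2 + B) ^+ 2); last by ring.
    by rewrite Q2 !cosh2_sinh2; ring.
  rewrite (_ : 4 * F x ^+ 2 + (2 * B + 2) ^+ 2 = (2 * (P x ^+ 2 + sinh x ^+ 2)) ^+ 2); last first.
    rewrite /F; transitivity (16 * sinh x ^+ 2 * P x ^+ 2 + (2 * B + 2) ^+ 2); first by ring.
    by rewrite P2 !cosh2_sinh2; ring.
  have S0 : 0 < P x ^+ 2 + sinh x ^+ 2 by rewrite ltr_wpDr ?sqr_ge0 // exprn_gt0.
  have g1 := mulr_gt0 (ltr0Sn R 1) (mulr_gt0 c0 Q0); have g2 := mulr_gt0 (ltr0Sn R 1) S0.
  rewrite !sqrtr_sqr (gtr0_norm g1) (gtr0_norm g2) /F'.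
  by field; rewrite !lt0r_neq0.
- move=> y; exists (Num.truncn `|y|).+1; apply: (le_trans _ (F_ge _ _)) => //.
  by apply: (le_trans (ler_norm y)); rewrite ltW // truncnS_gt.
- move=> y; exists (Num.truncn `|y|).+1; rewrite FN.
  have := F_ge (Num.truncn `|y|).+1%:R (ler0n _ _) => h.
  have := truncnS_gt `|y|; have := ler_norm (- y); rewrite normrN; lra.
Qed.

Let z : R := 1 - B ^- 2.

Let z01 : 0 <= z < 1.
Proof.
rewrite /z subr_ge0 invf_le1 ?exprn_gt0 // exprn_ege1 //=.
by rewrite ltrBlDr ltrDl invr_gt0 exprn_gt0.
Qed.

Let sg x : R := (1 + tanh x) / 2.

Let sgE x : sg x = expR x / (expR x + expR (- x)).
Proof.
rewrite /sg /tanh /sinh /cosh; have := expR_gt0 x; have := expR_gt0 (- x).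
by move=> *; field; rewrite gt_eqF // addr_gt0.
Qed.

Let sg01 x : 0 <= sg x <= 1.
Proof. by have := tanh_le1 x; rewrite ler_norml /sg => /andP[? ?]; apply/andP; split; lra. Qed.

Let zsg01 x : 0 <= z * sg x < 1.
Proof.
have /andP[z0 z1] := z01; have /andP[s0 s1] := sg01 x.
by rewrite mulr_ge0 //= (le_lt_trans _ z1) // ler_piMr.
Qed.

(** Here the first radicand is the square of F' and cancels it; the second is (4 B cosh x)^2 (1 - z
    sg x), where [sg] is the logistic function at 2 x. *)
Let integral_G : (\int[mu]_y (G y)%:E =
  \int[mu]_x (sech x / (2 * B) * (Num.sqrt (1 - z * sg x))^-1)%:E)%E.
Proof.
pose F x : R := expR x - B * expR (- x).
pose F' x : R := expR x + B * expR (- x).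
have F'0 x : 0 < F' x by rewrite addr_gt0 ?mulr_gt0 ?expR_gt0.
have dF x : is_derive x 1 F (F' x).
  have h1 := is_derive1_comp (is_derive_expR (- x)) (is_deriveNid x 1).
  have h := is_derive1B (is_derive_expR x) (is_derive1M (is_derive_cst B x 1) h1).
  by apply: (is_derive_eq h); rewrite /cst /F' /=; ring.
rewrite (@integral_line_subst R F F' G) //.
- apply: eq_integral => x _; congr EFin; rewrite /G.
  have e0 := expR_gt0 x; have e0' := expR_gt0 (- x).
  have ee : expR x * expR (- x) = 1 by rewrite -expRD subrr expR0.
  rewrite (_ : F x ^+ 2 + 4 * B = F' x ^+ 2); last first.
    rewrite /F /F'; transitivity ((expR x - B * expR (- x)) ^+ 2 + 4 * B * (expR x * expR (- x))).
      by rewrite ee mulr1.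
    by ring.
  have /andP[_ zs1] := zsg01 x.
  rewrite (_ : 4 * F x ^+ 2 + _ = (2 * (2 * B * cosh x)) ^+ 2 * (1 - z * sg x)); last first.
    (* The constant 2 B + 2 is multiplied by expR x * expR (- x) = 1; the two sides then differ by a
       multiple of that product minus 1. *)
    rewrite sgE /z /cosh; transitivity (4 * (expR x + expR (- x)) * (expR x + B ^+ 2 * expR (- x))).
      rewrite /F; transitivity (4 * (expR x - B * expR (- x)) ^+ 2 +
         (2 * B * (expR x * expR (- x)) + 2 * (expR x * expR (- x))) ^+ 2).
        by rewrite ee !mulr1.
      transitivity (4 * (expR x ^+ 2 + B ^+ 2 * expR (- x) ^+ 2 + (B ^+ 2 + 1) * (expR x * expR (- x)) +
        (B ^+2 + 2 * B + 1) * (expR x * expR (- x)) * (expR x * expR (- x) - 1))).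
        by ring.
      by rewrite ee subrr mulr0 addr0; transitivity (4 * (expR x ^+ 2 + B ^+ 2 * expR (- x) ^+ 2 + (B ^+ 2 + 1) * (expR x * expR (- x)))); [rewrite ee|ring].
    by field; rewrite !lt0r_neq0 // addr_gt0.
  rewrite sqrtr_sqr (sqrtrM _ (sqr_ge0 _)) sqrtr_sqr !gtr0_norm //; last first.
    by apply: mulr_gt0 => //; apply: mulr_gt0 (cosh_gt0 x); exact: mulr_gt0.
  have := cosh_gt0 x => c0; have S0 : 0 < Num.sqrt (1 - z * sg x) by rewrite sqrtr_gt0 subr_gt0.
  have := F'0 x => f0.
  by rewrite /sech; field; rewrite !lt0r_neq0.
- apply: continuousD; first exact: continuous_expR.
  by apply: continuousM.
- move=> y; exists (Num.truncn `|y + B|).+1; rewrite /F.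
  have := expR_ge1Dx ((Num.truncn `|y + B|).+1%:R : R).
  have := truncnS_gt `|y + B|; have := ler_norm (y + B).
  have : B * expR (- (Num.truncn `|y + B|).+1%:R) <= B.
    by rewrite ler_piMr ?(ltW B0) // expR_le1 oppr_le0.
  lra.
- move=> y; exists (Num.truncn `|y|).+1; rewrite /F opprK.
  have := expR_ge1Dx ((Num.truncn `|y|).+1%:R : R).
  have := truncnS_gt `|y|; have := ler_norm (- y); rewrite normrN.
  have : expR (- (Num.truncn `|y|).+1%:R) <= 1 :> R by rewrite expR_le1 oppr_le0.
  set m : R := (Num.truncn _).+1%:R; move: (expR (- m)) (expR m) => p q p1 h1 h2 h3.
  have : q <= B * q by rewrite ler_peMl //; have := normr_ge0 y; lra.
  lra.
Qed.

(** The sum is K(sqrt(1 - B^-2)) / B, with K the complete elliptic integral of the first kind. One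
    c_k comes from the expansion of (1 - z sg)^(-1/2), the other from [integral_logistic]. *)
Lemma integral_inv_sqrt_cosh :
  (\int[mu]_u ((Num.sqrt ((cosh u + 2 * B) ^+ 2 - 1))^-1)%:E =
   \sum_(k <oo) (pi / 2 * cbin k ^+ 2 * (B^-1 * (1 - B ^- 2) ^+ k))%:E)%E.
Proof.
rewrite -[LHS]/(\int[mu]_u (f u)%:E)%E integral_f integral_G -/z.
have /andP[z0 z1] := z01.
have csg : continuous sg.
  apply: continuousM => //; apply: continuousD => //; exact: continuous_tanh.
pose h k x : R := sg x ^+ k * sech x.
have h0 k x : 0 <= h k x.
  by rewrite mulr_ge0 ?exprn_ge0 ?(ltW (sech_gt0 x)) //; case/andP: (sg01 x).
have mh k : measurable_fun setT (fun x => (h k x)%:E).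
  apply/measurable_EFinP; apply: continuous_measurable_fun; apply: continuousM.
    exact: continuousX csg.
  exact: continuous_sech.
have c0 k : 0 <= cbin k * z ^+ k / (2 * B).
  by rewrite !mulr_ge0 ?exprn_ge0 ?(ltW (cbin_gt0 _)) // invr_ge0 mulr_ge0 // ltW.
transitivity (\int[mu]_x \sum_(k <oo) ((cbin k * z ^+ k / (2 * B))%:E * (h k x)%:E))%E.
  apply: eq_integral => x _; rewrite EFinM -binomial_series // -nneseriesZl; last first.
    by move=> k _; rewrite lee_fin mulr_ge0 ?exprn_ge0 ?(ltW (cbin_gt0 _)) //; case/andP: (zsg01 x).
  apply: eq_eseriesr => k _; rewrite -!EFinM /h exprMn; congr EFin; ring.
rewrite integral_nneseries //; last 2 first.
- by move=> k; apply: measurable_funeM; exact: mh.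
- by move=> k x _; rewrite -EFinM lee_fin mulr_ge0.
apply: eq_eseriesr => k _; rewrite ge0_integralZl_EFin //; last 2 first.
- by move=> x _; rewrite lee_fin.
- exact: mh.
rewrite integral_logistic -EFinM; congr EFin; rewrite -/z.
by field; rewrite gt_eqF.
Qed.

End Theta.

(** * The Bessel moment *)

Section BesselMoment.
Context {R : realType}.
Local Notation mu := (@lebesgue_measure R).
Implicit Types (t u r q : R) (k n : nat).

Let Pos : set R := `]0%R, +oo[%classic.

(** Tonelli with t > 0: the restriction is moved into the integrand as an indicator, so that both
    integrals run over the line. *)
Lemma integral_pos_swap (h : R -> \bar R) (g : R * R -> \bar R) :
  measurable_fun setT h -> (forall t, (0 <= h t)%E) ->
  measurable_fun setT g -> (forall z, (0 <= g z)%E) ->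
  (\int[mu]_(t in Pos) (h t * \int[mu]_y g (t, y)) =
   \int[mu]_y \int[mu]_(t in Pos) (h t * g (t, y)))%E.
Proof.
move=> mh h0 mg g0.
have mP : measurable Pos by exact: measurable_itv.
pose i t : \bar R := (\1_Pos t)%:E.
have i0 t : (0 <= i t)%E by rewrite lee_fin.
have mi : measurable_fun setT i by apply/measurable_EFinP; exact: measurable_indic.
have patchE (f : R -> \bar R) : (\int[mu]_(t in Pos) f t = \int[mu]_t (f t * i t))%E.
  by rewrite integral_mkcond epatch_indic.
have mg1 t : measurable_fun setT (fun y => g (t, y)) by exact: measurableT_comp.
transitivity (\int[mu]_t \int[mu]_y (h t * g (t, y) * i t))%E.
  rewrite patchE; apply: eq_integral => t _.
  rewrite ge0_integralZr //; last 2 first.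
  - by apply: measurable_funeM; exact: mg1.
  - by move=> y _; rewrite mule_ge0.
  by rewrite ge0_integralZl //; exact: mg1.
rewrite (@fubini_tonelli _ _ _ _ _ mu mu (fun z : R * R => h z.1 * g z * i z.1)%E).
- by apply: eq_integral => y _; rewrite patchE.
- apply: emeasurable_funM; last exact: measurableT_comp mi measurable_fst.
  by apply: emeasurable_funM => //; exact: measurableT_comp mh measurable_fst.
- by move=> z; rewrite !mule_ge0.
Qed.

(** The identity 1 - sech^2 r sech^2 q = tanh^2 q + sech^2 q tanh^2 r separates the variables in a
    binomial expansion, whose coefficients cancel those of the Beta integrals. *)
Lemma integral_cosh_moment k :
  (\int[mu]_r \int[mu]_q ((cosh r * cosh q)^-1 * (1 - (cosh r * cosh q) ^- 2) ^+ k)%:E =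
   (pi ^+ 2 * cauchy_prod (fun n => cbin n ^+ 2) cbin k)%:E)%E.
Proof.
pose f i j x : R := tanh x ^+ (2 * i) * sech x ^+ (2 * j).+1.
have f0 i j x : 0 <= f i j x.
  apply: mulr_ge0; first by rewrite exprn_even_ge0 ?oddM.
  by apply: exprn_ge0; rewrite ltW ?sech_gt0.
have mf i j : measurable_fun setT (fun x => (f i j x)%:E).
  apply/measurable_EFinP; apply: measurable_funM; apply: continuous_measurable_fun.
    exact: continuousX continuous_tanh.
  exact: continuousX continuous_sech.
pose c i : R := cbin i * cbin (k - i)%N * pi.
have c0 i : 0 <= c i by rewrite !mulr_ge0 ?pi_ge0 // ltW // cbin_gt0.
transitivity (\int[mu]_r \sum_(i < k.+1) ((c i)%:E * (f i 0%N r)%:E))%E.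
  apply: eq_integral => r _.
  transitivity (\int[mu]_q \sum_(i < k.+1)
      (('C(k, i)%:R * f i 0%N r)%:E * (f (k - i)%N i q)%:E))%E.
    apply: eq_integral => q _; under eq_bigr do rewrite -EFinM.
    rewrite sumEFin; congr EFin.
    have -> : 1 - (cosh r * cosh q) ^- 2 = tanh q ^+ 2 + sech q ^+ 2 * tanh r ^+ 2.
      transitivity (1 - sech r ^+ 2 * sech q ^+ 2).
        by rewrite -exprMn /sech -invfM exprVn.
      by rewrite -{1}(tanh2_sech2 q); have := tanh2_sech2 r => /(canRL (addrK _)) ->; ring.
    rewrite exprDn mulr_sumr; apply: eq_bigr => i _.
    rewrite invfM -/(sech r) -/(sech q) /f -mulr_natl.
    rewrite [(sech q ^+ 2 * _) ^+ i]exprMn -!exprM muln0 expr1 [sech q ^+ _.+1]exprS.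
    by ring.
  rewrite ge0_integral_sum //; last 2 first.
  - by move=> i; apply: measurable_funeM; exact: mf.
  - by move=> i q _; rewrite -EFinM lee_fin mulr_ge0 // mulr_ge0.
  apply: eq_bigr => i _; rewrite ge0_integralZl_EFin //; last 3 first.
  - by move=> q _; rewrite lee_fin.
  - exact: mf.
  - by rewrite mulr_ge0.
  rewrite integral_tanh_sech -!EFinM; congr EFin.
  have ik : (i <= k)%N by rewrite -ltnS.
  rewrite subnK // bin_sub // /c.
  have : 'C(k, i)%:R != 0 :> R by rewrite pnatr_eq0 -lt0n bin_gt0.
  by move=> ?; field.
rewrite ge0_integral_sum //; last 2 first.
- by move=> i; apply: measurable_funeM; exact: mf.
- by move=> i r _; rewrite -EFinM lee_fin mulr_ge0.
under eq_bigr => i _.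
  rewrite ge0_integralZl_EFin //; last 2 first.
  - by move=> r _; rewrite lee_fin.
  - exact: mf.
  rewrite integral_tanh_sech -EFinM; over.
rewrite sumEFin; congr EFin; rewrite /cauchy_prod mulr_sumr; apply: eq_bigr => i _.
by rewrite addn0 binn cbin0 /c; field.
Qed.

Lemma integral_besselIK3 :
  (\int[mu]_(t in Pos) (besselI t * (besselK t * (besselK t * besselK t))) =
   (pi ^+ 4 / 2 * limn (series (@weight R)))%:E)%E.
Proof.
have mP : measurable Pos by exact: measurable_itv.
have mIK : measurable_fun setT (fun t => besselI t * besselK t)%E.
  by apply: emeasurable_funM; [exact: measurable_besselI|exact: measurable_besselK].
have IK0 t : (0 <= besselI t * besselK t)%E by rewrite mule_ge0 ?besselI_ge0 ?besselK_ge0.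
have mKc : measurable_fun setT (fun z : R * R => besselK (2 * z.1 * cosh z.2)).
  apply: measurableT_comp measurable_besselK _.
  by apply: measurable_funM; [exact: measurable_funM|exact: measurable_fun_cosh].
have mexp (b : R) : measurable_fun setT (fun z : R * R => (expR (- (z.1 * b * cosh z.2)))%:E).
  apply/measurable_EFinP; apply: measurable_fun_expR; apply: measurable_funN.
  by apply: measurable_funM; [exact: measurable_funM|exact: measurable_fun_cosh].
have exp0 (x : R) : (0 <= (expR x)%:E)%E by rewrite lee_fin expR_ge0.
transitivity (2%:E * \int[mu]_(t in Pos)
    (besselI t * besselK t * \int[mu]_r besselK (2 * t * cosh r)))%E.
  rewrite -ge0_integralZl //.
  - by apply: eq_integral => t _; rewrite besselK_sqr !muleA; congr (_ * _)%E; rewrite muleC muleA.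
  - apply: emeasurable_funM; first exact: measurable_funTS.
    apply: measurable_funTS.
    apply: (@measurable_fun_fubini_tonelli_F _ _ _ _ _ mu
      (fun z : R * R => besselK (2 * z.1 * cosh z.2))) => // z.
    exact: besselK_ge0.
  - move=> t _; rewrite mule_ge0 //; apply: integral_ge0 => r _; exact: besselK_ge0.
rewrite (@integral_pos_swap _ (fun z => besselK (2 * z.1 * cosh z.2))) //; last first.
  by move=> z; exact: besselK_ge0.
pose b k r q : R := (cosh r * cosh q)^-1 * (1 - (cosh r * cosh q) ^- 2) ^+ k.
have B1 r q : 1 <= cosh r * cosh q by rewrite mulr_ege1 // cosh_ge1.
have b0 k r q : 0 <= b k r q.
  have B0 : 0 < cosh r * cosh q by exact: lt_le_trans (B1 r q).
  rewrite /b mulr_ge0 ?invr_ge0 ?(ltW B0) // exprn_ge0 // subr_ge0.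
  by rewrite invf_le1 ?exprn_gt0 // exprn_ege1.
pose c k : R := pi / 2 * cbin k ^+ 2.
have c0 k : 0 <= c k by rewrite mulr_ge0 ?divr_ge0 ?pi_ge0 // sqr_ge0.
have mb k : measurable_fun setT (fun z : R * R => (b k z.1 z.2)%:E).
  apply/measurable_EFinP.
  have ms : measurable_fun setT (fun z : R * R => (cosh z.1 * cosh z.2)^-1).
    have -> : (fun z : R * R => (cosh z.1 * cosh z.2)^-1) = (fun z => sech z.1 * sech z.2).
      by apply/funext => z; rewrite invfM.
    have msech : measurable_fun setT (@sech R).
      exact: continuous_measurable_fun continuous_sech.
    by apply: measurable_funM; exact: measurableT_comp msech _.
  apply: measurable_funM => //; apply: measurable_funX; apply: measurable_funB => //.
  by under eq_fun do rewrite -exprVn; exact: measurable_funX.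
have mbq k r : measurable_fun setT (fun q => (b k r q)%:E).
  exact: measurableT_comp (mb k) (measurable_pair1 r).
(* The exponents add up to - t (cosh u + 2 B) with B = cosh r cosh q: integrating over t is the
   Laplace transform of I_0, and integrating over u is [integral_inv_sqrt_cosh]. *)
transitivity (2%:E * \int[mu]_r \int[mu]_q \sum_(k <oo) ((c k)%:E * (b k r q)%:E))%E.
  congr (_ * _)%E; apply: eq_integral => r _.
  transitivity (\int[mu]_(t in Pos) (besselI t * besselK t *
      \int[mu]_q (expR (- (t * (2 * cosh r) * cosh q)))%:E))%E.
    by apply: eq_integral => t _; rewrite /= /besselK (_ : 2 * t * cosh r = t * (2 * cosh r)) //; ring.
  rewrite (@integral_pos_swap _ (fun z => (expR (- (z.1 * (2 * cosh r) * cosh z.2)))%:E)) //.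
  apply: eq_integral => q _.
  transitivity (\int[mu]_(t in Pos) (besselI t * (expR (- (t * (2 * cosh r) * cosh q)))%:E *
      \int[mu]_u (expR (- (t * 1 * cosh u)))%:E))%E.
    apply: eq_integral => t _; rewrite /= -!muleA; congr (_ * _)%E; rewrite muleC; congr (_ * _)%E.
    by apply: eq_integral => u _; rewrite mulr1.
  rewrite (@integral_pos_swap _ (fun z => (expR (- (z.1 * 1 * cosh z.2)))%:E)) //; last 2 first.
  - apply: emeasurable_funM; first exact: measurable_besselI.
    apply/measurable_EFinP; apply: measurable_fun_expR; apply: measurable_funN.
    by apply: measurable_funM => //; exact: measurable_funM.
  - by move=> t; rewrite mule_ge0 ?besselI_ge0.
  under [RHS]eq_eseriesr do rewrite -EFinM.
  rewrite -integral_inv_sqrt_cosh //; apply: eq_integral => u _.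
  rewrite -laplace_besselI; last by have := cosh_ge1 u; have := B1 r q; lra.
  apply: eq_integral => t _; rewrite /= -muleA -EFinM -expRD; congr (_ * (expR _)%:E)%E.
  by ring.
under eq_integral => r _.
  rewrite integral_nneseries //; last 2 first.
  - by move=> k; apply: measurable_funeM; exact: mbq.
  - by move=> k q _; rewrite -EFinM lee_fin mulr_ge0.
  under eq_eseriesr => k _.
    rewrite ge0_integralZl_EFin //; last 2 first.
    - by move=> q _; rewrite lee_fin.
    - exact: mbq.
    over.
  over.
have mbr k : measurable_fun setT (fun r => \int[mu]_q (b k r q)%:E)%E.
  apply: (@measurable_fun_fubini_tonelli_F _ _ _ _ _ mu (fun z : R * R => (b k z.1 z.2)%:E)).
    exact: mb.
  by move=> z; rewrite lee_fin.
have br0 k r : (0 <= \int[mu]_q (b k r q)%:E)%E by apply: integral_ge0 => q _; rewrite lee_fin.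
rewrite integral_nneseries //; last 2 first.
- by move=> k; apply: measurable_funeM; exact: mbr.
- by move=> k r _; rewrite mule_ge0 // lee_fin.
transitivity (2%:E * \sum_(k <oo) ((pi ^+ 3 / 2 : R)%:E *
   (cbin k ^+ 2 * cauchy_prod (fun n => cbin n ^+ 2) cbin k)%:E))%E.
  congr (_ * _)%E; apply: eq_eseriesr => k _.
  rewrite ge0_integralZl_EFin //; last exact: mbr.
  by rewrite /b integral_cosh_moment -!EFinM /c; congr EFin; field.
rewrite nneseriesZl; last first.
  move=> k _; rewrite lee_fin mulr_ge0 ?sqr_ge0 //; apply: sumr_ge0 => i _.
  by rewrite mulr_ge0 ?sqr_ge0 // ltW // cbin_gt0.
by rewrite cauchy_prod_weight -!EFinM; congr EFin; field.
Qed.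

Lemma s40E : s40 R = pi ^+ 4 / 16 * limn (series (@weight R)).
Proof.
rewrite /s40 /Rintegral.
(* The factor 1/8 appears because [besselK] is twice K_0. *)
have -> : (\int[mu]_(t in `]0%R, +oo[) (besselI0 t * besselK0 t ^+ 3)%:E =
   \int[mu]_(t in Pos) ((8^-1 : R)%:E * (besselI t * (besselK t * (besselK t * besselK t)))))%E.
  apply: eq_integral => t; rewrite inE /= in_itv /= andbT => t0.
  by rewrite besselIE besselKE // -!EFinM; congr EFin; field.
have mK := @measurable_besselK R.
rewrite ge0_integralZl_EFin //; last 3 first.
- exact: measurable_itv.
- by move=> t _; rewrite !mule_ge0 ?besselI_ge0 ?besselK_ge0.
- apply: measurable_funTS; apply: emeasurable_funM; first exact: measurable_besselI.
  by apply: emeasurable_funM => //; exact: emeasurable_funM.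
by rewrite integral_besselIK3 -EFinM /=; field.
Qed.

End BesselMoment.

Theorem corollary6p4 (R : realType) :
  series (fun n : nat =>
    (4 * n + 1)%:R * ('C(2 * n, n)%:R ^+ 6 / 2 ^+ (12 * n)) *
    (64 * harmonic_number R 7 (2 * n)
     - (8 * harmonic_number R 3 (2 * n) - zeta R 3)
       * (8 * harmonic_number R 4 (2 * n) - harmonic_number R 4 n)))
    @ \oo --> 8 * zeta R 7 / pi ^+ 4 * s40 R.
Proof.
have -> : 8 * zeta R 7 / pi ^+ 4 * s40 R = zeta R 7 / 2 * limn (series (@weight R)).
  rewrite s40E; move: (lt0r_neq0 (pi_gt0 R)); move: (pi : R) => p p0.
  by field.
apply: cvg_trans (@weighted_harmonic_sum R); apply: near_eq_cvg; apply: nearW => N.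
apply: eq_bigr => n _; congr (_ * _); rewrite /weight /cbin natrD natrM expr_div_n -exprM.
congr (_ * (_ / _)); rewrite (_ : 4 = 2 ^+ 2 :> R); last by ring.
by rewrite -exprM; congr (_ ^+ _); lia.
Qed.
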